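(* Let $\ell$ be a nonzero complex number. For every $\alpha\in\mathfrak{h}$, $V_{\mathcal{A}}\otimes M(1,\alpha)$ is a module for the vertex algebra $V_{\widehat{H}_4}(\ell,0)$ and an $\widehat{H}_4$-module of level $\ell$ (i.e. $\mathbf{k}\in\widehat{H}_4$ acts as the scalar $\ell$), where the generating fields of $\widehat{H}_4$ act by $$a(x)\mapsto\beta(x),\quad b(x)\mapsto \ell\gamma'(x)+p(x)\gamma(x),\quad c(x)\mapsto p(x),\quad d(x)\mapsto \ell q(x)+\tfrac{1}{2}\ell^{-1}p(x)-{:}\beta(x)\gamma(x){:}\,.$$
   Context: Nappi-Witten algebra: $H_4=\mathbb{C}a\oplus\mathbb{C}b\oplus\mathbb{C}c\oplus\mathbb{C}d$ with $[a,b]=c$, $[d,a]=a$, $[d,b]=-b$, $[c,d]=[c,a]=[c,b]=0$, and symmetric invariant form $(a,b)=(c,d)=1$, other pairings of basis vectors $0$. Its affinization is $\widehat{H}_4=H_4\otimes\mathbb{C}[t,t^{-1}]\oplus\mathbb{C}\mathbf{k}$, $[h_1\otimes t^m,h_2\otimes t^n]=[h_1,h_2]\otimes t^{m+n}+m(h_1,h_2)\delta_{m+n,0}\mathbf{k}$, $\mathbf{k}$ central. For $h\in H_4$, $h(n)$ denotes the action of $h\otimes t^n$ and $h(x)=\sum_{n\in\mathbb{Z}}h(n)x^{-n-1}$. Let $V_{\widehat{H}_4}(\ell,0)=U(\widehat{H}_4)\otimes_{U(H_4\otimes\mathbb{C}[t]\oplus\mathbb{C}\mathbf{k})}\mathbb{C}\mathbf{1}$,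 where $H_4\otimes\mathbb{C}[t]$ acts on $\mathbf{1}$ as $0$ and $\mathbf{k}$ as $\ell$; it has the unique vertex algebra structure with vacuum $\mathbf{1}$ and $Y(h(-1)\mathbf{1},x)=h(x)$ for $h\in H_4$. Weyl algebra: $\mathcal{A}$ has generators $\beta(n),\gamma(n)$ ($n\in\mathbb{Z}$) and a central element $\mathbf{k}$, with $[\beta(m),\gamma(n)]=\delta_{m+n,0}\mathbf{k}$, $[\gamma(m),\gamma(n)]=[\beta(m),\beta(n)]=0$. $V_{\mathcal{A}}$ is the irreducible $\mathcal{A}$-module generated by $\mathbf{1}$ with $\mathbf{k}=\mathrm{id}$, $\beta(n)\mathbf{1}=0$ for $n\ge0$, $\gamma(n)\mathbf{1}=0$ for $n>0$. It is a vertex algebra with $Y(\beta(-1)\mathbf{1},x)=\beta(x)=\sum_n\beta(n)x^{-n-1}$ and $Y(\gamma(0)\mathbf{1},x)=\gamma(x)=\sum_n\gamma(n)x^{-n}$; $\gamma'(x)=\frac{d}{dx}\gamma(x)$ and ${:}\ {:}$ denotes normal ordering. Heisenberg algebra: $\mathfrak{h}=\mathbb{C}p\oplus\mathbb{C}q$ is abelian with symmetric form $(p,q)=1$, $(p,p)=(q,q)=0$; $\widehat{\mathfrak{h}}=\mathfrak{h}\otimes\mathbb{C}[t,t^{-1}]\oplus\mathbb{C}\mathbf{c}$ with $[\alpha_1\otimes t^m,\alpha_2\otimes t^n]=m(\alpha_1,\alpha_2)\delta_{m+n,0}\mathbf{c}$, $\mathbf{c}$ central. For $\alpha\in\mathfrak{h}$,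 $M(1,\alpha)=U(\widehat{\mathfrak{h}})\otimes_{U(\mathfrak{h}\otimes\mathbb{C}[t]\oplus\mathbb{C}\mathbf{c})}\mathbb{C}$, where on $\mathbb{C}$ the subalgebra $\mathfrak{h}\otimes t\mathbb{C}[t]$ acts as $0$, $h\in\mathfrak{h}$ acts as $(h,\alpha)$ and $\mathbf{c}$ acts as $1$. $M(1)=M(1,0)$ is the Heisenberg vertex operator algebra and $M(1,\alpha)$ is an $M(1)$-module; $p(x)=\sum_n p(n)x^{-n-1}$, $q(x)=\sum_n q(n)x^{-n-1}$, with $p(n),q(n)$ the actions of $p\otimes t^n,q\otimes t^n$. *)

(* Defs.v *)
From HB Require Import structures.
From mathcomp Require Import all_boot all_order all_algebra.
From mathcomp Require Import finmap monalg complex.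
From mathcomp Require Import ring.
From mathcomp Require Import boolp classical_sets fsbigop reals.

Set Implicit Arguments.
Unset Strict Implicit.
Unset Printing Implicit Defensive.

Import Order.TTheory GRing.Theory Num.Theory.
Local Open Scope classical_set_scope.
Local Open Scope ring_scope.

(* [{malg K[X]}] is the free K-module on X; [lin_ext F] is the linear map
   extending F. *)
Section LinExt.
Variables (K : fieldType) (X : choiceType) (V : lmodType K).

Definition lin_ext (F : X -> V) (f : {malg K[X]}) : V :=
  \sum_(k <- msupp f) f@_k *: F k.

Lemma lin_extEw (F : X -> V) (D : {fset X}) (f : {malg K[X]}) :
  (msupp f `<=` D)%fset -> lin_ext F f = \sum_(k <- D) f@_k *: F k.
Proof.
move=> sfD; rewrite /lin_ext; apply: big_fset_incl => // k _ kf.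
by rewrite mcoeff_outdom // scale0r.
Qed.

Lemma lin_ext_linear (F : X -> V) : linear (lin_ext F).
Proof.
move=> c f g.
set D := (msupp f `|` msupp g `|` msupp (c *: f + g))%fset.
rewrite !(@lin_extEw F D) /D; last 3 first.
- exact: fsubset_trans (fsubsetUr _ _) (fsubsetUl _ _).
- exact: fsubset_trans (fsubsetUl _ _) (fsubsetUl _ _).
- exact: fsubsetUr.
rewrite scaler_sumr -big_split /=; apply: eq_bigr => k _.
by rewrite mcoeffD mcoeffZ scalerDl scalerA.
Qed.

Lemma lin_extU (F : X -> V) (k : X) : lin_ext F << k >> = F k.
Proof.
rewrite (@lin_extEw F [fset k]%fset) ?msuppU_le //.
by rewrite big_seq_fset1 mcoeffUU scale1r.
Qed.

End LinExt.

Section Quotient.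
Variables (K : fieldType) (V : lmodType K) (S : set V).

Inductive lspan : V -> Prop :=
| lspan_gen v : S v -> lspan v
| lspan_zero : lspan 0
| lspan_lin c u v : lspan u -> lspan v -> lspan (c *: u + v).

Fact lspan_trans a b c d :
  lspan (a - d - c) -> lspan (d - b) -> lspan (a - (b + c)).
Proof.
have -> : a - (b + c) = 1 *: (a - d - c) + (d - b).
  by rewrite scale1r [RHS]addrACA subrK -opprD [c + b]addrC.
exact: lspan_lin.
Qed.

Definition lspan_pred : {pred V} := fun v => `[< lspan v >].

Fact lspan_zmod_closed : zmod_closed lspan_pred.
Proof.
split=> [|u v]; first exact/asboolP/lspan_zero.
move=> /asboolP hu /asboolP hv; apply/asboolP.
by rewrite addrC -scaleN1r; apply: lspan_lin.
Qed.

HB.instance Definition _ :=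
  GRing.isZmodClosed.Build V lspan_pred lspan_zmod_closed.

(* V / span S *)
Definition lquot : Type := Quotient.quot lspan_pred.
HB.instance Definition _ := GRing.Zmodule.on lquot.

Definition lproj (v : V) : lquot := \pi_(Quotient.quot lspan_pred)%qT v.
Definition lrepr (x : lquot) : V := repr (x : (Quotient.quot lspan_pred)).

Lemma lreprK x : lproj (lrepr x) = x.
Proof. exact: reprK. Qed.

Lemma lproj_eq u v : lproj u = lproj v <-> lspan (u - v).
Proof.
rewrite /lproj; split.
  by move=> /eqP; rewrite -Quotient.idealrBE => /asboolP.
by move=> h; apply/eqP; rewrite -Quotient.idealrBE; apply/asboolP.
Qed.

Lemma lprojD u v : lproj (u + v) = lproj u + lproj v.
Proof. by rewrite /lproj !piE. Qed.

Lemma lproj0 : lproj 0 = 0.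
Proof. by apply: (addrI (lproj 0)); rewrite -lprojD !addr0. Qed.

Definition lquot_scale (c : K) (x : lquot) : lquot := lproj (c *: lrepr x).

Lemma lquot_scaleE c v : lquot_scale c (lproj v) = lproj (c *: v).
Proof.
apply/lproj_eq; rewrite -scalerBr -[_ *: _]addr0.
by apply: lspan_lin; [apply/lproj_eq; rewrite lreprK | apply: lspan_zero].
Qed.

Fact lquot_scaleA a b v :
  lquot_scale a (lquot_scale b v) = lquot_scale (a * b) v.
Proof. by rewrite -[v]lreprK !lquot_scaleE scalerA. Qed.
Fact lquot_scale1 : left_id 1 lquot_scale.
Proof. by move=> v; rewrite -[v]lreprK lquot_scaleE scale1r. Qed.
Fact lquot_scaleDr : right_distributive lquot_scale +%R.
Proof.
move=> c u v; rewrite -[u]lreprK -[v]lreprK.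
by rewrite -lprojD !lquot_scaleE scalerDr lprojD.
Qed.
Fact lquot_scaleDl v : {morph lquot_scale^~ v : a b / a + b}.
Proof.
by move=> a b; rewrite -[v]lreprK !lquot_scaleE scalerDl lprojD.
Qed.
HB.instance Definition _ := GRing.Zmodule_isLmodule.Build K lquot
  lquot_scaleA lquot_scale1 lquot_scaleDr lquot_scaleDl.

Lemma lproj_linear : linear lproj.
Proof. by move=> c u v; rewrite lprojD -lquot_scaleE. Qed.

Lemma lquot_lift (W : lmodType K) (f : V -> W) :
  linear f -> (forall v, S v -> f v = 0) ->
  forall v, f (lrepr (lproj v)) = f v.
Proof.
move=> flin fS v.
have f0 u : lspan u -> f u = 0.
  elim=> {u} [u /fS //||c u w _ fu _ fw].
    by have := flin (-1) 0 0; rewrite scaler0 addr0 scaleN1r addNr.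
  by rewrite flin fu fw scaler0 addr0.
have fB u w : f (u - w) = f u - f w.
  by rewrite addrC -scaleN1r flin scaleN1r addrC.
by apply/eqP; rewrite -subr_eq0 -fB f0 //; apply/lproj_eq; rewrite lreprK.
Qed.

Lemma lquot_lift_linear (W : lmodType K) (f : V -> W) :
  linear f -> (forall v, S v -> f v = 0) -> linear (fun x => f (lrepr x)).
Proof.
move=> flin fS c x y; rewrite -[x]lreprK -[y]lreprK -lproj_linear.
by rewrite !lquot_lift // flin.
Qed.

End Quotient.

(* U \otimes_A N, where B indexes a family generating the algebra A, which acts
   on the right of U by r and on the left of N by s. *)
Section BalancedTensor.
Variables (K : fieldType) (U N : lmodType K) (B : Type).
Variables (r : U -> B -> U) (s : B -> N -> N).

Inductive btens_rel : {malg K[(U * N)%type]} -> Prop :=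
| btens_addl u u' n :
    btens_rel (<< (u + u', n) >> - << (u, n) >> - << (u', n) >>)
| btens_addr u n n' :
    btens_rel (<< (u, n + n') >> - << (u, n) >> - << (u, n') >>)
| btens_scall c u n : btens_rel (<< (c *: u, n) >> - c *: << (u, n) >>)
| btens_scalr c u n : btens_rel (<< (u, c *: n) >> - c *: << (u, n) >>)
| btens_bal b u n : btens_rel (<< (r u b, n) >> - << (u, s b n) >>).

Definition btens := lquot btens_rel.
HB.instance Definition _ := GRing.Lmodule.on btens.

Definition btens_pure (u : U) (n : N) : btens := lproj btens_rel << (u, n) >>.

Lemma btens_pure_linearl n : linear (btens_pure^~ n).
Proof.
move=> c u u'; rewrite /btens_pure -lproj_linear; apply/lproj_eq.
by apply: lspan_trans; apply: lspan_gen; [apply: btens_addl | apply: btens_scall].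
Qed.

Lemma btens_pure_linearr u : linear (btens_pure u).
Proof.
move=> c n n'; rewrite /btens_pure -lproj_linear; apply/lproj_eq.
by apply: lspan_trans; apply: lspan_gen; [apply: btens_addr | apply: btens_scalr].
Qed.

Lemma btens_pure_bal b u n : btens_pure (r u b) n = btens_pure u (s b n).
Proof. by apply/lproj_eq; apply: lspan_gen; apply: btens_bal. Qed.

(* The linear map u \otimes n |-> F u n, when F is bilinear and balanced. *)
Definition btens_lift (W : lmodType K) (F : U -> N -> W) (t : btens) : W :=
  lin_ext (fun un => F un.1 un.2) (lrepr t).

Section Lift.
Variables (W : lmodType K) (F : U -> N -> W).
Hypothesis Fl : forall n, linear (F^~ n).
Hypothesis Fr : forall u, linear (F u).
Hypothesis Fb : forall b u n, F (r u b) n = F u (s b n).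

Fact btens_lift_rel f :
  btens_rel f -> lin_ext (fun un => F un.1 un.2) f = 0.
Proof.
set G := (fun un : U * N => F un.1 un.2).
have Gl := lin_ext_linear G.
have GD x y : lin_ext G (x + y) = lin_ext G x + lin_ext G y.
  by rewrite -[x in LHS]scale1r Gl scale1r.
have G0 : lin_ext G 0 = 0.
  by have := Gl (-1) 0 0; rewrite scaler0 addr0 scaleN1r addNr.
have GZ c x : lin_ext G (c *: x) = c *: lin_ext G x.
  by rewrite -[c *: x]addr0 Gl G0 addr0.
have GB x y : lin_ext G (x - y) = lin_ext G x - lin_ext G y.
  by rewrite GD -[- y]scaleN1r GZ scaleN1r.
have FlD a b m : F (a + b) m = F a m + F b m.
  by rewrite -[a in LHS]scale1r (Fl m) scale1r.
have FrD a m m' : F a (m + m') = F a m + F a m'.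
  by rewrite -[m in LHS]scale1r (Fr a) scale1r.
have Fl0 m : F 0 m = 0.
  by have := Fl m (-1) 0 0; rewrite scaler0 addr0 scaleN1r addNr.
have Fr0 a : F a 0 = 0.
  by have := Fr a (-1) 0 0; rewrite scaler0 addr0 scaleN1r addNr.
case=> [a a' m|a m m'|c a m|c a m|b a m]; rewrite !GB ?GZ !lin_extU /G /=.
- by rewrite FlD -addrA -opprD subrr.
- by rewrite FrD -addrA -opprD subrr.
- by rewrite -[c *: a]addr0 (Fl m) Fl0 addr0 subrr.
- by rewrite -[c *: m]addr0 (Fr a) Fr0 addr0 subrr.
- by rewrite Fb subrr.
Qed.

Lemma btens_liftE u n : btens_lift F (btens_pure u n) = F u n.
Proof.
rewrite /btens_lift /btens_pure lquot_lift ?lin_extU //.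
- exact: lin_ext_linear.
- exact: btens_lift_rel.
Qed.

Lemma btens_lift_linear : linear (btens_lift F).
Proof.
apply: lquot_lift_linear; first exact: lin_ext_linear.
exact: btens_lift_rel.
Qed.

End Lift.

Lemma btens_ind (P : btens -> Prop) :
  P 0 -> (forall x y, P x -> P y -> P (x + y)) ->
  (forall u n, P (btens_pure u n)) -> forall t, P t.
Proof.
move=> P0 PD Pp t; rewrite -[t]lreprK [lrepr t]monalgE.
elim/big_ind: _ => [|x y Px Py|[u n] _]; first by rewrite lproj0.
  by rewrite lprojD; apply: PD.
have -> : << (lrepr t)@_(u, n) *g (u, n) >> =
    (lrepr t)@_(u, n) *: << (u, n) >> :> {malg K[(U * N)%type]}.
  by apply/malgP => k; rewrite mcoeffZ !mcoeffU mulrnAr mulr1.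
have -> : lproj btens_rel ((lrepr t)@_(u, n) *: << (u, n) >>) =
    btens_pure ((lrepr t)@_(u, n) *: u) n; last exact: Pp.
apply/esym/lproj_eq; apply: lspan_gen; exact: btens_scall.
Qed.

End BalancedTensor.

Definition tens (K : fieldType) (V W : lmodType K) : lmodType K :=
  btens (fun (v : V) (_ : void) => v) (fun (_ : void) (w : W) => w).

Definition tens_pure (K : fieldType) (V W : lmodType K) (v : V) (w : W) :
  tens V W := btens_pure _ _ v w.

Notation "v ⊗ w" := (tens_pure v w) (at level 40, left associativity).

HB.mixin Record isLieAlgebra (K : fieldType) L of GRing.Lmodule K L := {
  lie : L -> L -> L;
  lie_linearl : forall y, linear (lie^~ y);
  lie_linearr : forall x, linear (lie x);
  lie_alt : forall x, lie x x = 0;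
  lie_jacobi : forall x y z,
    lie x (lie y z) + lie y (lie z x) + lie z (lie x y) = 0
}.
#[short(type="lieAlgType")]
HB.structure Definition LieAlgebra (K : fieldType) :=
  {L of GRing.Lmodule K L & isLieAlgebra K L}.

HB.mixin Record hasInvariantForm (K : fieldType) L of LieAlgebra K L := {
  form : L -> L -> K;
  form_linearl : forall y, scalar (form^~ y);
  form_sym : forall x y, form x y = form y x;
  form_inv : forall x y z : L, form (lie x y) z = form x (lie y z)
}.
#[short(type="quadLieAlgType")]
HB.structure Definition QuadLieAlgebra (K : fieldType) :=
  {L of LieAlgebra K L & hasInvariantForm K L}.

Definition lie_module (K : fieldType) (L : lieAlgType K) (W : lmodType K)
    (rho : L -> W -> W) : Prop :=
  [/\ forall x, linear (rho x),
      forall w, linear (rho^~ w)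
    & forall x y w, rho (lie x y) w = rho x (rho y w) - rho y (rho x w)].

Section AlgebraQuotient.
Variables (K : fieldType) (A : algType K) (S : set A).

Definition ideal_gens : set A :=
  [set z | exists a r b, S r /\ z = a * r * b].

(* [lspan ideal_gens] is the two-sided ideal generated by S. *)
Fact ideal_mull a z : lspan ideal_gens z -> lspan ideal_gens (a * z).
Proof.
elim=> {z} [z [b [r [d [hr ->]]]]||c u v _ hu _ hv].
- by apply: lspan_gen; exists (a * b), r, d; rewrite !mulrA.
- by rewrite mulr0; apply: lspan_zero.
- by rewrite mulrDr -scalerAr; apply: lspan_lin.
Qed.

Fact ideal_mulr a z : lspan ideal_gens z -> lspan ideal_gens (z * a).
Proof.
elim=> {z} [z [b [r [d [hr ->]]]]||c u v _ hu _ hv].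
- by apply: lspan_gen; exists b, r, (d * a); rewrite !mulrA.
- by rewrite mul0r; apply: lspan_zero.
- by rewrite mulrDl -scalerAl; apply: lspan_lin.
Qed.

Hypothesis proper : ~ lspan ideal_gens 1.

(* A / (S) *)
Definition aquot of ~ lspan ideal_gens 1 : Type := lquot ideal_gens.
Local Notation Q := (aquot proper).
HB.instance Definition _ := GRing.Lmodule.on Q.

Definition aproj (a : A) : Q := lproj ideal_gens a.
Definition arepr (x : Q) : A := lrepr x.
Fact areprK x : aproj (arepr x) = x. Proof. exact: lreprK. Qed.
Lemma aproj_linear : linear aproj. Proof. exact: lproj_linear. Qed.
Lemma aproj_eq a b : aproj a = aproj b <-> lspan ideal_gens (a - b).
Proof. exact: lproj_eq. Qed.

Definition aquot_one : Q := aproj 1.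
Definition aquot_mul (x y : Q) : Q := aproj (arepr x * arepr y).

Fact aquot_mulE a b : aquot_mul (aproj a) (aproj b) = aproj (a * b).
Proof.
apply/aproj_eq; set a' := arepr _; set b' := arepr _.
have -> : a' * b' - a * b = 1 *: (a' * (b' - b)) + (a' - a) * b.
  by rewrite scale1r mulrBr mulrBl addrA subrK.
apply: lspan_lin.
  by apply: ideal_mull; apply/aproj_eq; rewrite areprK.
by apply: ideal_mulr; apply/aproj_eq; rewrite areprK.
Qed.

Fact aprojD a b : aproj (a + b) = aproj a + aproj b.
Proof. exact: lprojD. Qed.
Fact aprojB a b : aproj (a - b) = aproj a - aproj b.
Proof. by rewrite addrC -scaleN1r aproj_linear scaleN1r addrC. Qed.
Fact aprojZ c a : aproj (c *: a) = c *: aproj a.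
Proof. exact: (esym (lquot_scaleE _ _ _)). Qed.

Fact aquot_mulA : associative aquot_mul.
Proof.
move=> x y z; rewrite -[x]areprK -[y]areprK -[z]areprK.
by rewrite !aquot_mulE mulrA.
Qed.
Fact aquot_mul1 : left_id aquot_one aquot_mul.
Proof. by move=> x; rewrite -[x]areprK aquot_mulE mul1r. Qed.
Fact aquot_mulr1 : right_id aquot_one aquot_mul.
Proof. by move=> x; rewrite -[x]areprK aquot_mulE mulr1. Qed.
Fact aquot_mulDl : left_distributive aquot_mul +%R.
Proof.
move=> x y z; rewrite -[x]areprK -[y]areprK -[z]areprK.
by rewrite -aprojD !aquot_mulE mulrDl aprojD.
Qed.
Fact aquot_mulDr : right_distributive aquot_mul +%R.
Proof.
move=> x y z; rewrite -[x]areprK -[y]areprK -[z]areprK.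
by rewrite -aprojD !aquot_mulE mulrDr aprojD.
Qed.
Fact aquot_one_neq0 : aquot_one != 0.
Proof.
apply/eqP => h; apply: proper; rewrite -[1]subr0; apply/aproj_eq.
by rewrite -/aquot_one h; apply/esym/lproj0.
Qed.

HB.instance Definition _ := GRing.Zmodule_isNzRing.Build Q
  aquot_mulA aquot_mul1 aquot_mulr1 aquot_mulDl aquot_mulDr aquot_one_neq0.

Lemma aprojM a b : aproj (a * b) = aproj a * aproj b.
Proof. by rewrite [RHS]aquot_mulE. Qed.

Fact aquot_scaleAl (c : K) (x y : Q) : c *: (x * y) = (c *: x) * y.
Proof.
rewrite -[x]areprK -[y]areprK.
by rewrite -aprojM -!aprojZ -aprojM scalerAl.
Qed.
HB.instance Definition _ := GRing.Lmodule_isLalgebra.Build K Q aquot_scaleAl.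
Fact aquot_scaleAr (c : K) (x y : Q) : c *: (x * y) = x * (c *: y).
Proof.
rewrite -[x]areprK -[y]areprK.
by rewrite -aprojM -!aprojZ -aprojM scalerAr.
Qed.
HB.instance Definition _ := GRing.Lalgebra_isAlgebra.Build K Q aquot_scaleAr.

End AlgebraQuotient.

Section FreeAlgebra.
Variables (K : fieldType) (X : choiceType).

(* The free unital associative K-algebra on X. *)
Definition free_alg : Type := {malg K[{fmonom X}]}.
HB.instance Definition _ := GRing.Lalgebra.on free_alg.

Definition fgen (x : X) : free_alg := << fmu x >>.

Fact malg_scalerAr (M : monomType) (c : K) (a b : {malg K[M]}) :
  c *: (a * b) = a * (c *: b).
Proof.
rewrite (@malgMEw _ _ (msupp a) (msupp b) a (c *: b)) ?msuppZ_le //.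
rewrite malgME scaler_sumr; apply: eq_bigr => i _.
rewrite scaler_sumr; apply: eq_bigr => j _.
apply/malgP => k; rewrite mcoeffZ; move: (mmul i j) => ij.
by rewrite !mcoeffU mcoeffZ mulrCA mulrnAr.
Qed.
HB.instance Definition _ := GRing.Lalgebra_isAlgebra.Build K free_alg
  (@malg_scalerAr {fmonom X}).

(* The augmentation x |-> 0. *)
Definition feps (z : free_alg) : K := z@_(mone).

Fact feps_gen x : feps (fgen x) = 0.
Proof.
rewrite /feps mcoeffU; case: eqP => // /(congr1 (@fdeg _)).
by rewrite /fdeg fmuE fm1.
Qed.
Fact fepsB u v : feps (u - v) = feps u - feps v.
Proof. exact: mcoeffB. Qed.
Fact fepsM u v : feps (u * v) = feps u * feps v.
Proof. exact: (rmorphM (@mcoeff {fmonom X} K mone)). Qed.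
Fact fepsZ c u : feps (c *: u) = c * feps u.
Proof. exact: mcoeffZ. Qed.
Fact feps1 : feps 1 = 1.
Proof. exact: (rmorph1 (@mcoeff {fmonom X} K mone)). Qed.

Fact feps_proper (S : set free_alg) :
  (forall z, S z -> feps z = 0) -> ~ lspan (ideal_gens S) 1.
Proof.
move=> hS; have eps0 z : lspan (ideal_gens S) z -> feps z = 0.
  elim=> {z} [z [b [r [d [hr ->]]]]||c u v _ hu _ hv].
  - by rewrite !fepsM (hS r) // mulr0 mul0r.
  - exact: mcoeff0.
  - by rewrite -[v]opprK fepsB (fepsZ c) -scaleN1r (fepsZ (-1)) hu hv !mulr0 subr0.
by move=> /eps0/eqP; rewrite feps1 oner_eq0.
Qed.

End FreeAlgebra.

Section Enveloping.
Variables (K : fieldType) (L : lieAlgType K).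

Section Relations.
Variables (A : algType K) (gen : L -> A).

(* The relations making gen a linear map of Lie algebras L -> A. *)
Inductive uenv_rel : A -> Prop :=
| uenv_add x y : uenv_rel (gen (x + y) - gen x - gen y)
| uenv_scale c x : uenv_rel (gen (c *: x) - c *: gen x)
| uenv_lie x y : uenv_rel (gen x * gen y - gen y * gen x - gen (lie x y)).

Hypothesis proper : ~ lspan (ideal_gens uenv_rel) 1.

Fact uenv_rel_ideal z : uenv_rel z -> lspan (ideal_gens uenv_rel) z.
Proof.
by move=> hz; apply: lspan_gen; exists 1, z, 1; rewrite mul1r mulr1.
Qed.

Fact uenv_linear_subproof : linear (fun x => aproj proper (gen x)).
Proof.
move=> c x y; rewrite -aproj_linear; apply/aproj_eq.
apply: (@lspan_trans _ _ _ _ _ _ (gen (c *: x))).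
  exact/uenv_rel_ideal/uenv_add.
exact/uenv_rel_ideal/uenv_scale.
Qed.

Fact uenv_lie_subproof x y : aproj proper (gen (lie x y)) =
  aproj proper (gen x) * aproj proper (gen y)
  - aproj proper (gen y) * aproj proper (gen x).
Proof.
rewrite -!aprojM -aprojB; apply/esym/aproj_eq.
exact/uenv_rel_ideal/uenv_lie.
Qed.

End Relations.

Fact uenv_proper : ~ lspan (ideal_gens (uenv_rel (@fgen K L))) 1.
Proof.
have feps0B (u v : free_alg K L) : feps u = 0 -> feps v = 0 -> feps (u - v) = 0.
  by move=> hu hv; rewrite fepsB hu hv subr0.
have feps0M (u v : free_alg K L) : feps u = 0 -> feps (u * v) = 0.
  by move=> hu; rewrite fepsM hu mul0r.
have feps0Z c (u : free_alg K L) : feps u = 0 -> feps (c *: u) = 0.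
  by move=> hu; rewrite fepsZ hu mulr0.
apply: feps_proper => _ [x y|c x|x y].
- by apply: (@feps0B); [apply: (@feps0B)|]; apply: feps_gen.
- by apply: (@feps0B); [|apply: (@feps0Z)]; apply: feps_gen.
- apply: (@feps0B); [apply: (@feps0B); apply: (@feps0M)|]; exact: feps_gen.
Qed.

Record envelope := Envelope {
  env_alg : algType K;
  env_inc : L -> env_alg;
  env_linear : linear env_inc;
  env_lie : forall x y,
    env_inc (lie x y) = env_inc x * env_inc y - env_inc y * env_inc x }.

(* The free algebra on the set L modulo [uenv_rel].  It is locked because
   unifying with the operations of the concrete algebra is very slow. *)
Definition uenv_def : envelope :=
  @Envelope (aquot uenv_proper) _ (uenv_linear_subproof uenv_proper)
    (uenv_lie_subproof uenv_proper).
Definition uenv_pack : envelope := locked uenv_def.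

Definition uenv : algType K := env_alg uenv_pack.
Definition uinc : L -> uenv := @env_inc uenv_pack.

Lemma uinc_linear : linear uinc. Proof. exact: env_linear. Qed.
Lemma uinc_lie x y : uinc (lie x y) = uinc x * uinc y - uinc y * uinc x.
Proof. exact: env_lie. Qed.

End Enveloping.

(* U(L) \otimes_{U(b)} N for a subalgebra b of L acting on N by s; since b
   generates U(b), it suffices to balance over b. *)
Section Induced.
Variables (K : fieldType) (L : lieAlgType K) (b : set L).
Variables (N : lmodType K) (s : L -> N -> N).

Definition ind_right (u : uenv L) (x : {x : L | b x}) : uenv L :=
  u * uinc (sval x).

Definition ind : lmodType K :=
  btens ind_right (fun (x : {x : L | b x}) n => s (sval x) n).

Definition ind_pure (u : uenv L) (n : N) : ind := btens_pure _ _ u n.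

Definition ind_act (x : L) : ind -> ind :=
  btens_lift (fun u n => ind_pure (uinc x * u) n).

Fact ind_act_linl x n : linear (fun u => ind_pure (uinc x * u) n).
Proof.
by move=> c v w; rewrite mulrDr -scalerAr; apply: btens_pure_linearl.
Qed.
Fact ind_act_linr x u : linear (ind_pure (uinc x * u)).
Proof. exact: btens_pure_linearr. Qed.
Fact ind_act_bal x (y : {x : L | b x}) u n :
  ind_pure (uinc x * ind_right u y) n = ind_pure (uinc x * u) (s (sval y) n).
Proof. by rewrite /ind_right mulrA; apply: btens_pure_bal. Qed.

Lemma ind_actE x u n : ind_act x (ind_pure u n) = ind_pure (uinc x * u) n.
Proof.
apply: (@btens_liftE _ _ _ _ _ _ _ (fun u n => ind_pure (uinc x * u) n)).
- exact: ind_act_linl.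
- exact: ind_act_linr.
- exact: ind_act_bal.
Qed.

Lemma ind_act_linear x : linear (ind_act x).
Proof.
apply: btens_lift_linear; first exact: ind_act_linl.
  exact: ind_act_linr.
exact: ind_act_bal.
Qed.

Lemma ind_act_module : lie_module ind_act.
Proof.
have D x t t' : ind_act x (t + t') = ind_act x t + ind_act x t'.
  by rewrite -[t in LHS]scale1r ind_act_linear scale1r.
have Z x : ind_act x 0 = 0.
  by apply: (addrI (ind_act x 0)); rewrite -D !addr0.
have pl n : linear (ind_pure^~ n) by exact: btens_pure_linearl.
have plD u u' n : ind_pure (u + u') n = ind_pure u n + ind_pure u' n.
  by rewrite -[u in LHS]scale1r pl scale1r.
split=> [x|t c x y|x y t]; first exact: ind_act_linear.
- elim/btens_ind: t => [|t t' IH IH'|u n].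
  + by rewrite !Z scaler0 addr0.
  + by rewrite !D IH IH' scalerDr addrACA.
  + by rewrite !ind_actE uinc_linear mulrDl -scalerAl; apply: pl.
- elim/btens_ind: t => [|t t' IH IH'|u n].
  + by rewrite !Z subr0.
  + by rewrite !D IH IH' opprD addrACA.
  + rewrite !ind_actE uinc_lie mulrBl -!mulrA.
    by rewrite -[- (_ * _)]scaleN1r addrC pl scaleN1r addrC.
Qed.

End Induced.

Section Affine.
Variables (K : fieldType).

(* g \otimes K[t, t^-1], as finitely supported functions int -> g;
   [<< h *g n >>] is h \otimes t^n. *)
Definition loop (g : lmodType K) := {malg g[int]}.

Section Loop.
Variable g : lmodType K.
HB.instance Definition _ := GRing.Zmodule.on (loop g).

Definition loop_scale (c : K) (f : loop g) : loop g :=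
  \sum_(n <- msupp f) << c *: f@_n *g n >>.

Fact loop_scaleE c f n : (loop_scale c f)@_n = c *: f@_n.
Proof.
rewrite /loop_scale [f in RHS]monalgE !(raddf_sum (mcoeff n)) scaler_sumr.
by apply/eq_bigr=> /= i _; rewrite !mcoeffU scalerMnr.
Qed.

Fact loop_scaleA a b f : loop_scale a (loop_scale b f) = loop_scale (a * b) f.
Proof. by apply/malgP=> n; rewrite !loop_scaleE scalerA. Qed.
Fact loop_scale1 : left_id 1 loop_scale.
Proof. by move=> f; apply/malgP=> n; rewrite loop_scaleE scale1r. Qed.
Fact loop_scaleDr : right_distributive loop_scale +%R.
Proof.
move=> a f h; apply/malgP=> n.
by rewrite !(mcoeffD, loop_scaleE) scalerDr.
Qed.
Fact loop_scaleDl f : {morph loop_scale^~ f : a b / a + b}.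
Proof.
move=> a b; apply/malgP=> n.
by rewrite !(mcoeffD, loop_scaleE) scalerDl.
Qed.
HB.instance Definition _ := GRing.Zmodule_isLmodule.Build K (loop g)
  loop_scaleA loop_scale1 loop_scaleDr loop_scaleDl.

Fact loopZE (c : K) (f : loop g) n : (c *: f)@_n = c *: f@_n.
Proof. exact: loop_scaleE. Qed.

Fact loopU_linear n : linear (fun h => << h *g n >> : loop g).
Proof.
move=> c u v; apply/malgP=> k; rewrite mcoeffD loopZE !mcoeffU.
by rewrite mulrnDl scalerMnr.
Qed.

Fact loop_ind (P : loop g -> Prop) :
  P 0 -> (forall f h, P f -> P h -> P (f + h)) ->
  (forall h n, P << h *g n >>) -> forall f, P f.
Proof. by move=> P0 PD PU f; rewrite [f]monalgE; elim/big_ind: _. Qed.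

Section LoopExt.
Variables (Z : lmodType K) (F : int -> g -> Z).
Hypothesis Flin : forall n, linear (F n).

Definition loop_ext (f : loop g) : Z := \sum_(n <- msupp f) F n f@_n.

Let F0 n : F n 0 = 0.
Proof. by have := Flin n (-1) 0 0; rewrite scaler0 addr0 scaleN1r addNr. Qed.

Fact loop_extEw (D : {fset int}) (f : loop g) :
  (msupp f `<=` D)%fset -> loop_ext f = \sum_(n <- D) F n f@_n.
Proof.
move=> sfD; apply: big_fset_incl => // k _ kf.
by rewrite mcoeff_outdom.
Qed.

Fact loop_ext_linear : linear loop_ext.
Proof.
move=> c f h.
set D := (msupp f `|` msupp h `|` msupp (c *: f + h))%fset.
rewrite !(@loop_extEw D) /D; last 3 first.
- exact: fsubset_trans (fsubsetUr _ _) (fsubsetUl _ _).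
- exact: fsubset_trans (fsubsetUl _ _) (fsubsetUl _ _).
- exact: fsubsetUr.
rewrite scaler_sumr -big_split /=; apply: eq_bigr => k _.
by rewrite mcoeffD loopZE Flin.
Qed.

Fact loop_extU h n : loop_ext << h *g n >> = F n h.
Proof.
rewrite (@loop_extEw [fset n]%fset) ?msuppU_le //.
by rewrite big_seq_fset1 mcoeffUU.
Qed.

End LoopExt.
End Loop.

Variable g : quadLieAlgType K.

Definition affine : Type := (loop g * K^o)%type.
HB.instance Definition _ := GRing.Lmodule.on affine.

(* [x t^i, y t^j] = [x, y] t^(i+j) + i (x, y) delta_(i+j,0) k *)
Definition affine_lie (x y : affine) : affine :=
  (\sum_(i <- msupp x.1) \sum_(j <- msupp y.1) << lie x.1@_i y.1@_j *g i + j >>,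
   \sum_(i <- msupp x.1) i%:~R * form x.1@_i y.1@_(- i)).

Fact lieN (u v : g) : lie u v = - lie v u.
Proof.
have D (a b c : g) : lie (a + b) c = lie a c + lie b c.
  by rewrite -[a in LHS]scale1r (lie_linearl c) scale1r.
have D' (a b c : g) : lie c (a + b) = lie c a + lie c b.
  by rewrite -[a in LHS]scale1r (lie_linearr c) scale1r.
apply/eqP; rewrite -addr_eq0; have := lie_alt (u + v).
by rewrite D !D' !lie_alt add0r addr0 => ->.
Qed.

Fact form_linearr (x : g) : scalar (form x).
Proof. by move=> c u v; rewrite !(form_sym x) form_linearl. Qed.

Definition affine_B (f h : loop g) : affine := affine_lie (f, 0) (h, 0).

Fact affine_B_linearl h : linear (affine_B^~ h).
Proof.
move=> c f f'; congr (_, _).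
- apply: (@loop_ext_linear g (loop g)
    (fun i u => \sum_(j <- msupp h) << lie u h@_j *g i + j >>)).
  move=> i a u v; rewrite scaler_sumr -big_split /=; apply: eq_bigr => j _.
  by rewrite lie_linearl loopU_linear.
- apply: (@loop_ext_linear g K^o (fun i u => i%:~R * form u h@_(- i))).
  by move=> i a u v; rewrite form_linearl mulrDr scalerAr.
Qed.

Fact affine_B_linearr f : linear (affine_B f).
Proof.
move=> c h h'; congr (_, _) => /=.
- rewrite scaler_sumr -big_split /=; apply: eq_bigr => i _.
  apply: (@loop_ext_linear g (loop g)
    (fun j v => << lie f@_i v *g i + j >>)) => j a u v.
  by rewrite lie_linearr loopU_linear.
- rewrite scaler_sumr -big_split /=; apply: eq_bigr => i _.
  by rewrite mcoeffD loopZE form_linearr mulrDr scalerAr.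
Qed.

Fact affine_BDl f f' h : affine_B (f + f') h = affine_B f h + affine_B f' h.
Proof. by rewrite -[f in LHS]scale1r affine_B_linearl scale1r. Qed.
Fact affine_BDr f h h' : affine_B f (h + h') = affine_B f h + affine_B f h'.
Proof. by rewrite -[h in LHS]scale1r affine_B_linearr scale1r. Qed.
Fact affine_B0l h : affine_B 0 h = 0.
Proof. by apply: (addrI (affine_B 0 h)); rewrite -affine_BDl !addr0. Qed.
Fact affine_B0r f : affine_B f 0 = 0.
Proof. by apply: (addrI (affine_B f 0)); rewrite -affine_BDr !addr0. Qed.

Fact affine_BU u m v n : affine_B << u *g m >> << v *g n >> =
  (<< lie u v *g m + n >>, (m%:~R * form u v) *+ (m + n == 0)) :> affine.
Proof.
congr (_, _) => /=.
- apply: (@etrans _ _ (\sum_(j <- msupp (<< v *g n >> : loop g))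
      << lie u << v *g n >>@_j *g m + j >>)).
    apply: (@loop_extU g (loop g) (fun i a =>
      \sum_(j <- msupp (<< v *g n >> : loop g))
         << lie a << v *g n >>@_j *g i + j >>)).
    move=> i a x y; rewrite scaler_sumr -big_split /=; apply: eq_bigr => j _.
    by rewrite lie_linearl loopU_linear.
  apply: (@loop_extU g (loop g) (fun j b => << lie u b *g m + j >>)).
  by move=> j a x y; rewrite lie_linearr loopU_linear.
- apply: (@etrans _ _ (m%:~R * form u << v *g n >>@_(- m))).
    apply: (@loop_extU g K^o
      (fun i a => i%:~R * form a << v *g n >>@_(- i))).
    by move=> i a x y; rewrite form_linearl mulrDr scalerAr.
  rewrite mcoeffU addrC addr_eq0; case: eqP => // _.
  rewrite !mulr0n; have := form_linearr u (-1) 0 0.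
  by rewrite scaler0 addr0 mulN1r addNr => ->; rewrite mulr0.
Qed.

Fact affine_BN f h : affine_B f h = - affine_B h f.
Proof.
elim/loop_ind: f => [|f f' IH IH'|u m].
- by rewrite affine_B0l affine_B0r oppr0.
- by rewrite affine_BDl affine_BDr opprD IH IH'.
elim/loop_ind: h => [|h h' IH IH'|v n].
- by rewrite affine_B0l affine_B0r oppr0.
- by rewrite affine_BDl affine_BDr opprD IH IH'.
rewrite !affine_BU; congr (_, _) => /=.
  by rewrite -raddfN -lieN addrC.
rewrite [n + m]addrC; case: eqP => [mn|_]; last by rewrite !mulr0n oppr0.
have -> : m = - n by apply/eqP; rewrite -addr_eq0 mn.
by rewrite !mulr1n mulrNz mulNr form_sym.
Qed.

Fact affine_lie_linearl y : linear (affine_lie^~ y).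
Proof. move=> c x x'; exact: affine_B_linearl. Qed.
Fact affine_lie_linearr x : linear (affine_lie x).
Proof. move=> c y y'; exact: affine_B_linearr. Qed.

Fact affine_lie_alt x : affine_lie x x = 0.
Proof.
rewrite -[LHS]/(affine_B x.1 x.1); elim/loop_ind: x.1 => [|f h IH IH'|u n].
- exact: affine_B0l.
- by rewrite affine_BDl !affine_BDr IH IH' add0r addr0 affine_BN addNr.
rewrite affine_BU lie_alt raddf0; congr (_, _).
case: eqP => [nn|//]; rewrite mulr1n.
have -> : n = 0 by move: nn; case: n => [[|k]|k].
by rewrite mul0r.
Qed.

Fact jacobiator_additive (V W : zmodType) (B : V -> V -> W) (p : W -> V) :
  (forall f f' h, B (f + f') h = B f h + B f' h) ->
  (forall f h h', B f (h + h') = B f h + B f h') ->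
  (forall x y, p (x + y) = p x + p y) ->
  forall f f' h k,
  B (f + f') (p (B h k)) + B h (p (B k (f + f'))) + B k (p (B (f + f') h)) =
  (B f (p (B h k)) + B h (p (B k f)) + B k (p (B f h)))
  + (B f' (p (B h k)) + B h (p (B k f')) + B k (p (B f' h))).
Proof.
move=> Bl Br pD f f' h k; rewrite !(Bl, pD, Br).
by rewrite [X in X + _ = _]addrACA [LHS]addrACA.
Qed.

Fact affine_lie_jacobi x y z :
  affine_lie x (affine_lie y z) + affine_lie y (affine_lie z x)
  + affine_lie z (affine_lie x y) = 0.
Proof.
pose J f h k := affine_B f (affine_B h k).1 + affine_B h (affine_B k f).1
  + affine_B k (affine_B f h).1.
rewrite -[LHS]/(J x.1 y.1 z.1).
have JC f h k : J f h k = J h k f by rewrite /J -[LHS]addrA [LHS]addrC.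
have JD f f' h k : J (f + f') h k = J f h k + J f' h k.
  exact: (@jacobiator_additive _ _ affine_B fst affine_BDl affine_BDr).
have J0 h k : J 0 h k = 0.
  by apply: (addrI (J 0 h k)); rewrite -JD !addr0.
elim/loop_ind: x.1 => [|f f' IH IH'|u m]; first exact: J0.
  by rewrite JD IH IH' addr0.
rewrite JC; elim/loop_ind: y.1 => [|f f' IH IH'|v n]; first exact: J0.
  by rewrite JD IH IH' addr0.
rewrite JC; elim/loop_ind: z.1 => [|f f' IH IH'|w k]; first exact: J0.
  by rewrite JD IH IH' addr0.
rewrite JC /J !affine_BU; congr (_, _) => /=.
  have -> : n + (k + m) = m + (n + k) by rewrite addrA addrC.
  have -> : k + (m + n) = m + (n + k) by rewrite addrC addrA.
  by rewrite -!raddfD lie_jacobi raddf0.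
have -> : n + (k + m) = m + (n + k) by rewrite addrA addrC.
have -> : k + (m + n) = m + (n + k) by rewrite addrC addrA.
case: eqP => [mnk|_]; last by rewrite !mulr0n !addr0.
rewrite !mulr1n -(form_inv w u v) (form_sym _ v) -(form_inv v w u).
rewrite (form_sym _ u) -!mulrDl -!intrD -addrA mnk.
by rewrite mul0r.
Qed.

HB.instance Definition _ := isLieAlgebra.Build K affine
  affine_lie_linearl affine_lie_linearr affine_lie_alt affine_lie_jacobi.

(* h \otimes t^n *)
Definition amode (h : g) (n : int) : affine := (<< h *g n >>, 0).
Definition acentral : affine := (0, 1).

End Affine.

Section AffineInduced.
Variables (K : fieldType) (g : quadLieAlgType K).

(* g \otimes K[t] \oplus K k *)
Definition affine_nonneg : set (affine g) :=
  [set x | forall n : int, n < 0 -> x.1@_n = 0].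

(* U(affine g) \otimes_{U(g \otimes K[t] + K k)} K, where g \otimes t K[t] acts
   on K as 0, h in g as lam h, and k as l. *)
Definition affine_ind (lam : g -> K) (l : K) : lmodType K :=
  ind affine_nonneg (fun (x : affine g) (z : K^o) => (lam x.1@_0 + x.2 * l) *: z).

Variables (lam : g -> K) (l : K).

Definition affine_vac : affine_ind lam l := ind_pure _ _ 1 (1 : K^o).

Definition affine_mode (h : g) (n : int) :
  affine_ind lam l -> affine_ind lam l := ind_act (amode h n).

End AffineInduced.

Section NappiWitten.
Variable K : fieldType.

(* Coordinates with respect to the basis a, b, c, d. *)
Definition H4 : Type := 'rV[K]_4.
HB.instance Definition _ := GRing.Lmodule.on H4.

Definition nwa : H4 := delta_mx 0 0.
Definition nwb : H4 := delta_mx 0 1.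
Definition nwc : H4 := delta_mx 0 2.
Definition nwd : H4 := delta_mx 0 3.

Definition H4_lie (x y : H4) : H4 :=
  \row_j [:: x 0 3 * y 0 0 - x 0 0 * y 0 3;
             x 0 1 * y 0 3 - x 0 3 * y 0 1;
             x 0 0 * y 0 1 - x 0 1 * y 0 0;
             0]`_j.

Definition H4_form (x y : H4) : K :=
  x 0 0 * y 0 1 + x 0 1 * y 0 0 + x 0 2 * y 0 3 + x 0 3 * y 0 2.

Fact H4_lie_linearl y : linear (H4_lie^~ y).
Proof.
move=> c u v; apply/rowP => j; rewrite !mxE.
by case: j => [[|[|[|[|j]]]] hj] //=; ring.
Qed.
Fact H4_lie_linearr x : linear (H4_lie x).
Proof.
move=> c u v; apply/rowP => j; rewrite !mxE.
by case: j => [[|[|[|[|j]]]] hj] //=; ring.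
Qed.
Fact H4_lie_alt x : H4_lie x x = 0.
Proof.
apply/rowP => j; rewrite !mxE.
by case: j => [[|[|[|[|j]]]] hj] //=; ring.
Qed.
Fact H4_lie_jacobi x y z :
  H4_lie x (H4_lie y z) + H4_lie y (H4_lie z x) + H4_lie z (H4_lie x y) = 0.
Proof.
apply/rowP => j; rewrite !mxE /=.
by case: j => [[|[|[|[|j]]]] hj] //=; ring.
Qed.
HB.instance Definition _ := isLieAlgebra.Build K H4
  H4_lie_linearl H4_lie_linearr H4_lie_alt H4_lie_jacobi.

Fact H4_form_linearl y : scalar (H4_form^~ y).
Proof. by move=> c u v; rewrite /H4_form !mxE; ring. Qed.
Fact H4_form_sym x y : H4_form x y = H4_form y x.
Proof. by rewrite /H4_form; ring. Qed.
Fact H4_form_inv x y z : H4_form (lie x y) z = H4_form x (lie y z).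
Proof. by rewrite /H4_form /lie /= !mxE /=; ring. Qed.
HB.instance Definition _ := hasInvariantForm.Build K H4
  H4_form_linearl H4_form_sym H4_form_inv.

Lemma H4_lie_basis :
  [/\ lie nwa nwb = nwc, lie nwd nwa = nwa, lie nwd nwb = - nwb
    & [/\ lie nwc nwd = 0, lie nwc nwa = 0 & lie nwc nwb = 0]].
Proof.
by split; [..|split]; apply/rowP => j; rewrite /lie /= !mxE /=;
  case: j => [[|[|[|[|j]]]] hj] //=; rewrite ?mxE /= ?mxE /=; ring.
Qed.

Lemma H4_form_basis :
  [/\ form nwa nwb = 1, form nwc nwd = 1,
      [/\ form nwa nwa = 0, form nwb nwb = 0, form nwc nwc = 0
        & form nwd nwd = 0]
    & [/\ form nwa nwc = 0, form nwa nwd = 0, form nwb nwc = 0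
        & form nwb nwd = 0]].
Proof. by split; [| |split|split]; rewrite /form /= /H4_form !mxE /=; ring. Qed.

(* Coordinates with respect to the basis p, q. *)
Definition heis : Type := 'rV[K]_2.
HB.instance Definition _ := GRing.Lmodule.on heis.

Definition heis_p : heis := delta_mx 0 0.
Definition heis_q : heis := delta_mx 0 1.

Definition heis_lie (x y : heis) : heis := 0.
Definition heis_form (x y : heis) : K := x 0 0 * y 0 1 + x 0 1 * y 0 0.

Fact heis_lie_linearl y : linear (heis_lie^~ y).
Proof. by move=> c u v; rewrite /heis_lie scaler0 addr0. Qed.
Fact heis_lie_linearr x : linear (heis_lie x).
Proof. by move=> c u v; rewrite /heis_lie scaler0 addr0. Qed.
Fact heis_lie_alt x : heis_lie x x = 0.
Proof. by []. Qed.
Fact heis_lie_jacobi x y z : heis_lie x (heis_lie y z)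
  + heis_lie y (heis_lie z x) + heis_lie z (heis_lie x y) = 0.
Proof. by rewrite /heis_lie !addr0. Qed.
HB.instance Definition _ := isLieAlgebra.Build K heis
  heis_lie_linearl heis_lie_linearr heis_lie_alt heis_lie_jacobi.

Fact heis_form_linearl y : scalar (heis_form^~ y).
Proof. by move=> c u v; rewrite /heis_form !mxE; ring. Qed.
Fact heis_form_sym x y : heis_form x y = heis_form y x.
Proof. by rewrite /heis_form; ring. Qed.
Fact heis_form_inv x y z : heis_form (lie x y) z = heis_form x (lie y z).
Proof. by rewrite /heis_form /lie /= !mxE; ring. Qed.
HB.instance Definition _ := hasInvariantForm.Build K heis
  heis_form_linearl heis_form_sym heis_form_inv.

(* V(l, 0) for the affinization of H4, and M(1, alpha) *)
Definition VH4 (l : K) : lmodType K := affine_ind (fun _ : H4 => 0) l.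
Definition M1 (alpha : heis) : lmodType K := affine_ind (form^~ alpha) 1.

Definition VH4_vac (l : K) : VH4 l := affine_vac _ _.
Definition VH4_mode (l : K) (h : H4) (n : int) (v : VH4 l) : VH4 l :=
  affine_mode h n v.
Definition M1_mode (alpha : heis) (h : heis) (n : int) (w : M1 alpha) :
  M1 alpha := affine_mode h n w.

End NappiWitten.

(* A vertex operator map Y(u, x) = \sum_n u_n x^(-n-1) is given by its modes:
   [Y u n v] is u_n v.  [\sum_(i \in A)] is the sum of a finitely supported
   family; truncation makes all the sums below finite. *)
Section VertexAlgebra.
Variable K : numFieldType.

(* The binomial coefficient m (m - 1) ... (m - i + 1) / i!, m possibly
   negative *)
Definition binz (m : int) (i : nat) : K :=
  (\prod_(j < i) (m - j%:Z)%:~R) / i`!%:R.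

Section Jacobi.
Variables (V W : lmodType K).
Variables (Y : V -> int -> V -> V) (YW : V -> int -> W -> W).

Definition truncated : Prop :=
  forall u w, exists N : int, forall n, N <= n -> YW u n w = 0.

(* The Jacobi identity
     x0^-1 delta((x1 - x2)/x0) Y(u, x1) Y(v, x2)
       - x0^-1 delta((x2 - x1)/(-x0)) Y(v, x2) Y(u, x1)
     = x2^-1 delta((x1 - x0)/x2) Y(Y(u, x0) v, x2),
   applied to w: coefficient of x0^(-n-1) x1^(-m-1) x2^(-k-1). *)
Definition jacobi_identity : Prop :=
  forall (u v : V) (w : W) (m n k : int),
    \sum_(i \in [set: nat])
      ((-1) ^+ i * binz n i) *:
        (YW u (m + n - i%:Z) (YW v (k + i%:Z) w)
         - (-1) ^ n *: YW v (n + k - i%:Z) (YW u (m + i%:Z) w))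
    = \sum_(i \in [set: nat])
        binz m i *: YW (Y u (n + i%:Z) v) (m + k - i%:Z) w.

End Jacobi.

Record vertex_algebra (V : lmodType K) (Y : V -> int -> V -> V) (vac : V) :
    Prop := VertexAlgebra {
  va_linearl : forall n v, linear (fun u => Y u n v);
  va_linearr : forall u n, linear (Y u n);
  va_truncated : truncated Y;
  va_vacuum : forall n v, Y vac n v = if n == -1 then v else 0;
  va_creation : forall v, Y v (-1) vac = v;
  va_creation0 : forall v n, 0 <= n -> Y v n vac = 0;
  va_jacobi : jacobi_identity Y Y }.

Record va_module (V : lmodType K) (Y : V -> int -> V -> V) (vac : V)
    (W : lmodType K) (YW : V -> int -> W -> W) : Prop := VAModule {
  vam_linearl : forall n w, linear (fun u => YW u n w);
  vam_linearr : forall u n, linear (YW u n);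
  vam_truncated : truncated YW;
  vam_vacuum : forall n w, YW vac n w = if n == -1 then w else 0;
  vam_jacobi : jacobi_identity Y YW }.

End VertexAlgebra.

Section Weyl.
Variables (K : fieldType) (V : lmodType K).
Variables (beta gamma : int -> V -> V).

Record weyl_module (kk : V -> V) : Prop := WeylModule {
  weyl_linear_beta : forall n, linear (beta n);
  weyl_linear_gamma : forall n, linear (gamma n);
  weyl_linear_k : linear kk;
  weyl_beta_gamma : forall m n v,
    beta m (gamma n v) - gamma n (beta m v) = if m + n == 0 then kk v else 0;
  weyl_beta_beta : forall m n v, beta m (beta n v) = beta n (beta m v);
  weyl_gamma_gamma : forall m n v, gamma m (gamma n v) = gamma n (gamma m v);
  weyl_k_beta : forall n v, kk (beta n v) = beta n (kk v);
  weyl_k_gamma : forall n v, kk (gamma n v) = gamma n (kk v) }.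

Definition weyl_submodule (kk : V -> V) (P : set V) : Prop :=
  [/\ P 0, forall c u v, P u -> P v -> P (c *: u + v),
      forall n v, P v -> P (beta n v), forall n v, P v -> P (gamma n v)
    & forall v, P v -> P (kk v)].

(* V is the module V_A, with k = id and generator vac. *)
Record weyl_vacuum_module (vac : V) : Prop := WeylVacuumModule {
  weylv_module : weyl_module id;
  weylv_nonzero : exists v : V, v != 0;
  weylv_irreducible : forall P, weyl_submodule id P ->
    (forall v, P v -> v = 0) \/ (forall v, P v);
  weylv_generated : forall P, weyl_submodule id P -> P vac -> forall v, P v;
  weylv_beta : forall n, 0 <= n -> beta n vac = 0;
  weylv_gamma : forall n, 0 < n -> gamma n vac = 0 }.

(* gamma(x) = \sum_n gamma(n) x^(-n), so gamma'(x) = \sum_n (- n gamma(n)) x^(-n-1):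
   modes here are the coefficients of x^(-n-1). *)
Definition dgamma_mode (n : int) (v : V) : V := (- n)%:~R *: gamma n v.

(* The modes of :beta(x) gamma(x):, the beta(i) with i >= 0 being moved to the
   right. *)
Definition nord_mode (n : int) (v : V) : V :=
  \sum_(i \in [set: int])
    (if i < 0 then beta i (gamma (n - i) v) else gamma (n - i) (beta i v)).

End Weyl.

(* Main.v *)
Require Import Defs.
From HB Require Import structures.
From mathcomp Require Import all_boot all_order all_algebra.
From mathcomp Require Import finmap monalg complex ring zify.
From mathcomp Require Import boolp classical_sets functions fsbigop reals.

Set Implicit Arguments.
Unset Strict Implicit.
Unset Printing Implicit Defensive.

Import Order.TTheory GRing.Theory Num.Theory.
Local Open Scope classical_set_scope.
Local Open Scope ring_scope.

(* A field on W is a family of modes c_n : W -> W with c_n w = 0 for large n.  On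
   the space of all fields a field a acts by its n-th products c |-> a_(n) c, and
   if the commutator [a_m, b_k] is given by fields t_r, then the operators a_(m)
   and b_(n) obey the corresponding commutator formula whatever c is.  Hence, for
   a restricted level l module W of an affine Lie algebra, the affine algebra acts
   on the fields on W with level l, the identity field is a vacuum vector, and the
   vacuum module maps to the fields on W; this map is the vertex operator map.
   The Jacobi identity follows from its commutator (n = 0) and iterate (m = 0)
   cases.  These are proved by induction on the second vector, first with a
   generator and then with any vector as first vector, skew-symmetry leading from
   the one to the other.

   What remains is that the given free fields satisfy the relations of the affine
   Nappi-Witten algebra: :beta gamma: is a current of level -1, and the term
   l^-1 p / 2 compensates for this in [d(m), d(n)]. *)

(** * Linear maps and finite sums *)

(** The order of the inductions is dictated by what is known when. For a generator g and any v the
    iterate formula holds by construction of the map, but nothing is known at first about a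
    composite first vector. The commutator of u with y_s v, in turn, calls for the full identity of
    the pairs (u_r y, v), r >= 0. If u and y are generators, u_r y is a combination of generators
    and the vacuum, so an induction on v closes. If u is arbitrary, so is u_r y: the induction on v
    must then run over all u at once, and the commutator of u with a generator must be known
    beforehand. That is the generator case with its arguments exchanged, hence the need for
    skew-symmetry. Skew-symmetry contains exp(xT), so the map must first be shown to turn the
    translation T u = u_(-2) 1 into the derivative of fields. Truncation makes all sums finite, and
    each identity comes down to a convolution of binomial coefficients. *)

Section LinearMaps.
Variables (K : fieldType) (V W : lmodType K) (f : V -> W).
Hypothesis fl : linear f.
Lemma lin0 : f 0 = 0.
Proof. by have := fl (-1) 0 0; rewrite scaler0 addr0 scaleN1r addNr. Qed.
Lemma linD u v : f (u + v) = f u + f v.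
Proof. by have := fl 1 u v; rewrite !scale1r. Qed.
Lemma lin_add0 u v : f u = 0 -> f v = 0 -> f (u + v) = 0.
Proof. by move=> u0 v0; rewrite linD u0 v0 addr0. Qed.
Lemma linZ c u : f (c *: u) = c *: f u.
Proof. by have := fl c u 0; rewrite !addr0 lin0 addr0. Qed.
Lemma linN u : f (- u) = - f u.
Proof. by rewrite -scaleN1r linZ scaleN1r. Qed.
Lemma linB u v : f (u - v) = f u - f v.
Proof. by rewrite linD linN. Qed.
Lemma lin_sum (I : Type) (r : seq I) (P : pred I) (F : I -> V) :
  f (\sum_(i <- r | P i) F i) = \sum_(i <- r | P i) f (F i).
Proof. exact: (big_morph f linD lin0). Qed.
End LinearMaps.

(** * Binomial coefficients *)

Section Binomials.
Variable K : numFieldType.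
Local Notation binz := (binz K).

Lemma binz0 m : binz m 0 = 1.
Proof. by rewrite /Defs.binz big_ord0 fact0 divr1. Qed.

Lemma binzS m i : i.+1%:R * binz m i.+1 = (m - i%:Z)%:~R * binz m i.
Proof.
rewrite /Defs.binz big_ord_recr /= factS natrM.
have h1 : i.+1%:R != 0 :> K by rewrite pnatr_eq0.
have h2 : i`!%:R != 0 :> K by rewrite pnatr_eq0 -lt0n fact_gt0.
by move: h1 h2; move: (i.+1%:R) (i`!%:R) => x y h1 h2; field; rewrite h1 h2.
Qed.

Lemma binzSl m i : i.+1%:R * binz (m + 1) i.+1 = (m + 1)%:~R * binz m i.
Proof.
rewrite /Defs.binz big_ord_recl /= factS natrM subr0.
have -> : \prod_(j < i) (m + 1 - (bump 0 j)%:Z)%:~R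
    = \prod_(j < i) (m - j%:Z)%:~R :> K.
  by apply: eq_bigr => j _; congr (_%:~R); rewrite /bump /=; lia.
have h1 : i.+1%:R != 0 :> K by rewrite pnatr_eq0.
have h2 : i`!%:R != 0 :> K by rewrite pnatr_eq0 -lt0n fact_gt0.
by move: h1 h2; move: (i.+1%:R) (i`!%:R) => x y h1 h2; field; rewrite h1 h2.
Qed.

Lemma binz_pascal m i : binz (m + 1) i.+1 = binz m i.+1 + binz m i.
Proof.
have h1 : i.+1%:R != 0 :> K by rewrite pnatr_eq0.
apply: (mulfI h1); rewrite mulrDr binzSl binzS -mulrDl; congr (_ * _).
by rewrite -[i.+1%:R]/(i.+1%:Z%:~R) -intrD; congr (_%:~R); lia.
Qed.

Lemma binz_nat (n i : nat) : binz n i = 'C(n, i)%:R.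
Proof.
elim: n i => [|n IH] [|i]; rewrite ?binz0 ?bin0 //.
  have h1 : i.+1%:R != 0 :> K by rewrite pnatr_eq0.
  apply: (mulfI h1); rewrite bin0n mulr0.
  elim: i {h1} => [|i IH]; first by rewrite binzS subr0 mul0r.
  rewrite binzS; have h1 : i.+1%:R != 0 :> K by rewrite pnatr_eq0.
  by rewrite (_ : binz 0 i.+1 = 0) ?mulr0 //; apply: (mulfI h1); rewrite IH mulr0.
by rewrite -addn1 PoszD binz_pascal !IH addn1 binS natrD.
Qed.

Lemma binz0n i : binz 0 i = (i == 0%N)%:R.
Proof. by rewrite (binz_nat 0) bin0n. Qed.

(** Induction on s after multiplying by s + 1 = i + (s + 1 - i). Each part lowers one of the two
    lower indices, and the factors m - i and n - (s - i) produced in this way add up to m + n -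
    s. *)
Lemma binz_vandermonde m n s :
  \sum_(i < s.+1) binz m i * binz n (s - i)%N = binz (m + n) s.
Proof.
elim: s => [|s IH]; first by rewrite big_ord1 !binz0 mul1r.
have h1 : s.+1%:R != 0 :> K by rewrite pnatr_eq0.
apply: (mulfI h1); rewrite binzS -{}IH !mulr_sumr.
rewrite (eq_bigr (fun i : 'I_s.+2 => i%:R * binz m i * binz n (s.+1 - i)%N
   + binz m i * ((s.+1 - i)%N%:R * binz n (s.+1 - i)%N))); last first.
  move=> i _; have -> : s.+1%:R = i%:R + (s.+1 - i)%N%:R :> K.
    by rewrite -natrD subnKC // -ltnS.
  by ring.
rewrite big_split /= big_ord_recl [X in _ + X]big_ord_recr /= !mul0r subnn mul0r mulr0.
rewrite add0r addr0 -big_split /=; apply: eq_bigr => i _.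
rewrite /bump /= add1n subSS binzS subSn -1?ltnS // binzS.
have -> : (m + n - s%:Z)%:~R = (m - i%:Z)%:~R + (n - (s - i)%N%:Z)%:~R :> K.
  rewrite -intrD; congr (_%:~R); have := ltn_ord i; lia.
by ring.
Qed.

(** Trinomial revision: it lets two nested expansions with lower indices r and j be regrouped by r +
    j. *)
Lemma binz_trinomial m r j :
  binz m (r + j)%N * 'C(r + j, r)%:R = binz m r * binz (m - r%:Z) j.
Proof.
elim: j => [|j IH]; first by rewrite addn0 binn binz0.
have h1 : j.+1%:R != 0 :> K by rewrite pnatr_eq0.
apply: (mulfI h1); rewrite [RHS]mulrCA binzS.
have -> : j.+1%:R * (binz m (r + j.+1)%N * 'C(r + j.+1, r)%:R)
    = (r + j).+1%:R * binz m (r + j).+1 * 'C(r + j, r)%:R :> K.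
  have := mul_bin_down (r + j).+1 r; rewrite subSn ?leq_addr // addKn /= => e.
  by rewrite addnS mulrCA -natrM -e natrM; ring.
rewrite binzS -mulrA IH mulrCA; congr (_ * (_ * _)); congr (_%:~R); lia.
Qed.

Lemma binzN m i : binz m i = (-1) ^+ i * binz (i%:Z - m - 1) i.
Proof.
rewrite /Defs.binz mulrA; congr (_ / _).
rewrite -[X in (-1) ^+ X](card_ord i) -prodr_const -big_split /=.
rewrite (reindex_inj rev_ord_inj) /=; apply: eq_bigr => j _.
rewrite mulN1r -mulrNz; congr (_%:~R); have := ltn_ord j; lia.
Qed.

Lemma binz_pred m i : (m - i%:Z)%:~R * binz m i = m%:~R * binz (m - 1) i.
Proof. by rewrite -binzS -{1}[m](subrK 1) binzSl subrK. Qed.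

Lemma binz1 m : binz m 1 = m%:~R.
Proof. by have := binzS m 0; rewrite mul1r binz0 mulr1 subr0. Qed.

(** Negating the upper index of the last factor makes it s - m - k - 1, independent of r, and what
    remains is a Vandermonde convolution. This is the coefficient identity behind skew-symmetry. *)
Lemma binz_skew m k s :
  \sum_(r < s.+1) (-1) ^+ r * binz m r * binz (m + k - r%:Z) (s - r)%N = binz k s.
Proof.
rewrite (binzN k s) (_ : s%:Z - k - 1 = m + (s%:Z - m - k - 1)); last by lia.
rewrite -binz_vandermonde mulr_sumr; apply: eq_bigr => r _.
have rs : (r <= s)%N by rewrite -ltnS.
have -> : (-1) ^+ s = (-1) ^+ r * (-1) ^+ (s - r)%N :> K by rewrite -exprD subnKC.
rewrite [X in _ * X = _]binzN -mulrA -[RHS]mulrA; congr (_ * _).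
rewrite mulrCA; congr (_ * (_ * binz _ _)); lia.
Qed.

Lemma binzN1 i : binz (-1) i = (-1) ^+ i.
Proof.
by rewrite binzN opprK addrK binz_nat binn mulr1.
Qed.

End Binomials.

(** * Truncated sums over the natural numbers *)

Section Sums.
Variable W : nmodType.
Implicit Types F : nat -> W.

Lemma fsum_nat N F : (forall i, (N <= i)%N -> F i = 0) ->
  \sum_(i \in [set: nat]) F i = \sum_(i < N) F i.
Proof.
move=> F0; rewrite (@fsbigE _ _ _ _ _ (index_iota 0 N)) ?iota_uniq //.
- by rewrite big_mkord; apply: eq_bigl => i; apply/asboolP.
- by move=> i _; rewrite mem_index_iota /= -leqNgt; apply: F0.
Qed.

Lemma sum_ord_widen N M F : (N <= M)%N -> (forall i, (N <= i)%N -> F i = 0) ->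
  \sum_(i < N) F i = \sum_(i < M) F i.
Proof.
move=> NM F0; rewrite (big_ord_widen M F NM) big_mkcond; apply: eq_bigr => i _.
by case: ltnP => // /F0.
Qed.

(** Terms on and beyond the N-th antidiagonal vanish, so the square is in effect a triangle. Double
    sums whose modes depend only on i + j become convolutions in this way. *)
Lemma sum_diag N (F : nat -> nat -> W) :
  (forall i j, (N <= i + j)%N -> F i j = 0) ->
  \sum_(i < N) \sum_(j < N) F i j = \sum_(s < N) \sum_(i < s.+1) F i (s - i)%N.
Proof.
move=> F0.
transitivity (\sum_(i < N) \sum_(s < N | (i <= s)%N) F i (s - i)%N); last first.
  rewrite (exchange_big_dep xpredT) //=; apply: eq_bigr => s _.
  rewrite (big_ord_widen_cond N xpredT (fun i => F i (s - i)%N)) //=.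
apply: eq_bigr => i _.
rewrite -[LHS](big_mkord xpredT (F i)) -(big_mkord (leq i) (fun s => F i (s - i)%N)).
rewrite (@big_cat_nat _ _ _ (N - i)) //= ?leq_subr //.
rewrite [X in _ + X]big_nat_cond [X in _ + X]big1; last first.
  by move=> j /andP[/andP[h _] _]; apply: F0; lia.
rewrite addr0 [RHS](@big_cat_nat _ _ _ i) //=; last exact: ltnW.
rewrite [X in X + _]big_nat_cond [X in X + _]big1; last first.
  by move=> j /andP[/andP[_ h] h']; move: (leq_trans h h'); rewrite ltnn.
have := big_addn 0 N i (leq i) (fun s => F i (s - i)%N); rewrite add0n add0r => ->.
by apply: eq_big => j *; rewrite ?leq_addl ?addnK.
Qed.

End Sums.

(** * Fields and their n-th products *)

Section Fields.
Variables (K : numFieldType) (W : lmodType K).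
Local Notation binz := (binz K).

(** A predicate closed under linear combinations, so that [vfield] inherits the module structure of
    all functions and can be the target of a linear map from the vacuum module. *)
Definition is_field : {pred int -> W -> W} := fun c =>
  `[< (forall n, linear (c n)) /\
      (forall w, exists N : int, forall n, N <= n -> c n w = 0) >].

Fact is_field_submod : submod_closed is_field.
Proof.
split.
  apply/asboolP; split=> [n k u v|w]; first by rewrite /= scaler0 addr0.
  by exists 0.
move=> k c d /asboolP[cl ct] /asboolP[dl dt]; apply/asboolP; split.
  move=> n e u v; rewrite -[LHS]/(k *: c n (e *: u + v) + d n (e *: u + v)).
  rewrite -[RHS]/(e *: (k *: c n u + d n u) + (k *: c n v + d n v)).
  rewrite cl dl !scalerDr !scalerA [k * e]mulrC addrACA.
  by rewrite -!scalerA.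
move=> w; have [N cN] := ct w; have [M dM] := dt w; exists (Order.max N M) => n.
rewrite ge_max => /andP[/cN e1 /dM e2].
by rewrite -[LHS]/(k *: c n w + d n w) e1 e2 scaler0 addr0.
Qed.
HB.instance Definition _ :=
  GRing.isSubmodClosed.Build K (int -> W -> W) is_field is_field_submod.

Record vfield := VField { fmode :> int -> W -> W; _ : fmode \in is_field }.
HB.instance Definition _ := [isSub for fmode].
HB.instance Definition _ := [Choice of vfield by <:].
HB.instance Definition _ := [SubChoice_isSubLmodule of vfield by <:].

Lemma fmode_linear (c : vfield) n : linear (c n).
Proof. by case: c => c /= /asboolP[]. Qed.
HB.instance Definition _ (c : vfield) n :=
  GRing.isLinear.Build K W W *:%R (fmode c n) (fmode_linear c n).

Lemma fmode_trunc (c : vfield) w : exists N : int, forall n, N <= n -> c n w = 0.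
Proof. by case: c => c /= /asboolP[]. Qed.

Lemma fmodeZr (c : vfield) n x w : c n (x *: w) = x *: c n w.
Proof. exact: linearZ. Qed.

Lemma fmodeNr (c : vfield) n u : c n (- u) = - c n u.
Proof. exact: linearN. Qed.
Lemma fmodeBr (c : vfield) n u v : c n (u - v) = c n u - c n v.
Proof. exact: linearB. Qed.

Lemma fmodeD (c d : vfield) n w : (c + d) n w = c n w + d n w.
Proof. by []. Qed.
Lemma fmodeZ x (c : vfield) n w : (x *: c) n w = x *: c n w.
Proof. by []. Qed.
Lemma fmodeB (c d : vfield) n w : (c - d) n w = c n w - d n w.
Proof. by []. Qed.
Lemma fmode0 n w : (0 : vfield) n w = 0.
Proof. by []. Qed.

Lemma vfieldP (c d : vfield) : (forall n w, c n w = d n w) -> c = d.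
Proof. by move=> cd; apply/val_inj/funext => n; apply/funext => w; apply: cd. Qed.

Lemma fmode_sum (I : Type) (r : seq I) P (F : I -> vfield) n w :
  (\sum_(i <- r | P i) F i) n w = \sum_(i <- r | P i) F i n w.
Proof. by elim/big_rec2: _ => // i y x _ <-. Qed.

Lemma fmode_bound (c : vfield) (w : W) (k : int) :
  exists N : nat, forall i : nat, (N <= i)%N -> c (k + i%:Z) w = 0.
Proof.
have [N cN] := fmode_trunc c w.
by exists `|N - k|%N => i iN; apply: cN; lia.
Qed.

(** Truncation bounds depend on the vector; in a double sum the inner vector varies with the outer
    index, which itself has a finite range, so one bound serves all. *)
Lemma fmode_bound_seq (M : nat) (c : nat -> vfield) (w : nat -> W) (k : nat -> int) :
  exists N : nat, forall j i : nat, (j < M)%N -> (N <= i)%N ->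
    c j (k j + i%:Z) (w j) = 0.
Proof.
elim: M => [|M [N hN]]; first by exists 0%N.
have [N' hN'] := fmode_bound (c M) (w M) (k M).
exists (maxn N N') => j i; rewrite ltnS leq_eqVlt geq_max.
by move=> /orP[/eqP ->|jM] /andP[iN iN']; [apply: hN'|apply: hN].
Qed.

End Fields.

(** * Convolutions occurring in commutators of n-th products *)

Section BinomialSums.
Variable K : numFieldType.
Local Notation binz := (binz K).

Lemma binz_swap m i r : binz m i * binz (m - i%:Z) r = binz m r * binz (m - r%:Z) i.
Proof.
by rewrite -!binz_trinomial addnC -bin_sub ?leq_addl // addnK.
Qed.

(** The coefficient on the s-th diagonal in the commutator of left multiplications: the factor
    binom(m, r) comes out, and Vandermonde applies to the rest. *)
Lemma binz_swap_sum m n r s :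
  \sum_(i < s.+1) binz m i * binz n (s - i)%N * binz (m - i%:Z) r
  = binz m r * binz (m + n - r%:Z) s.
Proof.
have -> : m + n - r%:Z = m - r%:Z + n by lia.
rewrite -binz_vandermonde mulr_sumr; apply: eq_bigr => i _.
by rewrite mulrAC binz_swap mulrA.
Qed.

(** The analogue for right multiplications, where the commutator formula is applied to the modes i
    and j themselves and contributes binom(i, r). Terms with i < r vanish, and trinomial revision
    reduces the others to Vandermonde. *)
Lemma binz_choose_sum m n r s :
  \sum_(i < (r + s).+1) binz m i * binz n (r + s - i)%N * binz i r
  = binz m r * binz (m + n - r%:Z) s.
Proof.
have -> : m + n - r%:Z = m - r%:Z + n by lia.
rewrite -binz_vandermonde mulr_sumr.
rewrite -(big_mkord xpredT (fun i => binz m i * binz n (r + s - i)%N * binz i r)).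
rewrite (@big_cat_nat _ _ _ r) //=; last by rewrite leqW ?leq_addr.
rewrite big_nat_cond big1 ?add0r; last first.
  by move=> i /andP[/andP[_ h] _]; rewrite binz_nat bin_small ?mulr0.
have := big_addn 0 (r + s).+1 r xpredT
  (fun i => binz m i * binz n (r + s - i)%N * binz i r).
rewrite add0n => ->; rewrite -addnS addKn big_mkord; apply: eq_bigr => i _.
rewrite [(i + r)%N]addnC subnDl mulrAC (binz_nat _ (r + i)) binz_trinomial.
by rewrite mulrA.
Qed.

Lemma binz_choose_sum_small m n r s : (s < r)%N ->
  \sum_(i < s.+1) binz m i * binz n (s - i)%N * binz i r = 0.
Proof.
move=> sr; apply: big1 => i _; rewrite binz_nat bin_small ?mulr0 //.
exact: leq_trans (ltn_ord i) sr.
Qed.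

End BinomialSums.

Lemma signzB (K : numFieldType) (m : int) (r : nat) :
  (-1) ^ (m - r%:Z) = (-1) ^ m * (-1) ^+ r :> K.
Proof.
by rewrite expfzDr ?oppr_eq0 ?oner_eq0 // -exprnN -exprVn invrN1.
Qed.

(** The vectors u and v stand for the mixed terms, with one left and one right multiplication; they
    occur twice with opposite signs. *)
Lemma commutator_rearrange (K : comNzRingType) (W : lmodType K) (x y : K)
    (p q s t u v : W) :
  (p - x *: u - y *: (v - x *: s)) - (q - y *: v - x *: (u - y *: t))
  = p - q - (y * x) *: (t - s).
Proof.
rewrite !scalerBr !scalerA [x * y]mulrC; move: (x *: u) (y *: v) => {}u {}v.
rewrite !opprB (AC ((2*2)*(2*2)) ((1*8)*(3*6)*((5*2)*(7*4)))) /= !subrr !addr0.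
by [].
Qed.

Section Products.
Variables (K : numFieldType) (W : lmodType K).
Local Notation binz := (binz K).
Local Notation field := (vfield W).
Implicit Types (a b c d : field) (m n k : int) (w : W).

(* The two halves of the n-th product of fields
     Res_x1 ((x1 - x)^n a(x1) c(x) - (-x + x1)^n c(x) a(x1)),
   the sign (-1)^n being left out of [fminus_fun]. *)
Definition fplus_fun a n c k w : W :=
  \sum_(i \in [set: nat])
    ((-1) ^+ i * binz n i) *: a (n - i%:Z) (c (k + i%:Z) w).

Definition fminus_fun a n c k w : W :=
  \sum_(i \in [set: nat])
    ((-1) ^+ i * binz n i) *: c (n + k - i%:Z) (a i%:Z w).

Lemma fplus_funE N a n c k w :
    (forall i : nat, (N <= i)%N -> c (k + i%:Z) w = 0) ->
  fplus_fun a n c k w =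
  \sum_(i < N) ((-1) ^+ i * binz n i) *: a (n - i%:Z) (c (k + i%:Z) w).
Proof. by move=> cN; apply: fsum_nat => i /cN ->; rewrite linear0 scaler0. Qed.

Lemma fminus_funE N a n c k w :
    (forall i : nat, (N <= i)%N -> a i%:Z w = 0) ->
  fminus_fun a n c k w =
  \sum_(i < N) ((-1) ^+ i * binz n i) *: c (n + k - i%:Z) (a i%:Z w).
Proof. by move=> cN; apply: fsum_nat => i /cN ->; rewrite linear0 scaler0. Qed.

Lemma fmode_bound0 a w : exists N, forall i : nat, (N <= i)%N -> a i%:Z w = 0.
Proof.
by have [N aN] := fmode_bound a w 0; exists N => i /aN; rewrite add0r.
Qed.

Fact fplus_subproof a n c : fplus_fun a n c \in @is_field _ W.
Proof.
apply/asboolP; split=> [k e u v|w].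
  have [M cM] := fmode_bound c u k; have [N cN] := fmode_bound c v k.
  rewrite !(@fplus_funE (maxn M N)); try by [move=> i; rewrite geq_max => /andP[h1 h2];
    rewrite ?linearP ?fmodeD ?fmodeZ /= ?cM ?cN ?scaler0 ?addr0].
  rewrite scaler_sumr -big_split; apply: eq_bigr => i _ /=.
  by rewrite !linearP /= !scalerA mulrC.
have [N cN] := fmode_trunc c w; exists N => k Nk.
rewrite (@fplus_funE 0) ?big_ord0 // => i _; apply: cN; lia.
Qed.

Fact fminus_subproof a n c : fminus_fun a n c \in @is_field _ W.
Proof.
apply/asboolP; split=> [k e u v|w].
  have [M cM] := fmode_bound0 a u; have [N cN] := fmode_bound0 a v.
  rewrite !(@fminus_funE (maxn M N)); try by [move=> i; rewrite geq_max => /andP[h1 h2];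
    rewrite ?linearP ?fmodeD ?fmodeZ /= ?cM ?cN ?scaler0 ?addr0].
  rewrite scaler_sumr -big_split; apply: eq_bigr => i _ /=.
  by rewrite !linearP /= !scalerA mulrC.
have [M aM] := fmode_bound0 a w.
(* Only the finitely many vectors a(j) w with j < M enter, and c truncates on each of them. *)
have [N cN] := @fmode_bound_seq _ _ M (fun _ => c) (fun j => a j%:Z w) (fun j => n - j%:Z).
exists N%:Z => k Nk; rewrite (fminus_funE _ _ _ aM) big1 // => i _.
have -> : n + k - i%:Z = n - i%:Z + `|k|%N%:Z by lia.
by rewrite cN ?scaler0 //; lia.
Qed.

Definition fplus a n c : field := VField (fplus_subproof a n c).
Definition fminus a n c : field := VField (fminus_subproof a n c).
Definition nprod a n c : field := fplus a n c - (-1) ^ n *: fminus a n c.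

Arguments fplus : simpl never.
Arguments fminus : simpl never.
Arguments nprod : simpl never.

Lemma fplusE N a n c k w :
    (forall i : nat, (N <= i)%N -> c (k + i%:Z) w = 0) ->
  fplus a n c k w =
  \sum_(i < N) ((-1) ^+ i * binz n i) *: a (n - i%:Z) (c (k + i%:Z) w).
Proof. exact: fplus_funE. Qed.

Lemma fminusE N a n c k w :
    (forall i : nat, (N <= i)%N -> a i%:Z w = 0) ->
  fminus a n c k w =
  \sum_(i < N) ((-1) ^+ i * binz n i) *: c (n + k - i%:Z) (a i%:Z w).
Proof. exact: fminus_funE. Qed.

Lemma fplus_linearr a n : linear (fplus a n).
Proof.
move=> x c d; apply: vfieldP => k w; rewrite fmodeD fmodeZ.
have [M cM] := fmode_bound c w k; have [N cN] := fmode_bound d w k.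
rewrite !(@fplusE (maxn M N)); try by [move=> i; rewrite geq_max => /andP[h1 h2];
    rewrite ?linearP ?fmodeD ?fmodeZ /= ?cM ?cN ?scaler0 ?addr0].
rewrite scaler_sumr -big_split; apply: eq_bigr => i _.
by rewrite fmodeD fmodeZ !linearP /= !scalerA mulrC.
Qed.

Lemma fminus_linearr a n : linear (fminus a n).
Proof.
move=> x c d; apply: vfieldP => k w; rewrite fmodeD fmodeZ.
have [M aM] := fmode_bound0 a w; rewrite !(fminusE _ _ _ aM).
rewrite scaler_sumr -big_split; apply: eq_bigr => i _.
by rewrite fmodeD fmodeZ !linearP /= !scalerA mulrC.
Qed.
HB.instance Definition _ a n :=
  GRing.isLinear.Build K field field *:%R (fplus a n) (fplus_linearr a n).
HB.instance Definition _ a n :=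
  GRing.isLinear.Build K field field *:%R (fminus a n) (fminus_linearr a n).

Lemma fplus_linearl n c : linear (fun a => fplus a n c).
Proof.
move=> x a b; apply: vfieldP => k w; rewrite fmodeD fmodeZ.
have [M cM] := fmode_bound c w k; rewrite !(fplusE _ _ cM).
rewrite scaler_sumr -big_split; apply: eq_bigr => i _.
by rewrite fmodeD fmodeZ !linearP /= !scalerA mulrC.
Qed.

Lemma fminus_linearl n c : linear (fun a => fminus a n c).
Proof.
move=> x a b; apply: vfieldP => k w; rewrite fmodeD fmodeZ.
have [M cM] := fmode_bound0 a w; have [N cN] := fmode_bound0 b w.
rewrite !(@fminusE (maxn M N)); try by [move=> i; rewrite geq_max => /andP[h1 h2];
    rewrite ?linearP ?fmodeD ?fmodeZ /= ?cM ?cN ?scaler0 ?addr0].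
rewrite scaler_sumr -big_split; apply: eq_bigr => i _.
by rewrite fmodeD fmodeZ !linearP /= !scalerA mulrC.
Qed.

Lemma nprod_linearr a n : linear (nprod a n).
Proof.
move=> x c d; by rewrite /nprod !linearP /= scalerDr addrACA.
Qed.
HB.instance Definition _ a n :=
  GRing.isLinear.Build K field field *:%R (nprod a n) (nprod_linearr a n).

Lemma nprod_linearl n c : linear (fun a => nprod a n c).
Proof.
move=> x a b; rewrite /nprod fplus_linearl fminus_linearl scalerBr !scalerDr !scalerA.
by rewrite [_ * x]mulrC opprD addrACA.
Qed.

(** Modes of a are applied after c and modes of b before c, so both sides are the same double sum of
    products a c b. *)
Lemma fplus_fminus a b c m n : fplus a m (fminus b n c) = fminus b n (fplus a m c).
Proof.
apply: vfieldP => k w; have [N bN] := fmode_bound0 b w.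
rewrite [RHS](fminusE _ _ _ bN).
have [M cM] := @fmode_bound_seq _ _ N (fun _ => c) (fun j => b j%:Z w) (fun j => n + k - j%:Z).
rewrite (@fplusE M); last first.
  move=> i iM; rewrite (fminusE _ _ _ bN) big1 // => j _.
  by rewrite (_ : _ - _ = n + k - j%:Z + i%:Z) ?cM ?scaler0 //; lia.
under eq_bigr => i _ do rewrite (fminusE _ _ _ bN) linear_sum scaler_sumr.
rewrite exchange_big; apply: eq_bigr => j _.
rewrite (@fplusE M); last by move=> i; apply: cM.
rewrite scaler_sumr; apply: eq_bigr => i _.
rewrite /= fmodeZr !scalerA mulrC; congr (_ *: a _ (c _ _)); lia.
Qed.

(** The hypothesis says that d is the derivative of c. This is Leibniz' rule for the product of
    index m, the derivative of a contributing -m times the product of index m - 1. The two halves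
    are treated apart because (-1)^m changes sign with m. *)
Lemma nprod_deriv a c d m k w :
    (forall k' w', d k' w' = - (k'%:~R *: c (k' - 1) w')) ->
  nprod a m d k w - m%:~R *: nprod a (m - 1) c k w
  = - (k%:~R *: nprod a m c (k - 1) w).
Proof.
move=> dE.
have plus : fplus a m d k w - m%:~R *: fplus a (m - 1) c k w
    = - (k%:~R *: fplus a m c (k - 1) w).
  have [N cN] := fmode_bound c w (k - 1).
  rewrite (@fplusE N.+1 a m d k w) => [|i h]; last first.
    by rewrite dE addrAC cN ?scaler0 ?oppr0 // ltnW.
  rewrite (@fplusE N.+1 a m c (k - 1) w) => [|i h]; last by rewrite cN // ltnW.
  rewrite (@fplusE N a (m - 1) c k w) => [|i h]; last first.
    by rewrite (_ : k + i%:Z = k - 1 + i.+1%:Z) ?cN; [|lia|lia].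
  (* The terms i = 0 agree; terms i + 1 of the two sums of index m are then compared with term i of
     the sum of index m - 1. *)
  rewrite !big_ord_recl /= dE fmodeNr fmodeZr !addr0 binz0 mulr1 !scale1r.
  rewrite -addrA scalerDr opprD; congr (_ + _).
  rewrite !scaler_sumr -sumrB -sumrN; apply: eq_bigr => i _.
  rewrite /bump leq0n add1n dE fmodeNr fmodeZr.
  rewrite (_ : k + i.+1%:Z - 1 = k + i%:Z); last by lia.
  rewrite (_ : k - 1 + i.+1%:Z = k + i%:Z); last by lia.
  rewrite (_ : m - i.+1%:Z = m - 1 - i%:Z); last by lia.
  rewrite scalerN !scalerA -!scaleNr -scalerDl; congr (_ *: _).
  have := binzSl K (m - 1) i; rewrite subrK => e.
  rewrite [m%:~R * _]mulrCA -e exprS (_ : (k + i.+1%:Z)%:~R = k%:~R + i.+1%:R :> K) ?intrD //.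
  by ring.
have minus : fminus a m d k w + m%:~R *: fminus a (m - 1) c k w
    = - (k%:~R *: fminus a m c (k - 1) w).
  have [N aN] := fmode_bound0 a w; rewrite !(fminusE _ _ _ aN).
  rewrite !scaler_sumr -sumrN -big_split; apply: eq_bigr => i _ /=.
  rewrite dE (_ : m - 1 + k - i%:Z = m + k - i%:Z - 1); last by lia.
  rewrite (_ : m + (k - 1) - i%:Z = m + k - i%:Z - 1); last by lia.
  rewrite scalerN !scalerA -!scaleNr -scalerDl; congr (_ *: _).
  rewrite [m%:~R * _]mulrCA -binz_pred (_ : m + k - i%:Z = k + (m - i%:Z)) ?[in LHS]intrD;
    last by lia.
  by ring.
rewrite /nprod !fmodeB !fmodeZ (_ : (-1) ^ (m - 1) = - (-1) ^ m :> K); last first.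
  by rewrite (signzB _ m 1) mulrN1.
rewrite scaleNr opprK scalerDr opprD addrACA plus scalerA mulrC -scalerA.
by rewrite -opprD -scalerDr minus scalerN opprK scalerBr opprB addrC !scalerA mulrC.
Qed.

Section Commutator.
Variables (a b : field) (R : nat) (t : nat -> field).
Hypothesis comm : forall m k w, a m (b k w) - b k (a m w)
  = \sum_(r < R) binz m r *: t r (m + k - r%:Z) w.

(** The commutator formula is applied to a(m - i) and b(n - j). The resulting modes depend on i and
    j only through i + j, and along a diagonal the coefficients add up by [binz_swap_sum]. *)
Lemma fplus_comm m n c : fplus a m (fplus b n c) - fplus b n (fplus a m c)
  = \sum_(r < R) binz m r *: fplus (t r) (m + n - r%:Z) c.
Proof.
apply: vfieldP => k w; rewrite fmodeB fmode_sum.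
have [N cN] := fmode_bound c w k.
have cN' (i j : nat) : (N <= i + j)%N -> c (k + i%:Z + j%:Z) w = 0.
  by move/cN; rewrite PoszD addrA.
have inner d p (i : nat) : fplus d p c (k + i%:Z) w = \sum_(j < N)
    ((-1) ^+ j * binz p j) *: d (p - j%:Z) (c (k + (i + j)%N%:Z) w).
  rewrite (@fplusE N) => [|j jN]; last by apply: cN'; rewrite (leq_trans jN) ?leq_addl.
  by apply: eq_bigr => j _; rewrite PoszD addrA.
have inner0 d p (i : nat) : (N <= i)%N -> fplus d p c (k + i%:Z) w = 0.
  by move=> iN; rewrite inner big1 // => j _;
    rewrite cN ?linear0 ?scaler0 // (leq_trans iN) ?leq_addr.
rewrite !(@fplusE N); try by move=> i; apply: inner0.
under eq_bigr => i _ do rewrite inner linear_sum scaler_sumr.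
under [X in _ - X]eq_bigr => i _ do rewrite inner linear_sum scaler_sumr.
rewrite [X in _ - X]exchange_big -sumrB.
pose F (i j : nat) := ((-1) ^+ (i + j)%N * (binz m i * binz n j)) *:
  \sum_(r < R) binz (m - i%:Z) r *:
    t r (m + n - (i + j)%N%:Z - r%:Z) (c (k + (i + j)%N%:Z) w).
transitivity (\sum_(i < N) \sum_(j < N) F i j).
  apply: eq_bigr => i _; rewrite -sumrB; apply: eq_bigr => j _.
  rewrite /= !fmodeZr !scalerA [(j + i)%N]addnC [X in _ - X *: _]mulrC.
  rewrite -scalerBr comm /F; congr (_ *: _); first by rewrite exprD mulrACA.
  by apply: eq_bigr => r _; congr (_ *: t r _ _); lia.
rewrite sum_diag; last first.
  by move=> i j /cN e; rewrite /F e big1 ?scaler0 // => r _; rewrite linear0 scaler0.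
under [RHS]eq_bigr => r _ do rewrite fmodeZ (fplusE _ _ cN) scaler_sumr.
rewrite [RHS]exchange_big; apply: eq_bigr => s _ /=.
transitivity (\sum_(r < R) \sum_(i < s.+1) ((-1) ^+ s * (binz m i * binz n (s - i)%N
   * binz (m - i%:Z) r)) *: t r (m + n - s%:Z - r%:Z) (c (k + s%:Z) w)).
  rewrite exchange_big; apply: eq_bigr => i _ /=.
  rewrite /F subnKC -1?ltnS // scaler_sumr; apply: eq_bigr => r _.
  by rewrite scalerA !mulrA.
apply: eq_bigr => r _; rewrite -scaler_suml -mulr_sumr binz_swap_sum.
rewrite scalerA mulrCA; congr (_ *: t r _ _); lia.
Qed.

(** Right multiplications compose in the opposite order, hence b stands first. The commutator of
    a(i) and b(j) contains [t r] at the mode i + j - r, so the diagonals are shifted by r against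
    the right hand side; this shift is the origin of the sign (-1)^r. *)
Lemma fminus_comm m n c : fminus b n (fminus a m c) - fminus a m (fminus b n c)
  = \sum_(r < R) ((-1) ^+ r * binz m r) *: fminus (t r) (m + n - r%:Z) c.
Proof.
apply: vfieldP => k w; rewrite fmodeB fmode_sum.
have [N1 aN1] := fmode_bound0 a w; have [N2 bN2] := fmode_bound0 b w.
have [N3 abN] := @fmode_bound_seq _ _ N2 (fun _ => a) (fun j => b j%:Z w) (fun _ => 0).
have [N4 baN] := @fmode_bound_seq _ _ N1 (fun _ => b) (fun j => a j%:Z w) (fun _ => 0).
have {}abN (i j : nat) : (N3 <= i)%N -> a i (b j w) = 0.
  by case: (ltnP j N2) => [h /(abN _ _ h)|/bN2 ->]; rewrite ?linear0 ?add0r.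
have {}baN (i j : nat) : (N4 <= j)%N -> b j (a i w) = 0.
  by case: (ltnP i N1) => [h /(baN _ _ h)|/aN1 ->]; rewrite ?linear0 ?add0r.
have [N5 tN5] := @fmode_bound_seq _ _ R t (fun _ => w) (fun r => - r%:Z).
pose N := (N1 + N2 + N3 + N4 + N5)%N.
have tN (r : 'I_R) (i : nat) : (N <= i)%N -> t r i%:Z w = 0.
  move=> iN; rewrite (_ : i%:Z = - r%:Z + (r + i)%N%:Z); last by lia.
  by apply: tN5 => //; lia.
have abN' (j i : nat) : (N + N <= i)%N -> a i (b j w) = 0.
  by move=> h; apply: abN; lia.
have baN' (i j : nat) : (N + N <= j)%N -> b j (a i w) = 0.
  by move=> h; apply: baN; lia.
have aN (i : nat) : (N + N <= i)%N -> a i w = 0 by move=> h; apply: aN1; lia.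
have bN (i : nat) : (N + N <= i)%N -> b i w = 0 by move=> h; apply: bN2; lia.
rewrite (fminusE _ _ _ aN) (fminusE _ _ _ bN).
under eq_bigr => j _ do rewrite (fminusE _ _ _ (abN' j)) scaler_sumr.
under [X in _ - X]eq_bigr => i _ do rewrite (fminusE _ _ _ (baN' i)) scaler_sumr.
rewrite [X in X - _]exchange_big -sumrB.
pose F (r i j : nat) := ((-1) ^+ (i + j)%N * (binz m i * binz n j * binz i r)) *:
  c (m + n + k - (i + j)%N%:Z) (t r ((i + j)%N%:Z - r%:Z) w).
transitivity (\sum_(i < N + N) \sum_(j < N + N) \sum_(r < R) F r i j).
  apply: eq_bigr => i _; rewrite -sumrB; apply: eq_bigr => j _.
  rewrite !scalerA [X in X *: _ - _]mulrC.
  rewrite (_ : m + (n + k - j%:Z) - i%:Z = m + n + k - (i + j)%N%:Z); last by lia.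
  rewrite (_ : n + (m + k - i%:Z) - j%:Z = m + n + k - (i + j)%N%:Z); last by lia.
  rewrite -scalerBr -linearB comm linear_sum scaler_sumr; apply: eq_bigr => r _ /=.
  by rewrite fmodeZr scalerA /F; congr (_ *: _); rewrite exprD; ring.
under eq_bigr => i _ do rewrite exchange_big.
rewrite exchange_big; apply: eq_bigr => r _.
rewrite fmodeZ (@fminusE (N + N)); last by move=> i h; apply: tN; lia.
have F0 i j : (N + N <= i + j)%N -> F r i j = 0.
  move=> h; rewrite /F; case: (ltnP i r) => [ir|ri].
    by rewrite (binz_nat _ i) (bin_small ir) !mulr0 scale0r.
  rewrite [_%:Z - _]addrC tN5 //; last by lia.
  by rewrite linear0 scaler0.
rewrite (sum_diag F0) scaler_sumr.
pose G s := \sum_(i < s.+1) F r i (s - i)%N.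
have GE s : G s = ((-1) ^+ s * \sum_(i < s.+1) (binz m i * binz n (s - i)%N * binz i r)) *:
    c (m + n + k - s%:Z) (t r (s%:Z - r%:Z) w).
  rewrite /G mulr_sumr scaler_suml; apply: eq_bigr => i _.
  by rewrite /F subnKC // -ltnS.
rewrite -/(\sum_(s < N + N) G s).
have GN s : (N5 <= s)%N -> G s = 0.
  by move=> h; rewrite GE [_%:Z - _]addrC tN5 // linear0 scaler0.
(* The range is extended by r so that, once the vanishing diagonals s < r are split off, the others
   match the terms on the right one by one. *)
rewrite (@sum_ord_widen _ _ (r + (N + N)) G) ?leq_addl //; last by move=> i h; apply: GN; lia.
rewrite big_split_ord /= big1 ?add0r; last first.
  by move=> s _; rewrite GE binz_choose_sum_small // mulr0 scale0r.
apply: eq_bigr => s _; rewrite GE binz_choose_sum scalerA exprD -!mulrA.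
rewrite [_ ^+ s * _]mulrCA.
congr (_ *: c _ (t r _ _)); [by ring|lia|lia].
Qed.

(* Left multiplications commute with right ones, so only the commutator of a
   and b enters: c need not be local to a or b. *)
Lemma nprod_comm m n c : nprod a m (nprod b n c) - nprod b n (nprod a m c)
  = \sum_(r < R) binz m r *: nprod (t r) (m + n - r%:Z) c.
Proof.
rewrite /nprod.
have fplusBZ d p u x v : fplus d p (u - x *: v) = fplus d p u - x *: fplus d p v.
  by rewrite linearB /= linearZ.
have fminusBZ d p u x v : fminus d p (u - x *: v) = fminus d p u - x *: fminus d p v.
  by rewrite linearB /= linearZ.
rewrite (fplusBZ a m (fplus b n c) _ (fminus b n c)).
rewrite (fplusBZ b n (fplus a m c) _ (fminus a m c)).
rewrite (fminusBZ a m (fplus b n c) _ (fminus b n c)).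
rewrite (fminusBZ b n (fplus a m c) _ (fminus a m c)).
rewrite (fplus_fminus a b) (fplus_fminus b a).
rewrite commutator_rearrange.
rewrite fplus_comm fminus_comm scaler_sumr -sumrB; apply: eq_bigr => r _.
rewrite scalerBr; congr (_ - _); rewrite !scalerA; congr (_ *: _).
by rewrite signzB expfzDr ?oppr_eq0 ?oner_eq0 //; ring.
Qed.

End Commutator.
End Products.

(** * The Borcherds identity *)

Section Borcherds.
Variables (K : numFieldType) (W : lmodType K).
Local Notation binz := (binz K).
Local Notation field := (vfield W).
Implicit Types (a b c d U V : field) (Z : int -> field) (m n k p : int) (w : W).

(* The modes of (x1 - x2)^n U(x1) V(x2), expanded for |x1| > |x2|. *)
Definition half_bracket U V n p k w : W :=
  \sum_(i \in [set: nat])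
    ((-1) ^+ i * binz n i) *: U (p - i%:Z) (V (k + i%:Z) w).

Lemma half_bracketE N U V n p k w :
    (forall i : nat, (N <= i)%N -> V (k + i%:Z) w = 0) ->
  half_bracket U V n p k w =
  \sum_(i < N) ((-1) ^+ i * binz n i) *: U (p - i%:Z) (V (k + i%:Z) w).
Proof. by move=> cN; apply: fsum_nat => i /cN ->; rewrite linear0 scaler0. Qed.

Lemma half_bracket_pascal U V n p k w :
  half_bracket U V (n + 1) p k w
  = half_bracket U V n p k w - half_bracket U V n (p - 1) (k + 1) w.
Proof.
have [N VN] := fmode_bound V w k.
rewrite !(@half_bracketE N.+1 U V _ _ k w); try by move=> i h; apply: VN; lia.
rewrite (@half_bracketE N) => [|i h]; last by rewrite -addrA -PoszD VN //; lia.
rewrite !big_ord_recl !binz0 -addrA -sumrB.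
congr (_ + _); apply: eq_bigr => i _; rewrite lift0 binz_pascal mulrDr scalerDl.
rewrite exprS mulN1r !mulNr scaleNr; congr (_ + _).
rewrite scaleNr; congr (- (_ *: U _ (V _ _))); lia.
Qed.

Definition borcherds_lhs U V m n k w : W :=
  half_bracket U V n (m + n) k w - (-1) ^ n *: half_bracket V U n (n + k) m w.

Definition borcherds_rhs Z m n k w : W :=
  \sum_(i \in [set: nat]) binz m i *: Z (n + i%:Z) (m + k - i%:Z) w.

(** The Jacobi identity of a single pair: U, V and Z n are meant to be the fields of u, v and u_n v.
    It mentions no vertex algebra, so it serves both for Y on V and for fields on W. *)
Definition borcherds U V Z : Prop :=
  forall m n k w, borcherds_lhs U V m n k w = borcherds_rhs Z m n k w.

Definition trunc_family Z : Prop := exists N : int, forall n, N <= n -> Z n = 0.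

Lemma trunc_familyP Z n : trunc_family Z ->
  exists N : nat, forall i : nat, (N <= i)%N -> Z (n + i%:Z) = 0.
Proof.
move=> [N ZN]; exists `|N - n|%N => i h; apply: ZN; lia.
Qed.

Lemma jacobi_lhsE U V m n k w :
  \sum_(i \in [set: nat]) ((-1) ^+ i * binz n i) *:
    (U (m + n - i%:Z) (V (k + i%:Z) w)
     - (-1) ^ n *: V (n + k - i%:Z) (U (m + i%:Z) w))
  = borcherds_lhs U V m n k w.
Proof.
have [N VN] := fmode_bound V w k; have [M UM] := fmode_bound U w m.
have VN' (i : nat) : (maxn N M <= i)%N -> V (k + i%:Z) w = 0.
  by rewrite geq_max => /andP[/VN].
have UM' (i : nat) : (maxn N M <= i)%N -> U (m + i%:Z) w = 0.
  by rewrite geq_max => /andP[_ /UM].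
rewrite /borcherds_lhs (half_bracketE _ _ _ VN') (half_bracketE _ _ _ UM').
rewrite (@fsum_nat _ (maxn N M)).
  rewrite scaler_sumr -sumrB; apply: eq_bigr => i _.
  by rewrite scalerBr !scalerA [_ ^ n * _]mulrC.
by move=> i h; rewrite VN' // UM' // !linear0 addr0 scaler0.
Qed.

Lemma borcherds_rhsE N Z m n k w :
    (forall i : nat, (N <= i)%N -> Z (n + i%:Z) = 0) ->
  borcherds_rhs Z m n k w =
  \sum_(i < N) binz m i *: Z (n + i%:Z) (m + k - i%:Z) w.
Proof. by move=> ZN; apply: fsum_nat => i /ZN ->; rewrite scaler0. Qed.

Lemma borcherds_lhs0 U V n k w : borcherds_lhs U V 0 n k w = nprod U n V k w.
Proof.
rewrite /borcherds_lhs add0r /nprod fmodeB fmodeZ; congr (_ - _ *: _).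
Qed.

Lemma borcherds_rhs0 Z n k w : borcherds_rhs Z 0 n k w = Z n k w.
Proof.
rewrite /borcherds_rhs (@fsum_nat _ 1); last first.
  by move=> [|i] //; rewrite binz0n scale0r.
by rewrite big_ord1 binz0 scale1r addr0 add0r subr0.
Qed.

Lemma borcherds_lhsC U V m k w :
  borcherds_lhs U V m 0 k w = U m (V k w) - V k (U m w).
Proof.
have half_bracket0 A B p q : half_bracket A B 0 p q w = A p (B q w).
  rewrite /half_bracket (@fsum_nat _ 1) => [|[|i] //]; last first.
    by rewrite binz0n mulr0 scale0r.
  by rewrite big_ord1 binz0 mulr1 scale1r addr0 subr0.
by rewrite /borcherds_lhs !half_bracket0 addr0 add0r expr0z scale1r.
Qed.

(* Multiplication by x1 = x2 + (x1 - x2). *)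
Lemma borcherds_lhs_pascal U V m n k w : borcherds_lhs U V (m + 1) n k w
  = borcherds_lhs U V m (n + 1) k w + borcherds_lhs U V m n (k + 1) w.
Proof.
rewrite /borcherds_lhs !half_bracket_pascal expfzDr ?oppr_eq0 ?oner_eq0 // expr1z mulrN1.
rewrite !scaleNr opprK scalerBr.
have -> : m + (n + 1) = m + 1 + n by lia.
have -> : m + 1 + n - 1 = m + n by lia.
have -> : n + (k + 1) = n + 1 + k by lia.
have -> : n + 1 + k - 1 = n + k by lia.
rewrite [RHS](AC ((2*2)*2) ((1*4)*((2*5)*(3*6)))) /=.
by rewrite addNr add0r subrr addr0.
Qed.

Lemma borcherds_rhs_pascal Z m n k w : trunc_family Z ->
  borcherds_rhs Z (m + 1) n k w
  = borcherds_rhs Z m (n + 1) k w + borcherds_rhs Z m n (k + 1) w.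
Proof.
move=> /(trunc_familyP n)[N ZN].
rewrite !(@borcherds_rhsE N.+1 Z _ n); try by move=> i h; apply: ZN; lia.
rewrite (@borcherds_rhsE N) => [|i h]; last by rewrite -addrA -PoszD ZN //; lia.
rewrite !big_ord_recl !binz0 addrCA -big_split /=.
congr (_ + _); first by congr (_ *: Z _ _ _); lia.
apply: eq_bigr => i _; rewrite /bump leq0n add1n binz_pascal scalerDl addrC.
congr (_ *: Z _ _ _ + _ *: Z _ _ _); lia.
Qed.

(* By the two Pascal relations the defect D satisfies
     D (m + 1) n k = D m (n + 1) k + D m n (k + 1),
   so it vanishes as soon as it does for m = 0 and for n = 0. *)
Lemma borcherdsP U V Z : trunc_family Z ->
  (forall n, Z n = nprod U n V) ->
  (forall m k w, borcherds_lhs U V m 0 k w = borcherds_rhs Z m 0 k w) ->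
  borcherds U V Z.
Proof.
move=> Zt iter comm.
pose D m n k w := borcherds_lhs U V m n k w - borcherds_rhs Z m n k w.
have DP m n k w : D (m + 1) n k w = D m (n + 1) k w + D m n (k + 1) w.
  by rewrite /D borcherds_lhs_pascal borcherds_rhs_pascal // opprD addrACA.
suff D0 m n k w : D m n k w = 0.
  by move=> m n k w; apply/eqP; rewrite -subr_eq0; apply/eqP/D0.
have Dm (i : nat) n' k' w' : D i n' k' w' = 0.
  elim: i n' k' => [|i IH] n' k'.
    by rewrite /D borcherds_lhs0 borcherds_rhs0 iter subrr.
  by rewrite (_ : i.+1%:Z = i%:Z + 1) ?DP ?IH ?addr0 //; lia.
have Dn (i : nat) m' k' w' : D m' i k' w' = 0.
  elim: i m' k' => [|i IH] m' k'; first by rewrite /D comm subrr.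
  have := DP m' i%:Z k' w'; rewrite !IH addr0 => /esym.
  by rewrite (_ : i.+1%:Z = i%:Z + 1) //; lia.
have Dneg (i j : nat) k' w' : D (- i%:Z) (- j%:Z) k' w' = 0.
  elim: i j k' => [|i IHi] j k'; first by rewrite oppr0 Dm.
  elim: j k' => [|j IHj] k'; first by rewrite oppr0 Dn.
  have := DP (- i.+1%:Z) (- j.+1%:Z) (k' - 1) w'; rewrite subrK.
  rewrite (_ : - i.+1%:Z + 1 = - i%:Z); last by lia.
  rewrite (_ : - j.+1%:Z + 1 = - j%:Z); last by lia.
  by rewrite IHi IHj add0r => <-.
case: m n => m [] n; rewrite ?Dm // ?Dn // !NegzE; exact: Dneg.
Qed.

(** The left hand side is symmetric up to sign, so any asymmetry between u and v lies in the
    iterates on the right. Skew-symmetry results from comparing them. *)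
Lemma borcherds_lhs_sym U V m n k w :
  borcherds_lhs V U k n m w = - (-1) ^ n *: borcherds_lhs U V m n k w.
Proof.
rewrite /borcherds_lhs scalerBr !scaleNr scalerA [n + m]addrC [k + n]addrC.
by rewrite -expfzMl mulrNN mulr1 exp1rz scale1r opprK [RHS]addrC.
Qed.

Lemma borcherds_iter U V Z : borcherds U V Z -> forall n, Z n = nprod U n V.
Proof.
move=> J n; apply: vfieldP => k w.
by rewrite -borcherds_rhs0 -borcherds_lhs0 J.
Qed.

Lemma borcherds_rhs_linear x Z Z' m n k w : trunc_family Z -> trunc_family Z' ->
  borcherds_rhs (fun i => x *: Z i + Z' i) m n k w
  = x *: borcherds_rhs Z m n k w + borcherds_rhs Z' m n k w.
Proof.
move=> /(trunc_familyP n)[N ZN] /(trunc_familyP n)[M ZM].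
rewrite !(@borcherds_rhsE (maxn N M)); try by move=> i; rewrite geq_max
  => /andP[h1 h2]; rewrite ?ZN ?ZM ?scaler0 ?addr0.
rewrite scaler_sumr -big_split; apply: eq_bigr => i _.
by rewrite fmodeD fmodeZ scalerDr !scalerA mulrC.
Qed.

Fact id_field_subproof : (fun (n : int) w => if n == -1 then w else 0) \in @is_field _ W.
Proof.
apply/asboolP; split=> [n x u v|w]; first by case: eqP; rewrite ?scaler0 ?addr0.
by exists 0 => n n0; case: eqP n0 => // ->.
Qed.
Definition id_field : field := VField id_field_subproof.

Lemma id_fieldE n w : id_field n w = if n == -1 then w else 0.
Proof. by []. Qed.

Lemma nprod_idl n V : nprod id_field n V = if n == -1 then V else 0.
Proof.
apply: vfieldP => k w; rewrite /nprod fmodeB fmodeZ (@fminusE _ _ 0); last first.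
  by move=> i _; rewrite id_fieldE.
rewrite big_ord0 scaler0 subr0; have [N VN] := fmode_bound V w k.
rewrite (@fplusE _ _ N.+1) => [|i h]; last by apply: VN; apply: ltnW.
rewrite big_ord_recl binz0 mulr1 scale1r subr0 addr0 id_fieldE big1 => [|i _].
  by rewrite addr0; case: eqP.
(* The identity field has only the mode -1, which forces n = i; there the coefficient binom(n, n +
   1) vanishes. *)
rewrite id_fieldE; case: eqP => [e|_]; last by rewrite scaler0.
have -> : n = i%:Z by rewrite /= /bump leq0n add1n in e; lia.
by rewrite binz_nat bin_small ?mulr0 ?scale0r //= /bump leq0n.
Qed.

Lemma borcherds_id_field V : borcherds id_field V (fun n => if n == -1 then V else 0).
Proof.
apply: borcherdsP; first by exists 0 => n n0; case: eqP n0 => // ->.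
  by move=> n; rewrite nprod_idl.
move=> m k w; rewrite borcherds_lhsC !id_fieldE (@borcherds_rhsE 0) ?big_ord0 => [|i _].
  by case: eqP => _; rewrite ?subrr // linear0 subr0.
by rewrite add0r.
Qed.

(** The identity as left factor is understood completely, and [borcherds_lhs_sym] carries this over
    to the right factor. This is what makes [id_field] a vacuum vector in the space of fields. *)
Lemma nprod_idr (n : nat) V : nprod V n%:Z id_field = 0.
Proof.
apply: vfieldP => k w; rewrite -borcherds_lhs0 borcherds_lhs_sym borcherds_id_field.
by rewrite (@borcherds_rhsE 0) ?big_ord0 ?scaler0 // => i _; rewrite ifN.
Qed.

Lemma nprodN1_idr V : nprod V (-1) id_field = V.
Proof.
apply: vfieldP => k w; rewrite -borcherds_lhs0 borcherds_lhs_sym borcherds_id_field.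
rewrite (@borcherds_rhsE 1) => [|[|i] //].
by rewrite big_ord1 binz0 scale1r addr0 subr0 addr0 eqxx exprN1 invrN1 opprK scale1r.
Qed.

End Borcherds.

(** * Modules from generating fields *)

Section Extension.
Variables (K : numFieldType) (V W : lmodType K).
Variables (Y : V -> int -> V -> V) (vac : V).
Hypothesis VA : vertex_algebra Y vac.
Local Notation binz := (binz K).

Fact va_field_subproof u : Y u \in @is_field _ V.
Proof.
by apply/asboolP; split=> [n|w]; [apply: (va_linearr VA)|apply: (va_truncated VA)].
Qed.
(** With Y viewed as a family of fields on V, the results on fields apply inside the vertex algebra
    too. *)
Definition va_field u : vfield V := VField (va_field_subproof u).

Lemma va_bound u v n : exists N : nat, forall i : nat, (N <= i)%N -> Y u (n + i%:Z) v = 0.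
Proof. exact: (fmode_bound (va_field u)). Qed.

Lemma va_field_borcherds u v :
  borcherds (va_field u) (va_field v) (fun n => va_field (Y u n v)).
Proof.
move=> m n k w; rewrite -jacobi_lhsE; exact: (va_jacobi VA).
Qed.

Lemma Y0l n v : Y 0 n v = 0.
Proof. by have := va_linearl VA n v (-1) 0 0; rewrite scaler0 addr0 scaleN1r addNr. Qed.

Lemma Y0r u n : Y u n 0 = 0.
Proof. exact: (linear0 (va_field u n)). Qed.

Variable phi : {linear V -> vfield W}.
Hypothesis phi_vac : phi vac = id_field W.

Lemma phiB u v : phi (u - v) = phi u - phi v. Proof. exact: linearB. Qed.
Lemma phiD u v : phi (u + v) = phi u + phi v. Proof. exact: linearD. Qed.
Lemma phiZ x u : phi (x *: u) = x *: phi u. Proof. exact: linearZ. Qed.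

Let Z u v n := phi (Y u n v).

Lemma phi_trunc u v : trunc_family (Z u v).
Proof.
by have [N YN] := va_truncated VA u v; exists N => n h; rewrite /Z YN // linear0.
Qed.

Definition comm_at u v := forall m k w,
  phi u m (phi v k w) - phi v k (phi u m w) = borcherds_rhs (Z u v) m 0 k w.
Definition iter_at u v := forall n, phi (Y u n v) = nprod (phi u) n (phi v).
Definition borcherds_at u v := borcherds (phi u) (phi v) (Z u v).

Lemma borcherds_atP u v : borcherds_at u v <-> comm_at u v /\ iter_at u v.
Proof.
split=> [J|[C I]]; first split.
- by move=> m k w; rewrite -borcherds_lhsC J.
- exact: borcherds_iter J.
- apply: borcherdsP => //; first exact: phi_trunc.
  by move=> m k w; rewrite borcherds_lhsC C.
Qed.

Lemma borcherds_at_linearl x u u' v :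
  borcherds_at u v -> borcherds_at u' v -> borcherds_at (x *: u + u') v.
Proof.
move=> /borcherds_atP[C I] /borcherds_atP[C' I']; apply/borcherds_atP; split.
  move=> m k w.
  have -> : Z (x *: u + u') v = fun n => x *: Z u v n + Z u' v n.
    by apply/funext => n; rewrite /Z (va_linearl VA) linearP.
  rewrite borcherds_rhs_linear; [|exact: phi_trunc|exact: phi_trunc].
  rewrite -C -C' (linearP phi) !fmodeD !fmodeZ (fmode_linear (phi v)).
  by rewrite scalerBr opprD addrACA.
move=> n; rewrite (va_linearl VA) !linearP /=.
by rewrite I I' nprod_linearl.
Qed.

Lemma borcherds_at_linearr x u v v' :
  borcherds_at u v -> borcherds_at u v' -> borcherds_at u (x *: v + v').
Proof.
move=> /borcherds_atP[C I] /borcherds_atP[C' I']; apply/borcherds_atP; split.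
  move=> m k w.
  have -> : Z u (x *: v + v') = fun n => x *: Z u v n + Z u v' n.
    by apply/funext => n; rewrite /Z (va_linearr VA) linearP.
  rewrite borcherds_rhs_linear; [|exact: phi_trunc|exact: phi_trunc].
  rewrite -C -C' (linearP phi) !fmodeD !fmodeZ (fmode_linear (phi u)).
  by rewrite scalerBr opprD addrACA.
move=> n; rewrite (va_linearr VA) !linearP /=.
by rewrite I I'.
Qed.

Lemma borcherds_at0l v : borcherds_at 0 v.
Proof.
apply/borcherds_atP; split=> [m k w|n]; last first.
  by rewrite Y0l linear0; have := nprod_linearl n (phi v) (-1) 0 0;
    rewrite scaler0 addr0 scaleN1r addNr.
rewrite linear0 !fmode0 linear0 subr0 (@borcherds_rhsE _ _ 0) ?big_ord0 //.
by move=> i _; rewrite /Z Y0l linear0.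
Qed.

Lemma borcherds_at_vac v : borcherds_at vac v.
Proof.
rewrite /borcherds_at phi_vac (_ : Z vac v = fun n => if n == -1 then phi v else 0).
  exact: borcherds_id_field.
by apply/funext => n; rewrite /Z (va_vacuum VA); case: eqP; rewrite ?linear0.
Qed.

(** The field of y_s v is a sum of products of modes of y and v, on which the bracket with a mode of
    u acts as a derivation. Where it meets y, the terms form the left hand side of the identity for
    u_r y and v with a nonzero first index, so the full identity is required there; where it meets
    v, they form the product of y with u_r v. In V the vector u_a (y_s v) splits in the same way. *)
Lemma comm_at_step u y v s :
  comm_at u y -> comm_at u v -> iter_at y v ->
  (forall r : nat, iter_at y (Y u r%:Z v)) ->
  (forall r : nat, borcherds_at (Y u r%:Z y) v) -> comm_at u (Y y s v).
Proof.
move=> Cuy Cuv Iyv Iyuv Juyv m k w.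
have [R1 uyR] := va_bound u y 0; have [R2 uvR] := va_bound u v 0.
pose R := (R1 + R2)%N.
have scaleC (x x' : K) (w' : W) : x *: (x' *: w') = x' *: (x *: w').
  by rewrite !scalerA mulrC.
have {}uyR (r : nat) : (R <= r)%N -> Y u r y = 0.
  by move=> h; rewrite -[r%:Z]add0r uyR //; lia.
have {}uvR (r : nat) : (R <= r)%N -> Y u r v = 0.
  by move=> h; rewrite -[r%:Z]add0r uvR //; lia.
have commR z p q w' : (forall r : nat, (R <= r)%N -> Y u r z = 0) -> comm_at u z ->
    phi u p (phi z q w') - phi z q (phi u p w')
    = \sum_(r < R) binz p r *: phi (Y u r z) (p + q - r%:Z) w'.
  move=> zR ->; rewrite (@borcherds_rhsE _ _ R) => [|i h]; last first.
    by rewrite /Z add0r zR // linear0.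
  by apply: eq_bigr => r _; rewrite /Z add0r.
have [N1 vN1] := fmode_bound (phi v) w k.
have [N2 vN2] := fmode_bound (phi v) (phi u m w) k.
have [N3 yN3] := fmode_bound (phi y) w 0.
have [N4 yN4] := fmode_bound (phi y) (phi u m w) 0.
have [N5 tN5] := @fmode_bound_seq _ _ R (fun r : nat => phi (Y u r y))
  (fun _ => w) (fun r => m - r%:Z).
have [N6 xN6] := @fmode_bound_seq _ _ R (fun r : nat => phi (Y u r v))
  (fun _ => w) (fun r => m + k - r%:Z).
pose N := (N1 + N2 + N3 + N4 + N5 + N6)%N.
have prodE z w' q : (forall i : nat, (N <= i)%N -> phi z (q + i%:Z) w' = 0) ->
    (forall i : nat, (N <= i)%N -> phi y i%:Z w' = 0) ->
    nprod (phi y) s (phi z) q w' = \sum_(i < N) ((-1) ^+ i * binz s i) *: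
      (phi y (s - i%:Z) (phi z (q + i%:Z) w')
       - (-1) ^ s *: phi z (s + q - i%:Z) (phi y i%:Z w')).
  move=> h1 h2; rewrite /nprod fmodeB fmodeZ (fplusE _ _ h1) (fminusE _ _ _ h2).
  rewrite scaler_sumr -sumrB; apply: eq_bigr => i _.
  by rewrite scalerBr !scalerA [_ ^ s * _]mulrC.
have yN (i : nat) : (N <= i)%N -> phi y i%:Z w = 0.
  by move=> h; rewrite -[i%:Z]add0r yN3 //; lia.
rewrite Iyv (prodE v w) //; last by move=> i h; apply: vN1; lia.
rewrite (prodE v (phi u m w)); last 2 first.
- by move=> i h; apply: vN2; lia.
- by move=> i h; rewrite -[i%:Z]add0r yN4 //; lia.
rewrite linear_sum -sumrB /=.
transitivity (\sum_(i < N) \sum_(r < R) binz m r *: (((-1) ^+ i * binz s i) *: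
   ((phi (Y u r y) (m - r%:Z + s - i%:Z) (phi v (k + i%:Z) w)
     - (-1) ^ s *: phi v (s + k - i%:Z) (phi (Y u r y) (m - r%:Z + i%:Z) w))
    + (phi y (s - i%:Z) (phi (Y u r v) (m + k - r%:Z + i%:Z) w)
     - (-1) ^ s *: phi (Y u r v) (s + (m + k - r%:Z) - i%:Z) (phi y i%:Z w))))).
  apply: eq_bigr => i _.
  rewrite fmodeZr -scalerBr fmodeBr fmodeZr.
  set A := phi u m _; set B := phi u m _; set C := phi y _ _; set D := phi v _ _.
  have -> : A - (-1) ^ s *: B - (C - (-1) ^ s *: D) = A - C - (-1) ^ s *: (B - D).
    by rewrite scalerBr !opprB [LHS]addrACA [RHS]addrACA [- C - _]addrC.
  have -> : A - C = \sum_(r < R) binz m r *: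
      (phi (Y u r y) (m - r%:Z + s - i%:Z) (phi v (k + i%:Z) w)
       + phi y (s - i%:Z) (phi (Y u r v) (m + k - r%:Z + i%:Z) w)).
    rewrite -[A](subrK (phi y (s - i%:Z) (phi u m (phi v (k + i%:Z) w)))) -addrA.
    rewrite -fmodeBr (commR _ _ _ _ uyR Cuy) (commR _ _ _ _ uvR Cuv) linear_sum.
    rewrite -big_split; apply: eq_bigr => r _ /=; rewrite fmodeZr scalerDr.
    congr (_ *: phi _ _ _ + _ *: phi _ _ (phi _ _ _)); lia.
  have -> : B - D = \sum_(r < R) binz m r *:
      (phi (Y u r v) (s + (m + k - r%:Z) - i%:Z) (phi y i%:Z w)
       + phi v (s + k - i%:Z) (phi (Y u r y) (m - r%:Z + i%:Z) w)).
    rewrite -[B](subrK (phi v (s + k - i%:Z) (phi u m (phi y i%:Z w)))) -addrA.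
    rewrite -fmodeBr (commR _ _ _ _ uvR Cuv) (commR _ _ _ _ uyR Cuy) linear_sum.
    rewrite -big_split; apply: eq_bigr => r _ /=; rewrite fmodeZr scalerDr.
    congr (_ *: phi _ _ _ + _ *: phi _ _ (phi _ _ _)); lia.
  rewrite scaler_sumr -sumrB scaler_sumr; apply: eq_bigr => r _.
  rewrite (scaleC ((-1) ^ s)) -scalerBr scaleC; congr (_ *: (_ *: _)).
  by rewrite scalerDr opprD [X in _ + X = _]addrC addrACA.
rewrite exchange_big /=.
(* Summed over i, each r leaves one Borcherds expression for (u_r y, v), at m - r in place of m, and
   one product of index s for (y, u_r v). *)
transitivity (\sum_(r < R) binz m r *:
  (borcherds_lhs (phi (Y u r y)) (phi v) (m - r%:Z) s k w
   + nprod (phi y) s (phi (Y u r v)) (m + k - r%:Z) w)).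
  apply: eq_bigr => r _; rewrite -scaler_sumr; congr (_ *: _).
  under eq_bigr => i _ do rewrite scalerDr.
  rewrite big_split -prodE //; last first.
    by move=> i h; apply: (xN6 r); [exact: ltn_ord|lia].
  congr (_ + _); rewrite -jacobi_lhsE (@fsum_nat _ N) // => i h.
  rewrite (tN5 r) ?ltn_ord //; last by lia.
  rewrite (vN1 i); last by lia.
  by rewrite !linear0 ?addr0 ?scaler0 ?addr0.
have [M1 yvM] := @fmode_bound_seq _ _ R (fun r : nat => va_field (Y u r y))
  (fun _ => v) (fun _ => s).
pose M := (M1 + R + R)%N.
have uyM (r i : nat) : (M <= r + i)%N -> Y (Y u r y) (s + i%:Z) v = 0.
  case: (ltnP r R) => [rR h|/uyR -> _]; last exact: Y0l.
  by apply: (yvM r); rewrite ?ltn_ord //; lia.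
(* The commutator formula in V for a nonnegative mode a: the binomial coefficient stops the sum at r
   = a. *)
have VC (a : nat) : Y u a (Y y s v) = Y y s (Y u a v)
    + \sum_(r < a.+1) 'C(a, r)%:R *: Y (Y u r y) (s + (a - r)%N%:Z) v.
  have := va_field_borcherds u y a 0 s v; rewrite borcherds_lhsC => /eqP.
  rewrite subr_eq addrC => /eqP; rewrite -[LHS]/(Y u a (Y y s v)) => ->.
  congr (_ + _); rewrite (@borcherds_rhsE _ _ R); last first.
    move=> i h; apply: vfieldP => j z; rewrite -[LHS]/(Y (Y u (0 + i%:Z) y) j z).
    by rewrite add0r uyR // Y0l.
  pose G (r : nat) := binz a r *: Y (Y u r y) (a%:Z + s - r%:Z) v.
  transitivity (\sum_(r < R) G r).
    by apply: eq_bigr => r _; rewrite /G -[in RHS](add0r r%:Z).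
  rewrite (@sum_ord_widen _ _ (R + a.+1) G) ?leq_addr // => [|i h]; last first.
    by rewrite /G uyR // Y0l scaler0.
  rewrite -(@sum_ord_widen _ a.+1 (R + a.+1) G) ?leq_addl // => [|i h]; last first.
    by rewrite /G binz_nat bin_small ?scale0r.
  apply: eq_bigr => r _; rewrite /G binz_nat; congr (_ *: Y _ _ _).
  by have := ltn_ord r; lia.
rewrite (@borcherds_rhsE _ _ M); last first.
  move=> i h; rewrite /Z add0r VC uvR; last by lia.
  rewrite Y0r add0r big1 ?linear0 // => r _.
  by rewrite uyM ?scaler0 // subnKC // -ltnS.
(* By [binz_trinomial] this is also binom(m, r) binom(m - r, j), the coefficient from the identity
   for (u_r y, v). Summing over diagonals a = r + j recovers the expansion of u_a (y_s v). *)
pose F (r j : nat) := (binz m (r + j)%N * 'C(r + j, r)%:R) *: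
  phi (Y (Y u r y) (s + j%:Z) v) (m + k - (r + j)%N%:Z) w.
transitivity (\sum_(r < M) (binz m r *: phi (Y y s (Y u r v)) (m + k - r%:Z) w)
   + \sum_(r < M) \sum_(j < M) F r j).
  pose G1 (r : nat) := binz m r *: phi (Y y s (Y u r v)) (m + k - r%:Z) w.
  pose G2 (r : nat) := \sum_(j < M) F r j.
  rewrite -(@sum_ord_widen _ R M G1); [|by lia|]; last first.
    by move=> i h; rewrite /G1 uvR // Y0r linear0 scaler0.
  rewrite -(@sum_ord_widen _ R M G2); [|by lia|]; last first.
    by move=> i h; rewrite /G2 big1 // => j _; rewrite /F uyR // Y0l linear0 scaler0.
  rewrite -big_split; apply: eq_bigr => r _; rewrite scalerDr addrC -Iyuv.
  congr (_ + _); rewrite (Juyv r (m - r%:Z) s k w) (@borcherds_rhsE _ _ M); last first.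
    by move=> i h; rewrite /Z uyM ?linear0 // (leq_trans h) ?leq_addl.
  rewrite scaler_sumr; apply: eq_bigr => j _; rewrite /F scalerA binz_trinomial.
  by congr (_ *: phi _ _ _); lia.
rewrite sum_diag; last first.
  by move=> i j h; rewrite /F uyM // linear0 scaler0.
rewrite -big_split; apply: eq_bigr => a _ /=; rewrite /Z add0r VC linearD fmodeD scalerDr.
congr (_ + _); rewrite linear_sum fmode_sum scaler_sumr; apply: eq_bigr => r _.
rewrite /F linearZ /= scalerA subnKC //; last by rewrite -ltnS.
Qed.

Section Generators.
Variable G : set V.
Hypothesis G_ind : forall P : V -> Prop, P vac ->
  (forall x u v, P u -> P v -> P (x *: u + v)) ->
  (forall g n v, G g -> P v -> P (Y g n v)) -> forall v, P v.
Hypothesis G_iter : forall g v, G g -> iter_at g v.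
Hypothesis G_comm : forall g h, G g -> G h -> comm_at g h.
Hypothesis G_prod : forall g h (r : nat), G g -> G h ->
  lspan (vac |` G) (Y g r%:Z h).

(** At h_n v the preceding step asks for the identity of g_r h and v. By [G_prod] the vector g_r h
    is a combination of the vacuum and generators, so the induction hypothesis for v, stated for all
    generators, covers it. *)
Lemma borcherds_at_gen v g : G g -> borcherds_at g v.
Proof.
elim/G_ind: v g => [|x u v IHu IHv|h n v Gh IHv] g Gg.
- apply/borcherds_atP; split; last exact: G_iter.
  move=> m k w; rewrite phi_vac !id_fieldE (@borcherds_rhsE _ _ 0) ?big_ord0.
    by case: eqP => _; rewrite ?subrr // linear0 subr0.
  by move=> i _; rewrite /Z add0r (va_creation0 VA) // linear0.
- by apply: borcherds_at_linearr; [exact: IHu|exact: IHv].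
- apply/borcherds_atP; split; last exact: G_iter.
  apply: comm_at_step; [exact: G_comm| |exact: G_iter|by move=> r; apply: G_iter|].
    by have /borcherds_atP[] := IHv g Gg.
  move=> r; elim: (G_prod r Gg Gh) => [u [->|/IHv//]||x u u' _ Hu _ Hu'].
  + exact: borcherds_at_vac.
  + exact: borcherds_at0l.
  + exact: borcherds_at_linearl.
Qed.

Lemma va_field_iter u v n k w : Y (Y u n v) k w
  = nprod (va_field u) n (va_field v) k w.
Proof. by rewrite -borcherds_lhs0 va_field_borcherds borcherds_rhs0. Qed.

Lemma va_field_iter_vac N u v n k :
    (forall i : nat, (N <= i)%N -> Y v (k + i%:Z) vac = 0) ->
  Y (Y u n v) k vac = \sum_(i < N) ((-1) ^+ i * binz n i) *:
    Y u (n - i%:Z) (Y v (k + i%:Z) vac).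
Proof.
move=> vN; rewrite va_field_iter /nprod fmodeB fmodeZ (@fminusE _ _ 0) => [|i _].
  by rewrite big_ord0 scaler0 subr0 (@fplusE _ _ N (va_field u) n (va_field v) k vac vN).
exact: (va_creation0 VA).
Qed.

(** [Y u (-2) vac] is the translate T u, and this is Leibniz' rule for T. In the iterate formula on
    the vacuum only the terms i = 0 and i = 1 survive, by creation. *)
Lemma vacuum_mode g s u :
  Y (Y g s u) (-2) vac = Y g s (Y u (-2) vac) - s%:~R *: Y g (s - 1) u.
Proof.
rewrite (@va_field_iter_vac 2) => [|i h]; last by apply: (va_creation0 VA); lia.
rewrite big_ord_recr big_ord1 /= binz0 binz1 mulr1 scale1r subr0 addr0 expr1.
by rewrite mulN1r scaleNr (va_creation VA).
Qed.

(** T in V and the derivative of fields obey the same rule on products with a generator, by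
    [vacuum_mode] and [nprod_deriv], and both vanish on the vacuum. *)
Lemma phi_translation u k w :
  phi (Y u (-2) vac) k w = - (k%:~R *: phi u (k - 1) w).
Proof.
elim/G_ind: u k w => [|x u v IHu IHv|g s u Gg IHu] k w.
- rewrite (va_vacuum VA) linear0 phi_vac id_fieldE; case: eqP => [e|_].
    by rewrite (_ : k = 0) ?scale0r ?oppr0 //; lia.
  by rewrite scaler0 oppr0.
- rewrite (va_linearl VA) !phiD !phiZ !fmodeD !fmodeZ IHu IHv.
  by rewrite scalerDr opprD scalerN !scalerA mulrC.
rewrite vacuum_mode phiB phiZ fmodeB fmodeZ.
rewrite (@G_iter g (Y u (-2) vac) Gg s) (@G_iter g u Gg (s - 1)) (@G_iter g u Gg s).
exact: nprod_deriv.
Qed.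

(** In the iterate formula for u_(-2) 1 only i = j survives, since the vacuum acts through its mode
    -1 alone; the coefficient is (-1)^j binom(-2, j) = j + 1. *)
Lemma va_translation_mode u j : Y (Y u (-2) vac) (-1 - j%:Z) vac
  = j.+1%:R *: Y u (-1 - j.+1%:Z) vac.
Proof.
have vac0 (i : nat) : i != j -> Y vac (-1 - j%:Z + i%:Z) vac = 0.
  by move=> ij; rewrite (va_vacuum VA) ifN //; lia.
rewrite (@va_field_iter_vac j.+1) => [|i h]; last by apply: vac0; lia.
rewrite big_ord_recr big1 => [|i _] /=; last first.
  by rewrite vac0 ?Y0r ?scaler0 //; have := ltn_ord i; lia.
rewrite add0r subrK (va_vacuum VA) eqxx binzN.
rewrite (_ : j%:Z - -2 - 1 = j.+1); last by lia.
rewrite binz_nat -[X in 'C(X, j)]addn1 -bin_sub ?leq_addr // addKn bin1 addn1.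
rewrite mulrA -exprMn mulrNN mulr1 expr1n mul1r; congr (_ *: Y _ _ _); lia.
Qed.

(** The vector on the left is T^j u / j!, and the right hand side gives the modes of the j-th
    divided derivative. The induction passes from u to T u, so u is general in it. *)
Lemma phi_creation u j k w : phi (Y u (-1 - j%:Z) vac) k w
  = ((-1) ^+ j * binz k j) *: phi u (k - j%:Z) w.
Proof.
elim: j u => [|j IH] u.
  by rewrite subr0 (va_creation VA) binz0 mulr1 scale1r subr0.
have h1 : j.+1%:R != 0 :> K by rewrite pnatr_eq0.
apply: (scalerI h1); rewrite -fmodeZ -phiZ -va_translation_mode IH phi_translation.
rewrite scalerN !scalerA -scaleNr; congr (_ *: phi _ _ _); last by lia.
by rewrite [RHS]mulrCA binzS exprS; ring.
Qed.

(** Skew-symmetry Y(v, x) u = exp(xT) Y(u, -x) v, with T^i / i! written as a mode on the vacuum. By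
    creation v_n u is the mode -1 of its own field on the vacuum; exchanging u and v makes this -1
    the first index, whence the coefficients binom(-1, i) = (-1)^i. *)
Lemma va_skew u v n N : (forall i : nat, (N <= i)%N -> Y u (n + i%:Z) v = 0) ->
  Y v n u = - (-1) ^ n *:
    \sum_(i < N) (-1) ^+ i *: Y (Y u (n + i%:Z) v) (-1 - i%:Z) vac.
Proof.
move=> uvN; rewrite -[LHS](va_creation VA).
transitivity (borcherds_rhs (fun i => va_field (Y v i u)) 0 n (-1) vac).
  by rewrite borcherds_rhs0.
rewrite -va_field_borcherds borcherds_lhs_sym va_field_borcherds.
rewrite (@borcherds_rhsE _ _ N) => [|i h]; last first.
  by apply: vfieldP => p z; rewrite -[LHS]/(Y (Y u (n + i%:Z) v) p z) uvN ?Y0l.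
congr (_ *: _); apply: eq_bigr => i _; rewrite binzN1 addr0.
by [].
Qed.

(** On the left the exchange costs only a sign. On the right [va_skew] expresses v_(n+r) u through
    the vectors u_(n+r+j) v, [phi_creation] turns the powers of T into coefficients, and [binz_skew]
    sums these for fixed r + j. *)
Lemma borcherds_at_sym u v : borcherds_at u v -> borcherds_at v u.
Proof.
move=> Juv m n k w.
have [N1 uvN] := va_bound u v n; have [N2 vuN] := va_bound v u n.
pose N := (N1 + N2)%N.
have {}uvN (i : nat) : (N <= i)%N -> Y u (n + i%:Z) v = 0 by move=> h; apply: uvN; lia.
rewrite borcherds_lhs_sym (Juv k n m w) (@borcherds_rhsE _ _ N) => [|i h]; last first.
  by rewrite /Z uvN ?linear0.
rewrite (@borcherds_rhsE _ _ N) => [|i h]; last by rewrite /Z vuN ?linear0 //; lia.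
pose F (r j : nat) := (- (-1) ^ n * ((-1) ^+ r * binz m r * binz (m + k - r%:Z) j)) *:
  phi (Y u (n + (r + j)%N%:Z) v) (m + k - (r + j)%N%:Z) w.
transitivity (\sum_(r < N) \sum_(j < N) F r j); last first.
  apply: eq_bigr => r _; rewrite /Z (@va_skew u v _ N) => [|i h]; last first.
    by rewrite -addrA -PoszD uvN // (leq_trans h) ?leq_addl.
  rewrite phiZ linear_sum fmodeZ fmode_sum !scaler_sumr; apply: eq_bigr => j _.
  rewrite phiZ fmodeZ phi_creation !scalerA /F; congr (_ *: phi (Y _ _ _) _ _); [|lia|lia].
  have e : (-1) ^+ j * (-1) ^+ j = 1 :> K by rewrite -exprMn mulrNN mulr1 expr1n.
  have -> : (-1) ^ (n + r%:Z) = (-1) ^ n * (-1) ^+ r :> K.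
    by rewrite expfzDr ?oppr_eq0 ?oner_eq0.
  by rewrite -[LHS]mul1r -{1}e; ring.
rewrite sum_diag => [|i j h]; last by rewrite /F uvN // linear0 scaler0.
rewrite scaler_sumr; apply: eq_bigr => s _; rewrite /Z [k + m]addrC -(binz_skew K m).
rewrite scalerA mulr_sumr scaler_suml; apply: eq_bigr => r _.
by rewrite /F subnKC // -ltnS.
Qed.

Theorem borcherds_at_all u v : borcherds_at u v.
Proof.
elim/G_ind: v u => [|x v v' IHv IHv'|g s v Gg IHv] u.
- exact/borcherds_at_sym/borcherds_at_vac.
- by apply: borcherds_at_linearr; [exact: IHv|exact: IHv'].
have Jug : borcherds_at u g by apply/borcherds_at_sym/borcherds_at_gen.
apply/borcherds_atP; split.
  apply: comm_at_step.
  - by have /borcherds_atP[] := Jug.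
  - by have /borcherds_atP[] := IHv u.
  - exact: G_iter.
  - by move=> r; apply: G_iter.
  - by move=> r; apply: IHv.
move=> n; rewrite (@G_iter g v Gg s).
have [R ugR] := va_bound u g 0.
have {}ugR (i : nat) : (R <= i)%N -> Y u (0 + i%:Z) g = 0 by exact: ugR.
have iter_v z : iter_at z v by have /borcherds_atP[] := IHv z.
have commR m k w : phi u m (phi g k w) - phi g k (phi u m w)
    = \sum_(r < R) binz m r *: phi (Y u r%:Z g) (m + k - r%:Z) w.
  have /borcherds_atP[-> _] := Jug; rewrite (@borcherds_rhsE _ _ R) => [|i h].
    by apply: eq_bigr => r _; rewrite /Z add0r.
  by rewrite /Z ugR // linear0.
(* For the iterate, u_n is moved past g_s twice, among the operators on fields and in V. The
   corrections are products of u_r g with v in both cases, and the iterate formula for v is known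
   with any first vector. *)
have := @nprod_comm _ _ (phi u) (phi g) R (fun r => phi (Y u r%:Z g)) commR n s (phi v).
move=> /eqP; rewrite subr_eq => /eqP ->; rewrite -(iter_v u) -(@G_iter g (Y u n v) Gg s) addrC.
have := va_field_borcherds u g n 0 s v; rewrite borcherds_lhsC => /eqP.
rewrite subr_eq => /eqP; rewrite -[LHS]/(Y u n (Y g s v)) => ->; rewrite phiD.
rewrite [RHS]addrC; congr (_ + _); rewrite (@borcherds_rhsE _ _ R) => [|i h].
  rewrite linear_sum; apply: eq_bigr => r _; rewrite phiZ -iter_v add0r.
  by [].
by apply: vfieldP => p z; rewrite -[LHS]/(Y (Y u (0 + i%:Z) g) p z) ugR ?Y0l.
Qed.

Theorem va_module_of_generators : va_module Y vac (fun u => phi u).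
Proof.
split.
- by move=> n w x u v; rewrite phiD phiZ fmodeD fmodeZ.
- by move=> u n; apply: fmode_linear.
- by move=> u w; apply: fmode_trunc.
- by move=> n w; rewrite phi_vac.
- by move=> u v w m n k; rewrite jacobi_lhsE; apply: borcherds_at_all.
Qed.

End Generators.
End Extension.

(** * Enveloping algebras and induced modules *)

Lemma malgZU (K : fieldType) (X : choiceType) (c : K) (k : X) :
  << c *g k >> = c *: << k >> :> {malg K[X]}.
Proof. by apply/malgP => i; rewrite mcoeffZ !mcoeffU mulrnAr mulr1. Qed.

Lemma alg_linl (K : fieldType) (A : algType K) c (u v w : A) :
  (c *: u + v) * w = c *: (u * w) + v * w.
Proof. by rewrite mulrDl scalerAl. Qed.

Lemma alg_linr (K : fieldType) (A : algType K) c (u v w : A) :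
  u * (c *: v + w) = c *: (u * v) + u * w.
Proof. by rewrite mulrDr scalerAr. Qed.

Section FreeAlgebraAction.
Variables (K : fieldType) (X : choiceType).
Local Notation FA := (free_alg K X).

Definition fword (s : seq X) : FA := << FMonom s >>.

Lemma fwordM s t : fword s * fword t = fword (s ++ t).
Proof.
rewrite /fword [LHS](@malgMEw _ _ [fset FMonom s]%fset [fset FMonom t]%fset) ?msuppU_le //.
rewrite !big_seq_fset1 !mcoeffUU mulr1; congr << _ >>.
by apply/val_inj; apply: fmM.
Qed.

Lemma fword0 : fword [::] = 1.
Proof. by rewrite /fword -fmoneE. Qed.

Lemma fword_cons x s : fword (x :: s) = fgen K x * fword s.
Proof. by rewrite -cat1s -fwordM /fword -fmuE. Qed.

Lemma free_alg_span (P : FA -> Prop) : P 0 ->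
  (forall c u v, P u -> P v -> P (c *: u + v)) ->
  (forall s, P (fword s)) -> forall u, P u.
Proof.
move=> P0 Plin Pw u; rewrite (@monalgE (fmonom X) K u).
elim/big_ind: _ => [|v w Pv Pw'|[s] _]; first exact: P0.
  by have := Plin 1 _ _ Pv Pw'; rewrite scale1r.
have := Plin u@_(FMonom s) (fword s) 0 (Pw s) P0; rewrite addr0 => h.
exact: (eq_ind _ P h _ (esym (malgZU _ _))).
Qed.

Variables (Z : lmodType K) (rho : X -> Z -> Z).
Hypothesis rho_linear : forall x, linear (rho x).

Definition free_act (f : FA) (z : Z) : Z :=
  lin_ext (fun m : fmonom X => foldr rho z (m : seq X)) f.

Lemma free_act_linearl z : linear (free_act^~ z).
Proof. exact: lin_ext_linear. Qed.

Lemma free_actD c f h z :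
  free_act (c *: f + h) z = c *: free_act f z + free_act h z.
Proof. exact: free_act_linearl. Qed.

Lemma free_actB f h z : free_act (f - h) z = free_act f z - free_act h z.
Proof. exact: linB (free_act_linearl z) _ _. Qed.

Lemma free_act_word s z : free_act (fword s) z = foldr rho z s.
Proof. by rewrite /free_act lin_extU. Qed.

Lemma free_act_linearr f : linear (free_act f).
Proof.
move=> c z z'; have fl := free_act_linearl.
elim/free_alg_span: f => [|a f h IHf IHh|s].
- by rewrite !(lin0 (fl _)) scaler0 addr0.
- by rewrite !free_actD IHf IHh !scalerDr !scalerA [a * c]mulrC addrACA.
- rewrite !free_act_word; elim: s => [|x s IH] //=.
  by rewrite IH rho_linear.
Qed.

Lemma free_actM f h z : free_act (f * h) z = free_act f (free_act h z).
Proof.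
have fl := free_act_linearl.
elim/free_alg_span: f => [|a f f' IHf IHf'|s].
- by rewrite mul0r !(lin0 (fl _)).
- rewrite (alg_linl a f f' h) (free_actD a (f * h)) (free_actD a f).
  exact: (congr2 (fun x y => a *: x + y) IHf IHf').
elim/free_alg_span: h => [|a h h' IHh IHh'|t].
- by rewrite mulr0 !(lin0 (fl _)) (lin0 (free_act_linearr _)).
- rewrite (alg_linr a (fword s) h h') (free_actD a (fword s * h)) (free_actD a h).
  rewrite free_act_linearr.
  exact: (congr2 (fun x y => a *: x + y) IHh IHh').
- by rewrite fwordM !free_act_word foldr_cat.
Qed.

Lemma free_act1 z : free_act 1 z = z.
Proof. by rewrite -fword0 free_act_word. Qed.

Lemma free_act_gen x z : free_act (fgen K x) z = rho x z.
Proof.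
by rewrite -[fgen K x]mulr1 -fword0 -fword_cons free_act_word.
Qed.

End FreeAlgebraAction.

Section EnvelopingAction.
Variables (K : fieldType) (L : lieAlgType K).

(* Stated for all envelopes since [uenv_pack] has to be unlocked. *)
Let envelope_ind (E : envelope L) := forall P : env_alg E -> Prop, P 1 ->
  (forall c u v, P u -> P v -> P (c *: u + v)) ->
  (forall x u, P u -> P (env_inc E x * u)) -> forall u, P u.

Lemma uenv_ind (P : uenv L -> Prop) : P 1 ->
  (forall c u v, P u -> P v -> P (c *: u + v)) ->
  (forall x u, P u -> P (uinc x * u)) -> forall u, P u.
Proof.
suff H : envelope_ind (uenv_pack L) by exact: H.
rewrite /uenv_pack -lock => {}P P1 Plin Pgen u; rewrite -[u]areprK.
have P0 : P 0 by have := Plin (-1) 1 1 P1 P1; rewrite scaleN1r addNr.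
elim/free_alg_span: (arepr u) => [|c f h IHf IHh|s].
- by rewrite (lin0 (@aproj_linear _ _ _ _)).
- by rewrite aproj_linear; apply: Plin.
- elim: s => [|x s IH]; first by rewrite fword0.
  by rewrite fword_cons aprojM; apply: Pgen.
Qed.

Variables (Z : lmodType K) (rho : L -> Z -> Z).
Hypothesis rhoM : lie_module rho.

Let envelope_act (E : envelope L) := exists A : env_alg E -> Z -> Z,
  [/\ forall z, linear (A^~ z), forall z, A 1 z = z
    & forall x u z, A (env_inc E x * u) z = rho x (A u z)].

(** Universal property of the enveloping algebra: the free algebra acts through words, the defining
    relations act as 0, hence so does the ideal they generate. *)
Lemma uenv_act : exists A : uenv L -> Z -> Z,
  [/\ forall z, linear (A^~ z), forall z, A 1 z = z
    & forall x u z, A (uinc x * u) z = rho x (A u z)].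
Proof.
suff H : envelope_act (uenv_pack L) by exact: H.
rewrite /uenv_pack -lock /envelope_act.
have [rl rr rb] := rhoM.
have fl := free_act_linearl rho; have fr := free_act_linearr rl.
have rel0 f : uenv_rel (@fgen K L) f -> forall z, free_act rho f z = 0.
  have gen := free_act_gen rho.
  case=> [x y|c x|x y] z; rewrite free_actB.
  - by rewrite free_actB !gen (linD (rr z)) addrAC addrK subrr.
  - by rewrite (linZ (fl z)) !gen (linZ (rr z)) subrr.
  - have genM x' y' : free_act rho (fgen K x' * fgen K y') z = rho x' (rho y' z).
      by apply: etrans (free_actM rl _ _ _) _; rewrite !gen.
    rewrite free_actB gen rb; apply/eqP; rewrite subr_eq0; apply/eqP.
    exact: (congr2 (fun u v => u - v)).
have id0 f : lspan (ideal_gens (uenv_rel (@fgen K L))) f ->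
    forall z, free_act rho f z = 0.
  elim=> {f} [_ [a [r [b [hr ->]]]]||c f h _ IHf _ IHh] z.
  - by rewrite (free_actM rl (a * r)) (free_actM rl a) (rel0 _ hr) (lin0 (fr a)).
  - by rewrite (lin0 (fl z)).
  - by rewrite free_actD IHf IHh scaler0 addr0.
pose A (u : aquot (@uenv_proper K L)) z := free_act rho (arepr u) z.
have AE f z : A (aproj _ f) z = free_act rho f z.
  apply/eqP; rewrite -subr_eq0 -free_actB; apply/eqP/id0.
  by apply/(aproj_eq (@uenv_proper K L)); exact: areprK.
exists A; split.
- move=> z c u v; rewrite -[u]areprK -[v]areprK -aproj_linear !AE.
  exact: fl.
- by move=> z; rewrite -[1]/(aproj (@uenv_proper K L) 1) AE free_act1.
- move=> x u z; rewrite -[u]areprK -[env_inc _ x]/(aproj (@uenv_proper K L) (fgen K x)).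
  rewrite -aprojM !AE.
  by rewrite (free_actM rl (fgen K x)) free_act_gen.
Qed.

End EnvelopingAction.

(** * Representations of affine Lie algebras and their induced modules *)

Section AffineModules.
Variables (K : fieldType) (g : quadLieAlgType K).
Local Notation A := (affine g).

Lemma affine_ind_alg (P : A -> Prop) : P 0 ->
  (forall c x y, P x -> P y -> P (c *: x + y)) ->
  (forall h n, P (amode h n)) -> P (acentral g) -> forall x, P x.
Proof.
move=> P0 Plin Pm Pc [f c].
have -> : (f, c) = (c : K) *: (acentral g : A) + (f, 0) :> A.
  by congr (_, _); rewrite /= ?scaler0 ?add0r // [c *: _]mulr1 addr0.
apply: (Plin) => //; elim/loop_ind: f => [|f f' IH IH'|h n]; [exact: P0| |exact: Pm].
have -> : (f + f', 0) = 1 *: (f, 0) + (f', 0) :> A.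
  by rewrite scale1r; congr (_, _); rewrite /= addr0.
exact: (Plin).
Qed.

Lemma lie_amode h k m n : lie (amode h m) (amode k n)
  = amode (lie h k) (m + n)
    + ((m%:~R * Defs.form h k) *+ (m + n == 0)) *: acentral g :> A.
Proof.
rewrite [LHS]affine_BU; congr (_, _); first by rewrite /= scaler0 addr0.
by rewrite /= add0r [RHS]mulr1.
Qed.

Lemma lie_acentral x : lie (acentral g) x = 0 :> A.
Proof. exact: (affine_B0l x.1). Qed.

Lemma lie_acentralr x : lie x (acentral g) = 0 :> A.
Proof. exact: (affine_B0r x.1). Qed.

Lemma amode_linear n : linear (fun h : g => amode h n).
Proof.
move=> c h k; congr (_, _); first exact: loopU_linear.
by rewrite /= scaler0 addr0.
Qed.

Section Construction.
Variables (Z : lmodType K) (F : g -> int -> Z -> Z) (l : K).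
Hypothesis F_linearl : forall n z, linear (fun h => F h n z).
Hypothesis F_linearr : forall h n, linear (F h n).
Hypothesis F_comm : forall h k m n z,
  F h m (F k n z) - F k n (F h m z)
  = F (lie h k) (m + n) z + ((m%:~R * Defs.form h k) *+ (m + n == 0) * l) *: z.

Definition affine_rep (x : A) (z : Z) : Z :=
  loop_ext (fun n h => F h n z) x.1 + (x.2 * l) *: z.

Lemma affine_rep_amode h n z : affine_rep (amode h n) z = F h n z.
Proof.
by rewrite /affine_rep /= loop_extU ?mul0r ?scale0r ?addr0 // => i; apply: F_linearl.
Qed.

Lemma affine_rep_acentral z : affine_rep (acentral g) z = l *: z.
Proof.
by rewrite /affine_rep /= (lin0 (loop_ext_linear _)) ?add0r ?mul1r.
Qed.

Lemma affine_rep_linearl z : linear (affine_rep^~ z).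
Proof.
move=> c x y; rewrite /affine_rep /= loop_ext_linear; last first.
  by move=> i; apply: F_linearl.
by rewrite mulrDl scalerDl -[c *: x.2 in LHS]/(c * x.2) -mulrA -scalerA addrACA -scalerDr.
Qed.

Lemma affine_rep_linearr x : linear (affine_rep x).
Proof.
move=> c z z'; have al := affine_rep_linearl.
elim/affine_ind_alg: x => [|a x y IHx IHy|h n|].
- by rewrite !(lin0 (al _)) scaler0 addr0.
- by rewrite !al IHx IHy !scalerDr !scalerA [a * c]mulrC addrACA.
- by rewrite !affine_rep_amode F_linearr.
- by rewrite !affine_rep_acentral scalerDr !scalerA mulrC.
Qed.

Lemma affine_rep_lie_module : lie_module affine_rep.
Proof.
split; [exact: affine_rep_linearr|exact: affine_rep_linearl|].
have al := affine_rep_linearl; have ar := affine_rep_linearr.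
move=> x y z.
elim/affine_ind_alg: x => [|a x x' IH IH'|h m|].
- by rewrite (lin0 (lie_linearl y)) !(lin0 (al _)) (lin0 (ar _)) subrr.
- rewrite lie_linearl !al IH IH' ar.
  by rewrite scalerBr [in RHS]opprD addrACA.
- elim/affine_ind_alg: y => [|a y y' IH IH'|k n|].
  + by rewrite (lin0 (lie_linearr _)) !(lin0 (al _)) (lin0 (ar _)) subrr.
  + rewrite lie_linearr !al IH IH' ar.
    by rewrite scalerBr [in RHS]opprD addrACA.
  + rewrite lie_amode (linD (al z)) (linZ (al z)) !affine_rep_amode.
    by rewrite affine_rep_acentral F_comm scalerA.
  + by rewrite lie_acentralr (lin0 (al z)) !affine_rep_acentral (linZ (ar _)) subrr.
- by rewrite lie_acentral (lin0 (al z)) !affine_rep_acentral (linZ (ar _)) subrr.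
Qed.

End Construction.

Section Induced.
Variables (lam : g -> K) (l : K).
Hypothesis lam0 : lam 0 = 0.
Local Notation V := (affine_ind lam l).
Local Notation vac := (affine_vac lam l).

Definition affine_pure (u : uenv A) (z : K^o) : V := ind_pure _ _ u z.

Lemma affine_mode_pure h n u z :
  affine_mode h n (affine_pure u z) = affine_pure (uinc (amode h n) * u) z.
Proof. exact: ind_actE. Qed.

Lemma affine_pure_ind (P : V -> Prop) : P 0 ->
  (forall v w, P v -> P w -> P (v + w)) -> (forall u z, P (affine_pure u z)) ->
  forall v, P v.
Proof. exact: btens_ind. Qed.

Lemma affine_mode_linear h n : linear (@affine_mode K g lam l h n).
Proof. exact: ind_act_linear. Qed.

Lemma affine_mode_linearl n (v : V) : linear (fun h => affine_mode h n v).
Proof.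
move=> c h k; rewrite /affine_mode amode_linear.
by have [_ -> _] := ind_act_module (@affine_nonneg K g)
  (fun (x : affine g) (z : K^o) => (lam x.1@_0 + x.2 * l) *: z).
Qed.

Lemma ind_act_vac x : affine_nonneg x ->
  ind_act x vac = (lam x.1@_0 + x.2 * l) *: vac.
Proof.
move=> hx; rewrite /affine_vac ind_actE mulr1.
have := btens_pure_bal (@ind_right K A (@affine_nonneg K g))
  (fun (x : {x : A | affine_nonneg x}) (z : K^o) =>
     (lam (sval x).1@_0 + (sval x).2 * l) *: z) (exist _ x hx) 1 1.
rewrite /ind_right mul1r => e; apply: etrans e _.
exact: (linZ (btens_pure_linearr _ _ 1)).
Qed.

Lemma uinc_acentral (u : uenv A) : uinc (acentral g) * u = u * uinc (acentral g).
Proof.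
elim/uenv_ind: u => [|c u v IHu IHv|x u IH]; first by rewrite mulr1 mul1r.
  by rewrite alg_linr IHu IHv alg_linl.
have := uinc_lie (acentral g) x; rewrite lie_acentral (lin0 (@uinc_linear K A)).
by move=> /esym/eqP; rewrite subr_eq0 => /eqP e; rewrite mulrA e -mulrA IH mulrA.
Qed.

(** The central element commutes with u in the enveloping algebra, crosses the tensor sign and acts
    on the scalar factor; its loop component is 0, so [lam0] leaves just l. *)
Lemma ind_act_acentral (v : V) : ind_act (acentral g) v = l *: v.
Proof.
have al := @ind_act_linear K A (@affine_nonneg K g)
  _ (fun (x : A) (z : K^o) => (lam x.1@_0 + x.2 * l) *: z) (acentral g).
have nonneg : affine_nonneg (acentral g) by move=> n _; rewrite mcoeff0.
elim/btens_ind: v => [|v w IHv IHw|u z]; first by rewrite (lin0 al) scaler0.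
  by rewrite (linD al) IHv IHw scalerDr.
rewrite [LHS]ind_actE uinc_acentral.
have := btens_pure_bal (@ind_right K A (@affine_nonneg K g))
  (fun (x : {x : A | affine_nonneg x}) (z : K^o) =>
     (lam (sval x).1@_0 + (sval x).2 * l) *: z) (exist _ _ nonneg) u z.
rewrite /ind_right /= mcoeff0 lam0 add0r mul1r => e; apply: etrans e _.
exact: (linZ (btens_pure_linearr _ _ u)).
Qed.

Lemma affine_ind_ind (P : V -> Prop) : P vac ->
  (forall c u v, P u -> P v -> P (c *: u + v)) ->
  (forall h n v, P v -> P (affine_mode h n v)) -> forall v, P v.
Proof.
move=> Pv Plin Pm.
have P0 : P 0 by have := Plin (-1) vac vac Pv Pv; rewrite scaleN1r addNr.
have PD u v : P u -> P v -> P (u + v).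
  by move=> Pu Pw; have := Plin 1 _ _ Pu Pw; rewrite scale1r.
have PZ c v : P v -> P (c *: v).
  by move=> Pw; have := Plin c _ _ Pw P0; rewrite addr0.
have [_ actl _] := ind_act_module (@affine_nonneg K g)
  (fun (x : A) (z : K^o) => (lam x.1@_0 + x.2 * l) *: z).
have Pact x v : P v -> P (ind_act x v).
  move=> Pw; elim/affine_ind_alg: x => [|c x y Px Py|h n|].
  - by rewrite (lin0 (actl v)).
  - by rewrite actl; apply: (Plin).
  - exact: Pm.
  - by rewrite ind_act_acentral; apply: PZ.
pose S (x : A) (z : K^o) := (lam x.1@_0 + x.2 * l) *: z.
have Pu u : P (ind_pure (@affine_nonneg K g) S u (1 : K^o)).
  elim/uenv_ind: u => [|c u v Pu Pw|x u Pu]; first exact: Pv.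
    have := Plin c _ _ Pu Pw; congr P.
    exact: (esym (btens_pure_linearl _ _ _ _ _ _)).
  by rewrite -ind_actE; apply: Pact.
apply: btens_ind; [exact: P0|exact: PD|move=> u z].
have := PZ z _ (Pu u); congr P.
rewrite -[LHS](linZ (btens_pure_linearr _ _ u)); congr (btens_pure _ _ _ _).
exact: mulr1.
Qed.

Lemma affine_mode_comm h k m n (v : V) :
  affine_mode h m (affine_mode k n v) - affine_mode k n (affine_mode h m v)
  = affine_mode (lie h k) (m + n) v
    + ((m%:~R * Defs.form h k) *+ (m + n == 0) * l) *: v.
Proof.
have [_ actl actb] := ind_act_module (@affine_nonneg K g)
  (fun (x : A) (z : K^o) => (lam x.1@_0 + x.2 * l) *: z).
apply: etrans (esym (actb (amode h m) (amode k n) v)) _; rewrite lie_amode.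
apply: etrans (linD (actl v) _ _) _; congr (_ + _).
by apply: etrans (linZ (actl v) _ _) _; rewrite ind_act_acentral scalerA.
Qed.

Lemma affine_mode_vac h (n : nat) :
  affine_mode h n%:Z vac = if n == 0%N then lam h *: vac else 0.
Proof.
rewrite /affine_mode ind_act_vac => [|i i0]; last first.
  by rewrite /= mcoeffU (_ : (n%:Z == i) = false) ?mulr0n //; lia.
rewrite /= mul0r addr0 mcoeffU; case: n => [|n] //=.
by rewrite mulr0n lam0 scale0r.
Qed.

(** Moving h(n) past k(m) leaves a mode of [h, k] on v, so the induction is for all h at once. The
    bound 1 - m keeps n + m positive and excludes the central term. *)
Lemma affine_mode_trunc h (v : V) :
  exists N : int, forall n, N <= n -> affine_mode h n v = 0.
Proof.
elim/affine_ind_ind: v h => [|c u v IHu IHv|k m v IH] h.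
- by exists 1 => -[[|n]|n] // _; rewrite affine_mode_vac.
- have [N uN] := IHu h; have [M vM] := IHv h; exists (Order.max N M) => n.
  rewrite ge_max => /andP[/uN e1 /vM e2].
  by rewrite affine_mode_linear e1 e2 scaler0 addr0.
- have [N1 h1] := IH h; have [N2 h2] := IH (lie h k).
  exists (Order.max N1 (Order.max (N2 - m) (1 - m))) => n.
  rewrite !ge_max => /andP[/h1 e1 /andP[e2 e3]].
  have vanish (x y z : V) (c : K) : x - y = z + c *: v -> y = 0 -> z = 0 -> c = 0 -> x = 0.
    by move=> e y0 z0 c0; move: e; rewrite y0 z0 c0 subr0 scale0r addr0.
  apply: vanish (affine_mode_comm h k n m v) _ _ _.
  - exact: etrans (congr1 _ e1) (lin0 (affine_mode_linear k m)).
  - by apply: h2; lia.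
  - by rewrite (_ : (n + m == 0) = false) ?mulr0n ?mul0r //; lia.
Qed.

End Induced.

Section Lift.
Variables (Z : lmodType K) (F : g -> int -> Z -> Z) (l : K) (z0 : Z).
Hypothesis F_linearl : forall n z, linear (fun h => F h n z).
Hypothesis F_linearr : forall h n, linear (F h n).
Hypothesis F_comm : forall h k m n z,
  F h m (F k n z) - F k n (F h m z)
  = F (lie h k) (m + n) z + ((m%:~R * Defs.form h k) *+ (m + n == 0) * l) *: z.
Hypothesis F_vac : forall h (n : nat), F h n z0 = 0.
Local Notation V := (affine_ind (fun _ : g => 0) l).

(** Frobenius reciprocity: the nonnegative part of the affine algebra acts on z0 by the same scalars
    as on the inducing one-dimensional module, so that u ⊗ n |-> n (u z0) is balanced. *)
Lemma affine_ind_lift : exists phi : V -> Z,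
  [/\ linear phi, phi (affine_vac _ l) = z0
    & forall h n v, phi (affine_mode h n v) = F h n (phi v)].
Proof.
have rhoM := affine_rep_lie_module F_linearl F_linearr F_comm.
have rhoV x : affine_nonneg x -> affine_rep F l x z0 = (x.2 * l) *: z0.
  move=> hx; rewrite /affine_rep /loop_ext big1 ?add0r // => n _.
  case: n => n; first exact: F_vac.
  by rewrite hx // (lin0 (F_linearl _ _)).
have [act [actl act1 actM]] := uenv_act rhoM.
have actr u : linear (act u).
  elim/uenv_ind: u => [|c u v IHu IHv|x u IH] d y z.
  - by rewrite !act1.
  - by rewrite !actl IHu IHv !scalerDr !scalerA [c * d]mulrC addrACA.
  - by rewrite !actM IH affine_rep_linearr.
have actMM u v z : act (u * v) z = act u (act v z).
  elim/uenv_ind: u => [|c u u' IHu IHv|x u IH].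
  - by rewrite mul1r act1.
  - by rewrite alg_linl !actl IHu IHv.
  - by rewrite -mulrA !actM IH.
have act_inc x z : act (uinc x) z = affine_rep F l x z.
  by rewrite -[uinc x]mulr1 actM act1.
pose G (u : uenv A) (n : K^o) : Z := (n : K) *: act u z0.
have Gl n : linear (G^~ n).
  by move=> c u v; rewrite /G actl scalerDr !scalerA [n * c]mulrC.
have Gr u : linear (G u).
  by move=> c n m; rewrite /G scalerDl scalerA.
have Gb (b : {x : A | affine_nonneg x}) u n :
    G (ind_right u b) n = G u ((0 + (sval b).2 * l) *: n).
  case: b => x hx; rewrite /G /ind_right /= actMM act_inc rhoV // add0r.
  rewrite (linZ (actr u)) scalerA; congr (_ *: _).
  exact: mulrC.
pose phi : V -> Z := btens_lift G.
have phil : linear phi := btens_lift_linear Gl Gr Gb.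
have phi_pure u z : phi (affine_pure (fun _ => 0) l u z) = G u z.
  exact: (btens_liftE Gl Gr Gb).
have phi_vac : phi (affine_vac _ l) = z0.
  by apply: etrans (phi_pure 1 1) _; rewrite /G act1 scale1r.
exists phi; split=> //; move: phi phil phi_pure {phi_vac} => phi phil phi_pure h n v.
elim/affine_pure_ind: v => [|v w IHv IHw|u z].
- by rewrite (lin0 (affine_mode_linear _ _)) !(lin0 phil) (lin0 (F_linearr _ _)).
- rewrite (linD (affine_mode_linear _ _)) !(linD phil) (linD (F_linearr _ _)).
  exact: (congr2 +%R IHv IHw).
- rewrite affine_mode_pure !phi_pure.
  by rewrite /G actM affine_rep_amode // (linZ (F_linearr h n)).
Qed.

End Lift.

End AffineModules.

(** * Restricted modules of an affine Lie algebra as vertex algebra modules *)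

Section RestrictedModules.
Variables (K : numFieldType) (g : quadLieAlgType K) (l : K).
Local Notation V := (affine_ind (fun _ : g => 0) l).
Local Notation vac := (affine_vac (fun _ : g => 0) l).
Local Notation gen h := (affine_mode h (-1) vac).
Variable Y : V -> int -> V -> V.
Hypothesis VA : vertex_algebra Y vac.
Hypothesis Y_gen : forall h n v, Y (gen h) n v = affine_mode h n v.

Variables (W : lmodType K) (F : g -> int -> W -> W).
Hypothesis F_linearl : forall n w, linear (fun h => F h n w).
Hypothesis F_linearr : forall h n, linear (F h n).
Hypothesis F_comm : forall h k m n w,
  F h m (F k n w) - F k n (F h m w)
  = F (lie h k) (m + n) w + ((m%:~R * Defs.form h k) *+ (m + n == 0) * l) *: w.
Hypothesis F_trunc : forall h w, exists N : int, forall n, N <= n -> F h n w = 0.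

Fact gen_field_subproof h : F h \in @is_field _ W.
Proof. by apply/asboolP; split. Qed.
Definition gen_field h : vfield W := VField (gen_field_subproof h).

Lemma gen_field_linear : linear gen_field.
Proof. by move=> c h k; apply: vfieldP => n w; apply: F_linearl. Qed.

(** Since h(r) kills the vacuum, only its commutator with k(-1) remains. This shows the generators
    closed under nonnegative products, up to multiples of the vacuum. *)
Lemma affine_mode_gen h k (r : nat) : affine_mode h r%:Z (gen k) =
  if r == 0%N then gen (lie h k) else if r == 1%N then (Defs.form h k * l) *: vac
  else 0.
Proof.
have lam0 : (fun _ : g => 0) 0 = 0 :> K by [].
have vac0 h' (n : nat) : affine_mode h' n%:Z vac = 0.
  by rewrite (@affine_mode_vac _ _ _ l lam0); case: eqP; rewrite ?scale0r.
have sub0 (x y z : V) : x - y = z -> y = 0 -> x = z by move=> <- ->; rewrite subr0.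
apply: etrans (sub0 _ _ _ (@affine_mode_comm _ _ _ l lam0 h k r%:Z (-1) vac) _) _.
  exact: etrans (congr1 _ (vac0 h r)) (lin0 (affine_mode_linear k (-1))).
case: r => [|[|r]].
- by rewrite (_ : (0%:Z + -1 == 0) = false) // mulr0n mul0r scale0r addr0.
- by rewrite (_ : 1%:Z + -1 = 0%N) // eqxx mulr1n mul1r vac0 add0r.
- rewrite (_ : (r.+2%:Z + -1 == 0) = false) ?mulr0n ?mul0r ?scale0r ?addr0; last by lia.
  by rewrite (_ : r.+2%:Z + -1 = r.+1) ?vac0 //; lia.
Qed.

Let t h k (r : nat) : vfield W :=
  if r == 0%N then gen_field (lie h k)
  else if r == 1%N then (Defs.form h k * l) *: id_field W else 0.

Lemma gen_field_comm h k m n w :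
  gen_field h m (gen_field k n w) - gen_field k n (gen_field h m w)
  = \sum_(r < 2) binz K m r *: t h k r (m + n - r%:Z) w.
Proof.
rewrite big_ord_recr big_ord1 binz0 scale1r subr0 [LHS]F_comm; congr (_ + _).
rewrite -[RHS]/(binz K m 1 *: ((Defs.form h k * l) *: id_field W) (m + n - 1) w).
rewrite binz1 fmodeZ id_fieldE (_ : (m + n - 1 == -1) = (m + n == 0)); last by lia.
case: eqP => _; last by rewrite mulr0n mul0r !scaler0 scale0r.
by rewrite mulr1n scalerA mulrA.
Qed.

(** The second commutator field is a multiple of the identity, whose product with c is nonzero only
    at index -1. For the index m + n - 1 this means m + n = 0, which is precisely the central term
    of level l. *)
Lemma gen_field_nprod_comm h k m n c :
  nprod (gen_field h) m (nprod (gen_field k) n c)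
    - nprod (gen_field k) n (nprod (gen_field h) m c)
  = nprod (gen_field (lie h k)) (m + n) c
    + ((m%:~R * Defs.form h k) *+ (m + n == 0) * l) *: c.
Proof.
rewrite (nprod_comm (gen_field_comm h k)) big_ord_recr big_ord1 /=.
rewrite binz0 scale1r subr0; congr (_ + _).
rewrite binz1 (linZ (nprod_linearl _ _)) nprod_idl.
rewrite (_ : (m + n - 1 == -1) = (m + n == 0)); last by lia.
case: eqP => _; last by rewrite mulr0n mul0r !scaler0 scale0r.
by rewrite mulr1n scalerA mulrA.
Qed.

Theorem restricted_va_module : exists YW : V -> int -> W -> W,
  va_module Y vac YW /\ forall h n w, YW (gen h) n w = F h n w.
Proof.
have [phi [phil phi_vac phiM]] := @affine_ind_lift K g (vfield W)
  (fun h n c => nprod (gen_field h) n c) l (id_field W)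
  (fun n c => (fun a h k => etrans (congr1 (fun f => nprod f n c) (gen_field_linear a h k))
      (nprod_linearl n c a (gen_field h) (gen_field k))))
  (fun h n => nprod_linearr (gen_field h) n)
  gen_field_nprod_comm (fun h n => nprod_idr n (gen_field h)).
(* The vector h(-1) 1 goes to the product of index -1 with the identity field, which returns the
   field of h. *)
have phi_gen h : phi (gen h) = gen_field h by rewrite phiM phi_vac nprodN1_idr.
pose phiL : {linear V -> vfield W} :=
  HB.pack phi (GRing.isLinear.Build K V (vfield W) *:%R phi phil).
pose G : set V := [set v | exists h, v = gen h].
exists (fun v => fmode (phi v)); split; last by move=> h n w; rewrite phi_gen.
apply: (@va_module_of_generators _ _ _ _ _ VA phiL phi_vac G).
- move=> P Pvac Plin PG; apply: affine_ind_ind => // h n v Pv.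
  by have := PG _ n v (ex_intro _ h erefl) Pv; rewrite Y_gen.
- move=> _ v [h ->] n; apply: etrans (congr1 phi (Y_gen h n v)) _.
  apply: etrans (phiM h n v) _.
  exact: (congr1 (fun c => nprod c n (phi v)) (esym (phi_gen h))).
- move=> _ _ [h ->] [k ->] m n w.
  apply: etrans (congr2 (fun U V' : vfield W => U m (V' n w) - V' n (U m w))
    (phi_gen h) (phi_gen k)) _.
  have ZE (r : nat) : phi (Y (gen h) (0 + r%:Z) (gen k)) = t h k r.
    apply: etrans (congr1 phi
      (etrans (Y_gen h (0 + r%:Z) (gen k)) (affine_mode_gen h k r))) _.
    rewrite /t; case: ifP => _; first exact: phi_gen.
    case: ifP => _; last exact: (lin0 phil).
    by rewrite (linZ phil) phi_vac.
  rewrite gen_field_comm (@borcherds_rhsE _ _ 2) => [|i i2].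
    by apply: eq_bigr => r _;
      apply: (congr1 (fun c : vfield W => binz K m r *: c (m + n - r%:Z) w) (esym (ZE r))).
  by apply: etrans (ZE i) _; rewrite /t; case: i i2 => [|[|i]].
- move=> _ _ r [h ->] [k ->]; rewrite Y_gen affine_mode_gen.
  case: ifP => _; first by apply: lspan_gen; right; exists (lie h k).
  case: ifP => _; last exact: lspan_zero.
  rewrite -[_ *: vac]addr0; apply: lspan_lin; last exact: lspan_zero.
  by apply: lspan_gen; left.
Qed.

End RestrictedModules.

(** * The beta-gamma system *)

Section FiniteSums.
Variables (K : fieldType) (I : choiceType).

(** A sum over all indices is 0 by convention if its support is infinite, so linearity of such sums
    always requires this condition. *)
Definition finite_supp (W : nmodType) (F : I -> W) :=
  exists s : seq I, forall i, i \notin s -> F i = 0.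

Lemma fsumE (W : nmodType) (s : seq I) (F : I -> W) : uniq s ->
  (forall i, i \notin s -> F i = 0) -> \sum_(i \in [set: I]) F i = \sum_(i <- s) F i.
Proof.
move=> us F0; rewrite (@fsbigE _ _ _ _ _ s) // => [|i _]; last exact: F0.
by apply: eq_bigl => i; apply/asboolP.
Qed.

Lemma finite_supp2 (W W' : nmodType) (F : I -> W) (G : I -> W') :
  finite_supp F -> finite_supp G ->
  exists s : seq I, [/\ uniq s, forall i, i \notin s -> F i = 0
    & forall i, i \notin s -> G i = 0].
Proof.
move=> [s sF] [t tG]; exists (undup (s ++ t)); rewrite undup_uniq.
by split=> // i; rewrite mem_undup mem_cat negb_or => /andP[/sF + /tG].
Qed.

Lemma fsum_lin (V W : lmodType K) (f : V -> W) (F : I -> V) : linear f -> finite_supp F ->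
  f (\sum_(i \in [set: I]) F i) = \sum_(i \in [set: I]) f (F i).
Proof.
move=> fl sF; have [s [us F0 _]] := finite_supp2 sF sF.
rewrite (fsumE us F0) (fsumE us) ?(lin_sum fl) // => i /F0 ->.
exact: (lin0 fl).
Qed.

Lemma fsum_linear (V : lmodType K) c (F G : I -> V) : finite_supp F -> finite_supp G ->
  \sum_(i \in [set: I]) (c *: F i + G i)
  = c *: (\sum_(i \in [set: I]) F i) + \sum_(i \in [set: I]) G i.
Proof.
move=> sF sG; have [s [us F0 G0]] := finite_supp2 sF sG.
rewrite (fsumE us F0) (fsumE us G0) (fsumE us) => [|i h].
  by rewrite scaler_sumr -big_split.
by rewrite F0 // G0 // scaler0 addr0.
Qed.

Lemma fsum_sub (V : lmodType K) (F G : I -> V) : finite_supp F -> finite_supp G ->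
  \sum_(i \in [set: I]) F i - \sum_(i \in [set: I]) G i
  = \sum_(i \in [set: I]) (F i - G i).
Proof.
move=> sF sG; rewrite addrC -scaleN1r -fsum_linear //.
by apply: eq_fsbigr => i _; rewrite scaleN1r addrC.
Qed.

Lemma fsum_delta (W : nmodType) (k : I) (F : I -> W) : (forall i, i != k -> F i = 0) ->
  \sum_(i \in [set: I]) F i = F k.
Proof.
move=> F0; rewrite (@fsumE _ [:: k]) ?big_seq1 // => i.
by rewrite inE => /F0.
Qed.

End FiniteSums.

Lemma finite_supp_int (W : nmodType) (F : int -> W) (N : int) :
  (forall i, N <= i -> F i = 0) -> (forall i, i <= - N -> F i = 0) -> finite_supp F.
Proof.
move=> h1 h2; exists [seq i%:Z - `|N|%N%:Z | i <- iota 0 (`|N| + `|N|)%N] => i /mapP h.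
case: (lerP N i) => [/h1//|iN]; case: (lerP i (- N)) => [/h2//|Ni].
case: h; exists (absz (i + `|N|%N%:Z)%R); last by lia.
by rewrite mem_iota; lia.
Qed.

Section Weyl.
Variables (K : fieldType) (V : lmodType K) (beta gamma : int -> V -> V) (vac : V).
Hypothesis VW : weyl_vacuum_module beta gamma vac.
Let VM := weylv_module VW.
Let bl n : linear (beta n) := weyl_linear_beta VM n.
Let gl n : linear (gamma n) := weyl_linear_gamma VM n.

(** The vectors with this property form a submodule containing [vac]: a mode n beyond -m commutes
    with [beta m] and [gamma m]. *)
Lemma weyl_trunc v : exists N : int, forall n, N <= n -> beta n v = 0 /\ gamma n v = 0.
Proof.
have comm := weyl_beta_gamma VM.
pose P v := exists N : int, forall n, N <= n -> beta n v = 0 /\ gamma n v = 0.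
apply: (weylv_generated VW (P := P)); last first.
  exists 1 => n n1; split; first by apply: (weylv_beta VW); lia.
  by apply: (weylv_gamma VW); lia.
split=> //.
- by exists 0 => n _; rewrite (lin0 (bl n)) (lin0 (gl n)).
- move=> c u w [N uN] [M wM]; exists (Order.max N M) => n.
  rewrite ge_max => /andP[/uN[e1 e2] /wM[e3 e4]].
  by rewrite bl gl e1 e2 e3 e4 scaler0 addr0.
- move=> m u [N uN]; exists (Order.max N (1 - m)) => n.
  rewrite ge_max => /andP[/uN[e1 e2] nm]; split.
    by rewrite (weyl_beta_beta VM) e1 (lin0 (bl m)).
  have /eqP := comm m n u; rewrite e2 (lin0 (bl m)) sub0r ifN; last by lia.
  by rewrite oppr_eq0 => /eqP.
- move=> m u [N uN]; exists (Order.max N (1 - m)) => n.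
  rewrite ge_max => /andP[/uN[e1 e2] nm]; split; last first.
    by rewrite (weyl_gamma_gamma VM) e2 (lin0 (gl m)).
  have := comm n m u; rewrite e1 (lin0 (gl m)) subr0 ifN //; lia.
Qed.

(** The order of the factors is a parameter separate from the modes, since in [nord_nord] the modes
    are shifted while the cut between the two orders moves. *)
Definition nord_term (b : bool) m n v :=
  if b then beta m (gamma n v) else gamma n (beta m v).

Lemma nord_term_linear b m n : linear (nord_term b m n).
Proof. by case: b => c u v; rewrite /nord_term ?(bl, gl). Qed.

Lemma nord_term_finite_supp (k m n : int) v :
  finite_supp (fun i => nord_term (i < k) (m + i) (n - i) v).
Proof.
have [N vN] := weyl_trunc v.
apply: (@finite_supp_int _ _ (`|N| + `|k| + `|m| + `|n| + 1)) => i h; rewrite /nord_term.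
  rewrite (_ : (i < k) = false); last by lia.
  by have [-> _] : beta (m + i) v = 0 /\ gamma (m + i) v = 0; [apply: vN; lia|exact: lin0].
rewrite (_ : (i < k) = true); last by lia.
by have [_ ->] : beta (n - i) v = 0 /\ gamma (n - i) v = 0; [apply: vN; lia|exact: lin0].
Qed.

Local Notation nord := (nord_mode beta gamma).

Lemma nord_modeE n v :
  nord n v = \sum_(i \in [set: int]) nord_term (i < 0) i (n - i) v.
Proof. by []. Qed.

Lemma nord_finite_supp n v : finite_supp (fun i => nord_term (i < 0) i (n - i) v).
Proof.
have [s h] := nord_term_finite_supp 0 0 n v; exists s => i /h.
by rewrite add0r.
Qed.

Lemma nord_linear n : linear (nord n).
Proof.
move=> c u v; rewrite !nord_modeE -fsum_linear; try exact: nord_finite_supp.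
by apply: eq_fsbigr => i _; rewrite nord_term_linear.
Qed.

(** For i < 0 the mode n - i of gamma is large, and for i >= N the mode i of beta kills v. In
    between are finitely many vectors [beta i v], on each of which gamma truncates. *)
Lemma nord_mode_trunc v : exists N : int, forall n, N <= n -> nord n v = 0.
Proof.
have [N vN] := weyl_trunc v.
have [M0 hM] : exists M0 : int, forall (i : nat) n, (i < `|N|)%N -> M0 <= n ->
    gamma (n - i%:Z) (beta i%:Z v) = 0.
  elim: `|N|%N => [|k [M0 hM]]; first by exists 0.
  have [M1 hM1] := weyl_trunc (beta k%:Z v).
  exists (Order.max M0 (M1 + k%:Z)) => i n; rewrite ltnS leq_eqVlt ge_max.
  move=> /orP[/eqP ->|ik] /andP[h1 h2]; last exact: hM.
  by have [] := hM1 (n - k%:Z); first by lia.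
exists (Order.max M0 N) => n; rewrite ge_max => /andP[h1 h2].
rewrite nord_modeE; apply: fsbig1 => i _; rewrite /nord_term.
case: ltrP => i0.
  have [_ ->] : beta (n - i) v = 0 /\ gamma (n - i) v = 0 by apply: vN; lia.
  exact: lin0.
case: (lerP N i) => [/vN[-> _]|iN]; first exact: lin0.
by rewrite (_ : i = (absz i)%:Z) ?hM //; lia.
Qed.

Lemma nord_comm (X : V -> V) n v : linear X ->
  X (nord n v) - nord n (X v) = \sum_(i \in [set: int])
    (X (nord_term (i < 0) i (n - i) v) - nord_term (i < 0) i (n - i) (X v)).
Proof.
move=> Xl; rewrite !nord_modeE (fsum_lin Xl); last exact: nord_finite_supp.
rewrite fsum_sub //; last exact: nord_finite_supp.
by have [s h] := nord_finite_supp n v; exists s => i /h ->; exact: lin0.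
Qed.

(** Whatever the order of the factors, beta(n) pairs only with gamma(m - i), so that i = m + n alone
    contributes. *)
Lemma beta_nord m n v : beta n (nord m v) - nord m (beta n v) = beta (m + n) v.
Proof.
rewrite nord_comm // (@fsum_delta _ _ (m + n)) => [|i im]; rewrite /nord_term.
  have comm := weyl_beta_gamma VM n (- n).
  rewrite (_ : m - (m + n) = - n); last by lia.
  case: ifP => _; last by rewrite (weyl_beta_beta VM) comm subrr.
  by rewrite (weyl_beta_beta VM) -(linB (bl _)) comm subrr.
have comm := weyl_beta_gamma VM n (m - i).
case: ifP => _.
  by rewrite (weyl_beta_beta VM) -(linB (bl _)) comm ifN ?(lin0 (bl _)) //; lia.
by rewrite (weyl_beta_beta VM) comm ifN //; lia.
Qed.

Lemma gamma_nord m n v : gamma n (nord m v) - nord m (gamma n v) = - gamma (m + n) v.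
Proof.
have comm u k : gamma n (beta k u) - beta k (gamma n u) = if k + n == 0 then - u else 0.
  by rewrite -opprB (weyl_beta_gamma VM); case: eqP; rewrite ?oppr0.
rewrite nord_comm // (@fsum_delta _ _ (- n)) => [|i im]; rewrite /nord_term.
  rewrite opprK; case: ifP => _.
    by rewrite (weyl_gamma_gamma VM) comm addNr eqxx.
  by rewrite (weyl_gamma_gamma VM) -(linB (gl _)) comm addNr eqxx (linN (gl _)).
case: ifP => _.
  by rewrite (weyl_gamma_gamma VM) comm ifN //; lia.
by rewrite (weyl_gamma_gamma VM) -(linB (gl _)) comm ifN ?(lin0 (gl _)) //; lia.
Qed.

(* Shifting the summation index of one of the two halves of the commutator moves
   the cut of the normal ordering from 0 to m; the |m| reordered terms give the
   central term. *)
Lemma nord_nord m n v : nord m (nord n v) - nord n (nord m v)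
  = - ((m%:~R *+ (m + n == 0)) *: v).
Proof.
rewrite nord_comm; last exact: nord_linear.
have bN k u : nord m (beta k u) = beta k (nord m u) - beta (m + k) u.
  by rewrite -(beta_nord m k u) opprB addrC subrK.
have gN k u : nord m (gamma k u) = gamma k (nord m u) + gamma (m + k) u.
  by rewrite -[gamma (m + k) u]opprK -(gamma_nord m k u) opprB addrC subrK.
have cancel1 (x y z : V) : x + y - z - x = y - z.
  by rewrite addrAC [x + y]addrC addrK.
have cancel2 (x y z : V) : x - y + z - x = z - y.
  by rewrite addrAC [x - y]addrC addrK addrC.
transitivity (\sum_(i \in [set: int]) (nord_term (i < 0) i (m + n - i) v
    - nord_term (i < 0) (m + i) (n - i) v)).
  apply: eq_fsbigr => i _; rewrite /nord_term; case: ifP => _.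
    by rewrite bN gN (linD (bl _)) [m + (n - i)]addrA cancel1.
  by rewrite gN bN (linB (gl _)) [m + (n - i)]addrA cancel2.
rewrite -fsum_sub; [|exact: nord_finite_supp|exact: nord_term_finite_supp].
rewrite [X in _ - X](@reindex_fsbigT _ _ _ _ _ (fun i => i - m)); last first.
  by exists (fun i => i + m) => i; rewrite ?addrK ?subrK.
have shift i : nord_term (i - m < 0) (m + (i - m)) (n - (i - m)) v
    = nord_term (i < m) (0 + i) (m + n - i) v.
  congr nord_term; lia.
under [X in _ - X]eq_fsbigr => i _ do rewrite shift.
rewrite fsum_sub; [|exact: nord_finite_supp|exact: nord_term_finite_supp].
pose x := (1 *+ (m + n == 0)) *: v.
have comm i : beta i (gamma (m + n - i) v) - gamma (m + n - i) (beta i v) = x.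
  rewrite (weyl_beta_gamma VM) /x (_ : i + (m + n - i) = m + n); last by lia.
  by case: eqP; rewrite ?scale1r ?scale0r.
have termE i : nord_term (i < 0) i (m + n - i) v - nord_term (i < m) (0 + i) (m + n - i) v
    = if (m <= i < 0) then x else if (0 <= i < m) then - x else 0.
  rewrite /nord_term add0r; case: (ltrP i 0); case: (ltrP i m) => h1 h2.
  - by rewrite subrr.
  - by rewrite comm.
  - by rewrite -opprB comm.
  - by rewrite subrr.
under eq_fsbigr => i _ do rewrite termE.
have -> : (m%:~R *+ (m + n == 0)) *: v = m%:~R *: x.
  by rewrite /x scalerA mulr_natr.
move: x {comm termE} => x; move: m {bN gN shift} => [] m.
  rewrite (@fsumE _ _ [seq i%:Z | i <- iota 0 m]).
  - rewrite big_map big_seq (eq_bigr (fun _ => - x)) => [|i].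
      rewrite -big_seq sumrN big_const_seq count_predT size_iota.
      by rewrite iter_addr_0 scaler_nat.
    by rewrite mem_iota => /andP[_ im]; rewrite andbF /=; rewrite ifT //; lia.
  - by rewrite map_inj_uniq ?iota_uniq // => i j [].
  - move=> i /mapP h; case: ifP => h1; first by exfalso; lia.
    by case: ifP => // h2; case: h; exists (absz i); rewrite ?mem_iota; lia.
rewrite (@fsumE _ _ [seq Negz i | i <- iota 0 m.+1]).
- rewrite big_map big_seq (eq_bigr (fun _ => x)) => [|i].
    rewrite -big_seq big_const_seq count_predT size_iota.
    by rewrite iter_addr_0 NegzE mulrNz scaleNr opprK scaler_nat.
  by rewrite mem_iota => /andP[_ im]; rewrite ifT //; lia.
- by rewrite map_inj_uniq ?iota_uniq // => i j [].
- move=> i /mapP h; case: ifP => h1.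
    by case: h; exists (absz i).-1; rewrite ?mem_iota; lia.
  by case: ifP => // h2; exfalso; lia.
Qed.

End Weyl.

(** * The realization of the affine Nappi-Witten algebra *)

Section LinearOperators.
Variables (K : fieldType) (V W : lmodType K).

Lemma linear_comb (c : K) (f h : V -> W) :
  linear f -> linear h -> linear (fun v => c *: f v + h v).
Proof.
move=> fl hl d u v; rewrite fl hl !scalerDr !scalerA [c * d]mulrC.
by rewrite addrACA.
Qed.

Lemma linear_opp (f : V -> W) : linear f -> linear (fun v => - f v).
Proof. by move=> fl d u v; rewrite fl opprD scalerN. Qed.

Lemma linear_fsum (I : choiceType) (F : I -> V -> W) : (forall i, linear (F i)) ->
  (forall v, finite_supp (F^~ v)) -> linear (fun v => \sum_(i \in [set: I]) F i v).
Proof.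
move=> Fl Fs c u v; rewrite -fsum_linear //.
by apply: eq_fsbigr => i _; rewrite Fl.
Qed.

End LinearOperators.

Section Bracket.
Variables (K : fieldType) (V : lmodType K).
Implicit Types (f h : V -> V).

Definition op_br f h v := f (h v) - h (f v).

Lemma op_brC f h v : op_br f h v = - op_br h f v.
Proof. by rewrite /op_br opprB. Qed.

Lemma op_br_combr c f h1 h2 v : linear f ->
  op_br f (fun u => c *: h1 u + h2 u) v = c *: op_br f h1 v + op_br f h2 v.
Proof. by move=> fl; rewrite /op_br fl scalerBr opprD addrACA. Qed.

Lemma op_br_combl c f1 f2 h v : linear h ->
  op_br (fun u => c *: f1 u + f2 u) h v = c *: op_br f1 h v + op_br f2 h v.
Proof. by move=> hl; rewrite op_brC op_br_combr // opprD -scalerN -!op_brC. Qed.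

Lemma op_br_fsumr (I : choiceType) f (H : I -> V -> V) v : linear f ->
  (forall v, finite_supp (H^~ v)) ->
  op_br f (fun v => \sum_(i \in [set: I]) H i v) v = \sum_(i \in [set: I]) op_br f (H i) v.
Proof.
move=> fl Hs; rewrite /op_br (fsum_lin fl) ?fsum_sub //.
by have [s h] := Hs v; exists s => i /h ->; apply: lin0.
Qed.

Lemma op_br_comp f h1 h2 v : linear h1 ->
  op_br f (fun v => h1 (h2 v)) v = op_br f h1 (h2 v) + h1 (op_br f h2 v).
Proof. by move=> hl; rewrite /op_br (linB hl) addrA subrK. Qed.

End Bracket.

(* B, G, P, Q and E stand for the modes of beta, gamma, p, q and - :beta gamma:,
   and [conv_GP] for those of p(x) gamma(x). *)
Section Realization.
Variables (K : numFieldType) (l : K) (Z : lmodType K) (B G P Q E : int -> Z -> Z).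
Hypothesis l_neq0 : l != 0.
Hypothesis Bl : forall n, linear (B n).
Hypothesis Gl : forall n, linear (G n).
Hypothesis Pl : forall n, linear (P n).
Hypothesis Ql : forall n, linear (Q n).
Hypothesis El : forall n, linear (E n).
Local Notation br := (@op_br K Z).
Local Notation delta m n := ((m + n == 0)%:R : K).
Hypothesis brBB : forall m n t, br (B m) (B n) t = 0.
Hypothesis brGG : forall m n t, br (G m) (G n) t = 0.
Hypothesis brBG : forall m n t, br (B m) (G n) t = delta m n *: t.
Hypothesis brPP : forall m n t, br (P m) (P n) t = 0.
Hypothesis brQQ : forall m n t, br (Q m) (Q n) t = 0.
Hypothesis brQP : forall m n t, br (Q m) (P n) t = (m%:~R * delta m n) *: t.
Hypothesis brEB : forall m n t, br (E m) (B n) t = B (m + n) t.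
Hypothesis brEG : forall m n t, br (E m) (G n) t = - G (m + n) t.
Hypothesis brEE : forall m n t, br (E m) (E n) t = - ((m%:~R * delta m n) *: t).
Hypothesis brPB : forall m n t, br (P m) (B n) t = 0.
Hypothesis brQB : forall m n t, br (Q m) (B n) t = 0.
Hypothesis brPG : forall m n t, br (P m) (G n) t = 0.
Hypothesis brQG : forall m n t, br (Q m) (G n) t = 0.
Hypothesis brPE : forall m n t, br (P m) (E n) t = 0.
Hypothesis brQE : forall m n t, br (Q m) (E n) t = 0.
Hypothesis GP_finite : forall n t, finite_supp (fun i => G (n - i) (P i t)).

Definition conv_GP n (t : Z) : Z := \sum_(i \in [set: int]) G (n - i) (P i t).

Definition op_b n t := (l * - n%:~R) *: G n t + conv_GP n t.
Definition op_d n t := l *: Q n t + ((2^-1 * l^-1) *: P n t + E n t).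

Lemma GP_linear n i : linear (fun t => G (n - i) (P i t)).
Proof. by move=> c t u; rewrite Pl Gl. Qed.

Lemma conv_linear n : linear (conv_GP n).
Proof. by apply: linear_fsum => [i|t]; [exact: GP_linear|exact: GP_finite]. Qed.

Lemma op_b_linear n : linear (op_b n).
Proof. exact: linear_comb (conv_linear n). Qed.

Lemma op_d_linear n : linear (op_d n).
Proof. by apply: linear_comb => //; apply: linear_comb. Qed.

Lemma br_conv (f : Z -> Z) n t : linear f -> br f (conv_GP n) t
  = \sum_(i \in [set: int]) (br f (G (n - i)) (P i t) + G (n - i) (br f (P i) t)).
Proof.
move=> fl; rewrite op_br_fsumr //.
by apply: eq_fsbigr => i _; rewrite op_br_comp.
Qed.

Lemma fsum0 (F : int -> Z) : (forall i, F i = 0) -> \sum_(i \in [set: int]) F i = 0.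
Proof. by move=> F0; apply: fsbig1 => i _; apply: F0. Qed.

Lemma brB_conv m n t : br (B m) (conv_GP n) t = P (m + n) t.
Proof.
rewrite br_conv // (@fsum_delta _ _ (m + n)) => [|i im].
  rewrite brBG op_brC brPB oppr0 (lin0 (Gl _)) addr0.
  by rewrite (_ : (m + (n - (m + n)) == 0) = true) ?scale1r //; lia.
rewrite brBG op_brC brPB oppr0 (lin0 (Gl _)) addr0.
by rewrite (_ : (m + (n - i) == 0) = false) ?scale0r //; lia.
Qed.

Lemma brG_conv m n t : br (G m) (conv_GP n) t = 0.
Proof.
rewrite br_conv //; apply: fsum0 => i.
by rewrite brGG op_brC brPG oppr0 (lin0 (Gl _)) addr0.
Qed.

Lemma brP_conv m n t : br (P m) (conv_GP n) t = 0.
Proof.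
rewrite br_conv //; apply: fsum0 => i.
by rewrite brPG brPP (lin0 (Gl _)) addr0.
Qed.

Lemma brQ_conv m n t : br (Q m) (conv_GP n) t = m%:~R *: G (m + n) t.
Proof.
rewrite br_conv // (@fsum_delta _ _ (- m)) => [|i im].
  by rewrite brQG brQP add0r subrr eqxx mulr1 (linZ (Gl _)) opprK addrC.
rewrite brQG brQP add0r (_ : (m + i == 0) = false) ?mulr0 ?scale0r ?(lin0 (Gl _)) //.
by lia.
Qed.

Lemma brE_conv m n t : br (E m) (conv_GP n) t = - conv_GP (m + n) t.
Proof.
rewrite br_conv // -[RHS]sub0r -[X in X - _](fsum0 (F := fun _ => 0)) //.
rewrite /conv_GP fsum_sub; [|by exists [::]|exact: GP_finite].
apply: eq_fsbigr => i _; rewrite brEG op_brC brPE oppr0 (lin0 (Gl _)) addr0 sub0r.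
by rewrite addrA.
Qed.

Lemma br_conv_conv m n t : br (conv_GP m) (conv_GP n) t = 0.
Proof.
rewrite br_conv; last exact: conv_linear.
apply: fsum0 => i; rewrite op_brC brG_conv op_brC brP_conv !oppr0 (lin0 (Gl _)).
exact: addr0.
Qed.

(** The product p gamma yields c, and l gamma' yields the central term: its coefficient -n equals m
    when m + n = 0. *)
Lemma br_ab m n t : br (B m) (op_b n) t = P (m + n) t + (m%:~R * delta m n * l) *: t.
Proof.
rewrite op_br_combr // brBG brB_conv addrC scalerA; congr (_ + _ *: _).
case: eqP => [mn|_]; last by rewrite !mulr0 mul0r.
by rewrite !mulr1 (_ : m = - n) ?mulrNz 1?mulrC //; lia.
Qed.

Lemma br_bb m n t : br (op_b m) (op_b n) t = 0.
Proof.
rewrite op_br_combr; last exact: op_b_linear.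
rewrite !op_br_combl //; last exact: conv_linear.
rewrite brGG brG_conv br_conv_conv op_brC brG_conv.
by rewrite !(oppr0, scaler0, addr0).
Qed.

Lemma br_cb m n t : br (P m) (op_b n) t = 0.
Proof. by rewrite op_br_combr // brPG brP_conv scaler0 addr0. Qed.

Lemma br_dX (f : Z -> Z) m t : linear f -> br (op_d m) f t
  = l *: br (Q m) f t + ((2^-1 * l^-1) *: br (P m) f t + br (E m) f t).
Proof. by move=> fl; rewrite !op_br_combl. Qed.

Lemma br_da m n t : br (op_d m) (B n) t = B (m + n) t.
Proof. by rewrite br_dX // brQB brPB brEB !scaler0 !add0r. Qed.

(** Two multiples of gamma(m + n) arise, l m from q against p gamma and l n from - :beta gamma:
    against l gamma'. Together they make the derivative term of -b(m + n). *)
Lemma br_db m n t : br (op_d m) (op_b n) t = - op_b (m + n) t.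
Proof.
rewrite br_dX; last exact: op_b_linear.
rewrite br_cb scaler0 add0r !op_br_combr // brQG brQ_conv brEG brE_conv.
rewrite scaler0 add0r scalerN addrA opprD; congr (_ - _).
by rewrite -scaleNr scalerA -scalerDl -scaleNr intrD; congr (_ *: _); ring.
Qed.

Lemma br_dc m n t : br (op_d m) (P n) t = (m%:~R * delta m n * l) *: t.
Proof.
rewrite br_dX // brQP brPP op_brC brPE oppr0 scaler0 !addr0 scalerA.
by rewrite mulrC.
Qed.

(** Each of the two brackets between l q and p / (2 l) contributes m / 2 when m + n = 0, and :beta
    gamma: contributes -m; this fixes the coefficient of p in d. *)
Lemma br_dd m n t : br (op_d m) (op_d n) t = 0.
Proof.
rewrite br_dX; last exact: op_d_linear.
rewrite !op_br_combr // brQQ brQP brQE brPP brPE [br (P m) _ _]op_brC brQP.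
rewrite [br (E m) (Q n) t]op_brC brQE [br (E m) (P n) t]op_brC brPE brEE.
rewrite !(oppr0, scaler0, addr0, add0r) !scalerN !scalerA.
case: (eqVneq (m + n) 0) => [mn|mn]; last first.
  by rewrite [n + m]addrC (negbTE mn) !(mulr0, scale0r, oppr0, addr0).
rewrite [n + m]addrC mn eqxx !mulr1 -!scaleNr -!scalerDl.
rewrite (_ : n = - m); last by lia.
rewrite mulrNz (_ : _ + _ = 0) ?scale0r //.
by field.
Qed.

Definition H4_op (h : H4 K) n (t : Z) : Z :=
  h 0 0 *: B n t + (h 0 1 *: op_b n t + (h 0 2 *: P n t + h 0 3 *: op_d n t)).

Lemma H4_op_linearl n t : linear (fun h => H4_op h n t).
Proof.
move=> c h k; rewrite /H4_op; move: (B n t) (op_b n t) (P n t) (op_d n t) => x y z u.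
rewrite !mxE !scalerDl -!scalerA !scalerDr.
by do 2!(rewrite [RHS]addrACA; congr (_ + _)); rewrite addrACA.
Qed.

Lemma H4_op_linearr h n : linear (H4_op h n).
Proof.
have dl : linear (fun t => h 0 3 *: op_d n t).
  by move=> c u v; rewrite op_d_linear scalerDr !scalerA mulrC.
apply: linear_comb => //; apply: linear_comb; first exact: op_b_linear.
exact: linear_comb.
Qed.

Lemma H4_op_a n t : H4_op (nwa K) n t = B n t.
Proof. by rewrite /H4_op /nwa !mxE /= scale1r !scale0r !addr0. Qed.
Lemma H4_op_b n t : H4_op (nwb K) n t = op_b n t.
Proof. by rewrite /H4_op /nwb !mxE /= scale1r !scale0r add0r !addr0. Qed.
Lemma H4_op_c n t : H4_op (nwc K) n t = P n t.
Proof. by rewrite /H4_op /nwc !mxE /= scale1r !scale0r !add0r addr0. Qed.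
Lemma H4_op_d n t : H4_op (nwd K) n t = op_d n t.
Proof. by rewrite /H4_op /nwd !mxE /= scale1r !scale0r !add0r. Qed.

Lemma H4_ind (R : H4 K -> Prop) :
  (forall c h k, R h -> R k -> R (c *: h + k)) ->
  R (nwa K) -> R (nwb K) -> R (nwc K) -> R (nwd K) -> forall h, R h.
Proof.
move=> Rl Ra Rb Rc Rd h.
(* The tail - d + d is a zero written as a combination of basis vectors, as the induction principle
   has no clause for 0. *)
have -> : h = h 0 0 *: nwa K + (h 0 1 *: nwb K + (h 0 2 *: nwc K
    + (h 0 3 *: nwd K + (-1 *: nwd K + nwd K)))).
  rewrite scaleN1r addNr addr0; apply/rowP => j; rewrite !mxE.
  by case: j => [[|[|[|[|j]]]] hj] //=; rewrite !(mulr1, mulr0, add0r, addr0);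
    congr (h _ _); apply/val_inj.
by do ?[apply: (Rl)].
Qed.

(** The relation is bilinear in h and k and stable under exchanging them, so ten pairs of basis
    vectors suffice. *)
Lemma H4_op_comm h k m n t :
  H4_op h m (H4_op k n t) - H4_op k n (H4_op h m t)
  = H4_op (lie h k) (m + n) t
    + ((m%:~R * Defs.form h k) *+ (m + n == 0) * l) *: t.
Proof.
pose C h k m n t := br (H4_op h m) (H4_op k n) t = H4_op (lie h k) (m + n) t
    + (m%:~R * delta m n * Defs.form h k * l) *: t.
suff Chk : forall m n t, C h k m n t.
  rewrite -[LHS]/(br (H4_op h m) (H4_op k n) t) Chk -[_ *+ (_ == _)]mulr_natr.
  by congr (_ + _ *: _); ring.
have opl n' t' := H4_op_linearl n' t'; have opr h' n' := H4_op_linearr h' n'.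
have C_comb c h1 h2 k' : (forall m n t, C h1 k' m n t) -> (forall m n t, C h2 k' m n t) ->
    forall m n t, C (c *: h1 + h2) k' m n t.
  move=> C1 C2 m' n' t'; rewrite /C.
  transitivity (c *: br (H4_op h1 m') (H4_op k' n') t' + br (H4_op h2 m') (H4_op k' n') t').
    rewrite -op_br_combl // /op_br; congr (_ - _); last first.
      by congr (H4_op k' n' _); apply: opl.
    exact: opl.
  rewrite C1 C2 lie_linearl opl form_linearl scalerDr scalerA addrACA -scalerDl.
  by congr (_ + _ *: _); ring.
(* In the central term the form is symmetric, but m changes sign under the exchange when m + n =
   0. *)
have C_sym h1 k1 : (forall m n t, C h1 k1 m n t) -> forall m n t, C k1 h1 m n t.
  move=> C1 m' n' t'; rewrite /C op_brC C1 opprD [n' + m']addrC (lieN k1 h1).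
  rewrite (linN (opl _ _)) (form_sym k1 h1) -scaleNr; congr (_ + _ *: _).
  have [mn|_] := eqVneq (m' + n') 0; last by rewrite !(mulr0, mul0r) oppr0.
  by rewrite (_ : n' = - m') ?mulrNz; [ring|lia].
have brE' h1 k1 f1 f2 m' n' t' : (forall s, H4_op h1 m' s = f1 s) ->
    (forall s, H4_op k1 n' s = f2 s) -> br (H4_op h1 m') (H4_op k1 n') t' = br f1 f2 t'.
  by move=> e1 e2; rewrite /op_br !e1 !e2.
have [ab da db [cd ca cb]] := @H4_lie_basis K.
have [fab fcd [faa fbb fcc fdd] [fac fad fbc fbd]] := @H4_form_basis K.
have op0 n' t' : H4_op 0 n' t' = 0 by exact: (lin0 (opl n' t')).
have opN h' n' t' : H4_op (- h') n' t' = - H4_op h' n' t' by exact: (linN (opl n' t')).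
have Caa m' n' t' : C (nwa K) (nwa K) m' n' t'.
  by rewrite /C (brE' _ _ _ _ _ _ _ (H4_op_a _) (H4_op_a _)) brBB lie_alt op0 faa
    mulr0 mul0r scale0r addr0.
have Cbb m' n' t' : C (nwb K) (nwb K) m' n' t'.
  by rewrite /C (brE' _ _ _ _ _ _ _ (H4_op_b _) (H4_op_b _)) br_bb lie_alt op0 fbb
    mulr0 mul0r scale0r addr0.
have Ccc m' n' t' : C (nwc K) (nwc K) m' n' t'.
  by rewrite /C (brE' _ _ _ _ _ _ _ (H4_op_c _) (H4_op_c _)) brPP lie_alt op0 fcc
    mulr0 mul0r scale0r addr0.
have Cdd m' n' t' : C (nwd K) (nwd K) m' n' t'.
  by rewrite /C (brE' _ _ _ _ _ _ _ (H4_op_d _) (H4_op_d _)) br_dd lie_alt op0 fdd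
    mulr0 mul0r scale0r addr0.
have Cab m' n' t' : C (nwa K) (nwb K) m' n' t'.
  by rewrite /C (brE' _ _ _ _ _ _ _ (H4_op_a _) (H4_op_b _)) br_ab ab fab H4_op_c mulr1.
have Cda m' n' t' : C (nwd K) (nwa K) m' n' t'.
  by rewrite /C (brE' _ _ _ _ _ _ _ (H4_op_d _) (H4_op_a _)) br_da da form_sym fad H4_op_a
    mulr0 mul0r scale0r addr0.
have Cdb m' n' t' : C (nwd K) (nwb K) m' n' t'.
  by rewrite /C (brE' _ _ _ _ _ _ _ (H4_op_d _) (H4_op_b _)) br_db db form_sym fbd opN H4_op_b
    mulr0 mul0r scale0r addr0.
have Cdc m' n' t' : C (nwd K) (nwc K) m' n' t'.
  by rewrite /C (brE' _ _ _ _ _ _ _ (H4_op_d _) (H4_op_c _)) br_dc lieN cd oppr0 op0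
    form_sym fcd add0r mulr1.
have Cca m' n' t' : C (nwc K) (nwa K) m' n' t'.
  by rewrite /C (brE' _ _ _ _ _ _ _ (H4_op_c _) (H4_op_a _)) brPB ca op0 form_sym fac
    mulr0 mul0r scale0r addr0.
have Ccb m' n' t' : C (nwc K) (nwb K) m' n' t'.
  by rewrite /C (brE' _ _ _ _ _ _ _ (H4_op_c _) (H4_op_b _)) br_cb cb op0 form_sym fbc
    mulr0 mul0r scale0r addr0.
have Crow h1 : (forall m n t, C h1 (nwa K) m n t) -> (forall m n t, C h1 (nwb K) m n t) ->
    (forall m n t, C h1 (nwc K) m n t) -> (forall m n t, C h1 (nwd K) m n t) ->
    forall k' m n t, C h1 k' m n t.
  move=> Ha Hb Hc Hd k'; apply: (C_sym).
  by elim/H4_ind: k' => [c x y||||] => *;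
    [apply: (C_comb)|apply: (C_sym)|apply: (C_sym)|apply: (C_sym)|apply: (C_sym)].
elim/H4_ind: h => [c x y Hx Hy||||].
- exact: (C_comb).
- by apply: (Crow) => //; apply: (C_sym).
- by apply: (Crow) => //; apply: (C_sym).
- by apply: (Crow) => //; apply: (C_sym).
- by apply: (Crow).
Qed.

End Realization.

(** * Operators on a tensor product *)

Section TensorOperators.
Variables (K : fieldType) (V W : lmodType K).
Local Notation T := (tens V W).

Lemma tens_linearl (w : W) : linear (fun v : V => v ⊗ w).
Proof. exact: btens_pure_linearl. Qed.

Lemma tens_linearr (v : V) : linear (fun w : W => v ⊗ w).
Proof. exact: btens_pure_linearr. Qed.

Lemma tens_ind (P : T -> Prop) : P 0 ->
  (forall x y, P x -> P y -> P (x + y)) -> (forall v w, P (v ⊗ w)) -> forall t, P t.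
Proof. exact: btens_ind. Qed.

Definition tmap (f : V -> V) (h : W -> W) : T -> T :=
  btens_lift (fun v w => f v ⊗ h w).

Section Map.
Variables (f : V -> V) (h : W -> W).
Hypotheses (fl : linear f) (hl : linear h).

Let bil w : linear (fun v => f v ⊗ h w).
Proof. by move=> c u v; rewrite fl tens_linearl. Qed.
Let bir v : linear (fun w => f v ⊗ h w).
Proof. by move=> c u w; rewrite hl tens_linearr. Qed.

Lemma tmapE v w : tmap f h (v ⊗ w) = f v ⊗ h w.
Proof. by apply: (btens_liftE bil bir); case. Qed.

Lemma tmap_linear : linear (tmap f h).
Proof. by apply: (btens_lift_linear bil bir); case. Qed.

End Map.

Lemma tens_eq_linear (Z : lmodType K) (f h : T -> Z) : linear f -> linear h ->
  (forall v w, f (v ⊗ w) = h (v ⊗ w)) -> forall t, f t = h t.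
Proof.
move=> fl hl e; elim/tens_ind => [|x y IHx IHy|//].
  by rewrite (lin0 fl) (lin0 hl).
by rewrite (linD fl) (linD hl); apply: congr2.
Qed.

Definition tmapl (f : V -> V) : T -> T := tmap f (fun w => w).
Definition tmapr (h : W -> W) : T -> T := tmap (fun v => v) h.

Lemma tmaplE f v w : linear f -> tmapl f (v ⊗ w) = f v ⊗ w.
Proof. by move=> fl; apply: tmapE. Qed.
Lemma tmaprE h v w : linear h -> tmapr h (v ⊗ w) = v ⊗ h w.
Proof. by move=> hl; apply: tmapE. Qed.
Lemma tmapl_linear f : linear f -> linear (tmapl f).
Proof. by move=> fl; apply: tmap_linear. Qed.
Lemma tmapr_linear h : linear h -> linear (tmapr h).
Proof. by move=> hl; apply: tmap_linear. Qed.

Lemma op_br_linear (U : lmodType K) (f h : U -> U) : linear f -> linear h ->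
  linear (op_br f h).
Proof.
by move=> fl hl c u v; rewrite /op_br !(fl, hl) scalerBr opprD addrACA.
Qed.

Lemma tmapl_scale c t : tmapl (fun v => c *: v) t = c *: t.
Proof.
have sl (U : lmodType K) : linear (fun u : U => c *: u).
  by move=> d u v; rewrite scalerDr !scalerA mulrC.
apply: tens_eq_linear t => [||v w]; [exact: tmapl_linear|exact: sl|].
by rewrite tmaplE // (linZ (tens_linearl w)).
Qed.

Lemma tmapr_scale c t : tmapr (fun v => c *: v) t = c *: t.
Proof.
have sl (U : lmodType K) : linear (fun u : U => c *: u).
  by move=> d u v; rewrite scalerDr !scalerA mulrC.
apply: tens_eq_linear t => [||v w]; [exact: tmapr_linear|exact: sl|].
by rewrite tmaprE // (linZ (tens_linearr v)).
Qed.

Lemma tmapl_br f h r t : linear f -> linear h -> linear r ->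
  (forall v, op_br f h v = r v) -> op_br (tmapl f) (tmapl h) t = tmapl r t.
Proof.
move=> fl hl rl e; apply: (@tens_eq_linear T) t => [||v w].
- by apply: op_br_linear; apply: tmapl_linear.
- exact: tmapl_linear.
rewrite /op_br (tmaplE v w hl) (tmaplE v w fl) (tmaplE (h v) w fl) (tmaplE (f v) w hl).
by rewrite (tmaplE v w rl) -e /op_br (linB (tens_linearl w)).
Qed.

Lemma tmapr_br f h r t : linear f -> linear h -> linear r ->
  (forall v, op_br f h v = r v) -> op_br (tmapr f) (tmapr h) t = tmapr r t.
Proof.
move=> fl hl rl e; apply: (@tens_eq_linear T) t => [||v w].
- by apply: op_br_linear; apply: tmapr_linear.
- exact: tmapr_linear.
rewrite /op_br (tmaprE v w hl) (tmaprE v w fl) (tmaprE v (h w) fl) (tmaprE v (f w) hl).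
by rewrite (tmaprE v w rl) -e /op_br (linB (tens_linearr v)).
Qed.

Lemma tmapr_tmapl_br f h t : linear f -> linear h -> op_br (tmapr h) (tmapl f) t = 0.
Proof.
move=> fl hl; rewrite -[RHS](scale0r t).
apply: (@tens_eq_linear T _ (fun t => 0 *: t)) t => [||v w].
- by apply: op_br_linear; [exact: tmapr_linear|exact: tmapl_linear].
- by move=> c u v; rewrite !scale0r scaler0 addr0.
rewrite /op_br (tmaplE v w fl) (tmaprE v w hl) (tmaprE (f v) w hl) (tmaplE v (h w) fl).
by rewrite subrr scale0r.
Qed.

End TensorOperators.

(** * The free field action on the tensor product *)

Section FreeField.
Variables (K : numFieldType) (l : K).
Variables (V : lmodType K) (beta gamma : int -> V -> V) (vac : V).
Hypothesis l_neq0 : l != 0.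
Hypothesis VW : weyl_vacuum_module beta gamma vac.
Variable alpha : heis K.
Local Notation M := (M1 alpha).
Local Notation T := (tens V M).
Let VM := weylv_module VW.
Let bl n : linear (beta n) := weyl_linear_beta VM n.
Let gl n : linear (gamma n) := weyl_linear_gamma VM n.

Let alpha0 : (fun h : heis K => Defs.form h alpha) 0 = 0.
Proof.
exact: (lin0 (f := fun h : heis K => Defs.form h alpha : K^o) (form_linearl alpha)).
Qed.

Lemma M1_mode_linear h n : linear (@M1_mode K alpha h n).
Proof. exact: affine_mode_linear. Qed.

Lemma M1_mode_br h k m n (w : M) : op_br (@M1_mode K alpha h m) (@M1_mode K alpha k n) w
  = (m%:~R * (m + n == 0)%:R * Defs.form h k) *: w.
Proof.
apply: etrans (@affine_mode_comm K (heis K) _ 1 alpha0 h k m n w) _.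
rewrite mulr1 -[_ *+ (_ == _)]mulr_natr [_ * _ * _%:R]mulrAC.
rewrite -[RHS]add0r; congr (_ + _).
exact: (lin0 (affine_mode_linearl _ w)).
Qed.

Lemma M1_mode_trunc h (w : M) : exists N : int, forall n, N <= n -> M1_mode h n w = 0.
Proof. exact: (@affine_mode_trunc K (heis K) _ 1 alpha0). Qed.

Local Notation p := (@M1_mode K alpha (heis_p K)).
Local Notation q := (@M1_mode K alpha (heis_q K)).
Let pl n : linear (p n) := M1_mode_linear (heis_p K) n.
Let ql n : linear (q n) := M1_mode_linear (heis_q K) n.
Let nl n : linear (fun v => - nord_mode beta gamma n v) := linear_opp (nord_linear VW n).

Let B n : T -> T := tmapl (beta n).
Let G n : T -> T := tmapl (gamma n).
Let P n : T -> T := tmapr (p n).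
Let Q n : T -> T := tmapr (q n).
Let E n : T -> T := tmapl (fun v => - nord_mode beta gamma n v).

Let scale_linear (U : lmodType K) (c : K) : linear (fun u : U => c *: u).
Proof. by move=> d u v; rewrite scalerDr !scalerA mulrC. Qed.

Let tmapl_br_scale f h c t : linear f -> linear h ->
  (forall v, op_br f h v = c *: v) -> op_br (tmapl f) (tmapl h) t = c *: t :> T.
Proof.
move=> fl hl e; apply: etrans (tmapl_br t fl hl (@scale_linear V c) e) _.
exact: tmapl_scale.
Qed.

Let tmapr_br_scale f h c t : linear f -> linear h ->
  (forall w, op_br f h w = c *: w) -> op_br (tmapr f) (tmapr h) t = c *: t :> T.
Proof.
move=> fl hl e; apply: etrans (tmapr_br t fl hl (@scale_linear M c) e) _.
exact: tmapr_scale.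
Qed.

Let brBB m n t : op_br (B m) (B n) t = 0.
Proof.
rewrite -[RHS](scale0r t); apply: tmapl_br_scale => // v.
by rewrite /op_br (weyl_beta_beta VM) subrr scale0r.
Qed.

Let brGG m n t : op_br (G m) (G n) t = 0.
Proof.
rewrite -[RHS](scale0r t); apply: tmapl_br_scale => // v.
by rewrite /op_br (weyl_gamma_gamma VM) subrr scale0r.
Qed.

Let brBG m n t : op_br (B m) (G n) t = (m + n == 0)%:R *: t.
Proof.
apply: tmapl_br_scale => // v; rewrite /op_br (weyl_beta_gamma VM).
by case: eqP; rewrite ?scale1r ?scale0r.
Qed.

Let brPP m n t : op_br (P m) (P n) t = 0.
Proof.
rewrite -[RHS](scale0r t); apply: tmapr_br_scale => // w.
rewrite M1_mode_br (_ : Defs.form _ _ = 0) ?mulr0 //.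
by rewrite /Defs.form /= /heis_form !mxE /=; ring.
Qed.

Let brQQ m n t : op_br (Q m) (Q n) t = 0.
Proof.
rewrite -[RHS](scale0r t); apply: tmapr_br_scale => // w.
rewrite M1_mode_br (_ : Defs.form _ _ = 0) ?mulr0 //.
by rewrite /Defs.form /= /heis_form !mxE /=; ring.
Qed.

Let brQP m n t : op_br (Q m) (P n) t = (m%:~R * (m + n == 0)%:R) *: t.
Proof.
apply: tmapr_br_scale => // w.
rewrite M1_mode_br (_ : Defs.form _ _ = 1) ?mulr1 //.
by rewrite /Defs.form /= /heis_form !mxE /=; ring.
Qed.

Let brEB m n t : op_br (E m) (B n) t = B (m + n) t.
Proof.
apply: tmapl_br => // v.
by rewrite /op_br (linN (bl n)) opprK addrC (beta_nord VW).
Qed.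

Let brEG m n t : op_br (E m) (G n) t = - G (m + n) t.
Proof.
have el : linear (fun v => - gamma (m + n) v) := linear_opp (gl _).
apply: etrans (tmapl_br t (nl m) (gl n) el _) _ => [v|].
  by rewrite /op_br (linN (gl n)) opprK addrC (gamma_nord VW).
apply: (@tens_eq_linear K V M T _ (fun t => - G (m + n) t)) t => [||v w].
- exact: tmapl_linear.
- exact/linear_opp/tmapl_linear.
by rewrite /G (tmaplE v w el) (tmaplE v w (gl _)) (linN (tens_linearl w)).
Qed.

Let brEE m n t : op_br (E m) (E n) t = - ((m%:~R * (m + n == 0)%:R) *: t).
Proof.
rewrite -scaleNr; apply: tmapl_br_scale => // v.
have Nl := nord_linear VW.
rewrite /op_br !(linN (Nl _)) !opprK scaleNr mulr_natr; exact: (nord_nord VW).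
Qed.

Let brPB m n t : op_br (P m) (B n) t = 0. Proof. exact: tmapr_tmapl_br. Qed.
Let brQB m n t : op_br (Q m) (B n) t = 0. Proof. exact: tmapr_tmapl_br. Qed.
Let brPG m n t : op_br (P m) (G n) t = 0. Proof. exact: tmapr_tmapl_br. Qed.
Let brQG m n t : op_br (Q m) (G n) t = 0. Proof. exact: tmapr_tmapl_br. Qed.
Let brPE m n t : op_br (P m) (E n) t = 0. Proof. exact: tmapr_tmapl_br. Qed.
Let brQE m n t : op_br (Q m) (E n) t = 0. Proof. exact: tmapr_tmapl_br. Qed.

Let Bl n : linear (B n). Proof. exact: tmapl_linear. Qed.
Let Gl n : linear (G n). Proof. exact: tmapl_linear. Qed.
Let Pl n : linear (P n). Proof. exact: tmapr_linear. Qed.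
Let Ql n : linear (Q n). Proof. exact: tmapr_linear. Qed.
Let El n : linear (E n). Proof. exact: tmapl_linear. Qed.

Let GPE n i v w : G n (P i (v ⊗ w)) = gamma n v ⊗ p i w.
Proof. by rewrite /P (tmaprE v w (pl i)) /G (tmaplE v _ (gl n)). Qed.

(** For large i the mode p(i) kills w, and for very negative i the mode gamma(n - i) kills v, so
    p(x) gamma(x) is well defined. *)
Let GP_finite n t : finite_supp (fun i => G (n - i) (P i t)).
Proof.
elim/tens_ind: t => [|x y [s1 h1] [s2 h2]|v w].
- by exists [::] => i _; rewrite (lin0 (Pl _)) (lin0 (Gl _)).
- exists (s1 ++ s2) => i; rewrite mem_cat negb_or => /andP[/h1 e1 /h2 e2].
  exact: (lin_add0 (GP_linear Gl Pl n i) e1 e2).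
- have [N vN] := weyl_trunc VW v; have [N' wN] := M1_mode_trunc (heis_p K) w.
  apply: (@finite_supp_int _ _ (`|N| + `|N'| + `|n|)) => i h; rewrite GPE.
    by rewrite wN ?(lin0 (tens_linearr _)) //; lia.
  have [_ ->] : beta (n - i) v = 0 /\ gamma (n - i) v = 0 by apply: vN; lia.
  exact: (lin0 (tens_linearl _)).
Qed.

Definition free_op (h : H4 K) (n : int) (t : T) : T := H4_op l B G P Q E h n t.

Lemma free_op_linearl n t : linear (fun h => free_op h n t).
Proof. exact: H4_op_linearl. Qed.

Lemma free_op_linearr h n : linear (free_op h n).
Proof. exact: (H4_op_linearr l Bl Gl Pl Ql El GP_finite). Qed.

Lemma free_op_comm h k m n t :
  free_op h m (free_op k n t) - free_op k n (free_op h m t)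
  = free_op (lie h k) (m + n) t
    + ((m%:~R * Defs.form h k) *+ (m + n == 0) * l) *: t.
Proof.
exact: (H4_op_comm l_neq0 Bl Gl Pl Ql El brBB brGG brBG brPP brQQ brQP brEB brEG
  brEE brPB brQB brPG brQG brPE brQE GP_finite).
Qed.

Lemma free_op_a n v w : free_op (nwa K) n (v ⊗ w) = beta n v ⊗ w.
Proof. by rewrite /free_op H4_op_a /B (tmaplE v w (bl n)). Qed.

Lemma free_op_b n v w : free_op (nwb K) n (v ⊗ w)
  = l *: (dgamma_mode gamma n v ⊗ w)
    + \sum_(i \in [set: int]) (gamma (n - i) v ⊗ p i w).
Proof.
apply: etrans (H4_op_b _ _ _ _ _ _ _ _) _; apply: (congr2 +%R).
  rewrite /G (tmaplE v w (gl n)) -scalerA -mulrNz; congr (_ *: _).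
  exact: (esym (linZ (tens_linearl w) _ _)).
by apply: eq_fsbigr => i _; apply: GPE.
Qed.

Lemma free_op_c n v w : free_op (nwc K) n (v ⊗ w) = v ⊗ p n w.
Proof. by rewrite /free_op H4_op_c /P (tmaprE v w (pl n)). Qed.

Lemma free_op_d n v w : free_op (nwd K) n (v ⊗ w)
  = l *: (v ⊗ q n w) + (2^-1 * l^-1) *: (v ⊗ p n w) - nord_mode beta gamma n v ⊗ w.
Proof.
apply: etrans (H4_op_d _ _ _ _ _ _ _ _) _; apply: etrans (addrA _ _ _) _.
apply: (congr2 +%R).
  apply: (congr2 +%R); first exact: congr1 (tmaprE v w (ql n)).
  exact: congr1 (tmaprE v w (pl n)).
exact: etrans (tmaplE v w (nl n)) (linN (tens_linearl w) _).
Qed.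

(** The case of interest is p gamma: for n beyond the sum of both bounds, either i is large enough
    for p(i) to kill w, or n - i is large enough for gamma(n - i) to kill v. *)
Lemma free_op_trunc h t : exists N : int, forall n, N <= n -> free_op h n t = 0.
Proof.
have opl n' t' := free_op_linearl n' t'; have opr h' n' := free_op_linearr h' n'.
elim/tens_ind: t => [|x y [N xN] [N' yN]|v w].
- by exists 0 => n _; apply: (lin0 (opr h n)).
- exists (Order.max N N') => n; rewrite ge_max => /andP[/xN e1 /yN e2].
  exact: (lin_add0 (opr h n) e1 e2).
have [N1 vN] := weyl_trunc VW v.
have [N2 pN] := M1_mode_trunc (heis_p K) w.
have [N3 qN] := M1_mode_trunc (heis_q K) w.
have tl w' := lin0 (tens_linearl (V := V) (W := M) w').
have tr v' := lin0 (tens_linearr (V := V) (W := M) v').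
elim/H4_ind: h => [c h k [N hN] [N' kN]||||].
- exists (Order.max N N') => n; rewrite ge_max => /andP[/hN e1 /kN e2].
  by rewrite opl e1 e2 scaler0 addr0.
- by exists N1 => n /vN[e _]; rewrite free_op_a e tl.
- exists (`|N1| + `|N2| + 1) => n hn; rewrite free_op_b.
  have [_ e] : beta n v = 0 /\ gamma n v = 0 by apply: vN; lia.
  rewrite /dgamma_mode e scaler0 tl scaler0 add0r; apply: fsbig1 => i _.
  case: (lerP N2 i) => [/pN ->|iN]; first exact: tr.
  have [_ ->] : beta (n - i) v = 0 /\ gamma (n - i) v = 0 by apply: vN; lia.
  exact: tl.
- by exists N2 => n /pN e; rewrite free_op_c e tr.
- have [N4 nN] := nord_mode_trunc VW v.
  exists (Order.max N2 (Order.max N3 N4)) => n.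
  rewrite !ge_max => /andP[/pN e1 /andP[/qN e2 /nN e3]].
  by rewrite free_op_d e1 e2 e3 !tr tl !scaler0 addr0 subr0.
Qed.

End FreeField.

Theorem corollary5p6 (R : realType) (l : R[i]) (l_neq0 : l != 0)
  (Y : VH4 l -> int -> VH4 l -> VH4 l)
  (VH4_va : vertex_algebra Y (VH4_vac l))
  (VH4_gen : forall (h : H4 R[i]) (n : int) (v : VH4 l),
     Y (VH4_mode h (-1) (VH4_vac l)) n v = VH4_mode h n v)
  (VA : lmodType R[i]) (beta gamma : int -> VA -> VA) (vac : VA)
  (VA_weyl : weyl_vacuum_module beta gamma vac)
  (alpha : heis R[i]) :
  let W := tens VA (M1 alpha) in
  let p := fun (n : int) (w : M1 alpha) => M1_mode (heis_p R[i]) n w in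
  let q := fun (n : int) (w : M1 alpha) => M1_mode (heis_q R[i]) n w in
  exists (rho : affine (H4 R[i]) -> W -> W) (YW : VH4 l -> int -> W -> W),
  [/\ lie_module rho,
      forall w : W, rho (acentral (H4 R[i])) w = l *: w,
      va_module Y (VH4_vac l) YW,
      forall (h : H4 R[i]) (n : int) (w : W),
        YW (VH4_mode h (-1) (VH4_vac l)) n w = rho (amode h n) w
    & forall (n : int) (v : VA) (w : M1 alpha),
      [/\ rho (amode (nwa R[i]) n) (v ⊗ w) = beta n v ⊗ w,
          rho (amode (nwb R[i]) n) (v ⊗ w) =
            l *: (dgamma_mode gamma n v ⊗ w)
            + \sum_(i \in [set: int]) (gamma (n - i) v ⊗ p i w),
          rho (amode (nwc R[i]) n) (v ⊗ w) = v ⊗ p n w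
        & rho (amode (nwd R[i]) n) (v ⊗ w) =
            l *: (v ⊗ q n w) + (2^-1 * l^-1) *: (v ⊗ p n w)
            - nord_mode beta gamma n v ⊗ w]].
Proof.
move=> W p q.
have Fl := @free_op_linearl R[i] l VA beta gamma alpha.
have Fr := @free_op_linearr R[i] l VA beta gamma vac l_neq0 VA_weyl alpha.
have Fc := @free_op_comm R[i] l VA beta gamma vac l_neq0 VA_weyl alpha.
have Ft := @free_op_trunc R[i] l VA beta gamma vac l_neq0 VA_weyl alpha.
(* The same operators [free_op] define both structures, so the required agreement of the modes of
   [YW] with [rho] is immediate. *)
have [YW [YW_module YWE]] :=
  @restricted_va_module R[i] (H4 R[i]) l Y VH4_va VH4_gen W _ Fl Fr Fc Ft.
have repE h n w := affine_rep_amode l Fl h n w.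
exists (affine_rep (free_op l beta gamma (alpha := alpha)) l), YW; split.
- exact: affine_rep_lie_module.
- exact: affine_rep_acentral.
- exact: YW_module.
- by move=> h n w; apply: etrans (YWE h n w) (esym (repE h n w)).
move=> n v w; split; apply: etrans (repE _ _ _) _.
- exact: (free_op_a l VA_weyl).
- exact: (free_op_b l VA_weyl).
- exact: free_op_c.
- exact: (free_op_d l VA_weyl).
Qed.
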